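(* Let $r>0$ and $E=\mathbb{R}\times\{0,r\}$ with the Euclidean distance $d$, and let $0<p\le1$. Let $\widehat\Pi$ be a homogeneous Poisson process on $\mathbb{R}$ with rate $1$. Independently for each $X\in\widehat\Pi$: with probability $1-p$ make $X$ a point of both $\Pi^0$ and $\Pi^r$; with probability $p$ assign $X$ to exactly one of $\Pi^0$ and $\Pi^r$, each being chosen with probability $1/2$. Let $\Pi=(\Pi^0\times\{0\})\cup(\Pi^r\times\{r\})$, a point process on $E$. Then, for any $p>0$, the greedy walk on $\Pi$ starting from $S_0=(0,0)$ almost surely visits all points of $\Pi$.
   Context: Greedy walk: given a simple point process $\Pi$ (viewed as a random set of points) in a metric space $(E,d)$ and a starting point $S_0\in E$, the greedy walk $(S_n)_{n\ge0}$ on $\Pi$ is defined recursively by $S_{n+1}=\arg\min\{d(X,S_n): X\in\Pi,\ X\notin\{S_0,S_1,\dots,S_n\}\}$. For the process considered here every step is almost surely uniquely defined. *)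

(* Defs.v *)
From HB Require Import structures.
From mathcomp Require Import all_boot all_order all_algebra finmap.
From mathcomp Require Import all_classical all_reals all_analysis.
From mathcomp Require Import measurable_realfun.

Set Implicit Arguments.
Unset Strict Implicit.
Unset Printing Implicit Defensive.

Import Order.TTheory GRing.Theory Num.Theory.
Import numFieldNormedType.Exports.

Local Open Scope classical_set_scope.
Local Open Scope ring_scope.

Section greedy_walk.
Context {E : Type} {R : realType}.

Definition argmin (f : E -> R) (A : set E) : set E :=
  [set x | A x /\ forall y, A y -> f x <= f y].

Definition greedy_walk (dist : E -> E -> R) (Pi : set E) (s0 : E)
    (S : nat -> E) : Prop :=
  S 0%N = s0 /\
  forall n, argmin (dist^~ (S n)) (Pi `\` [set S i | i in `I_n.+1]) (S n.+1).

End greedy_walk.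

(* The norm that the library puts on R * R is the sup norm, hence this one. *)
Definition euclidean_dist {R : realType} (x y : R * R) : R :=
  Num.sqrt ((x.1 - y.1) ^+ 2 + (x.2 - y.2) ^+ 2).

Definition mutually_independent {d} {Omega : measurableType d} {R : realType}
    (P : probability Omega R) {I : choiceType}
    (F : I -> set (set Omega)) : Prop :=
  forall (J : {fset I}) (A : I -> set Omega),
    (forall i, i \in J -> F i (A i)) ->
    P (\bigcap_(i in [set` J]) A i) = (\prod_(i <- J) P (A i))%E.

Definition sigma_fun {d d'} {Omega : measurableType d} {T : measurableType d'}
    (X : Omega -> T) : set (set Omega) :=
  preimage_set_system [set: Omega] X measurable.

Section point_processes.
Context {d} {Omega : measurableType d} {R : realType}.
Variable P : probability Omega R.

Definition num_points (Pi : Omega -> set R) (A : set R) (w : Omega) : \bar R :=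
  counting (Pi w `&` A).

(* The second argument of [poisson_prob] is a dummy; at rate 0 (Lebesgue-null
   sets) [poisson_prob] is the Dirac mass at 0, whereas [poisson_pmf] takes a
   junk value there. *)
Definition homogeneous_poisson_process (lambda : R) (Pi : Omega -> set R)
    : Prop :=
  [/\ forall A : set R, measurable A ->
        measurable_fun [set: Omega] (num_points Pi A),
      forall A : set R, measurable A -> (lebesgue_measure A < +oo)%E ->
        forall k : nat,
          P [set w | num_points Pi A w = k%:R%:E] =
          poisson_prob (lambda * fine (lebesgue_measure A)) 0%N [set k] &
      forall A : nat -> set R, (forall i, measurable (A i)) ->
        trivIset [set: nat] A ->
        mutually_independent P (fun i => sigma_fun (num_points Pi (A i)))].

(* Points are attributed through a measurable enumeration (X n) of Pihat, which
   is almost surely infinite; the two components of the mark M n say whether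
   X n belongs to Pi0, respectively to Pir.  The index None of the independent
   family stands for the whole sequence X. *)
Definition independent_attribution (p : R) (Pihat Pi0 Pir : Omega -> set R)
    : Prop :=
  exists (X : nat -> {RV P >-> R}) (M : nat -> {RV P >-> (bool * bool)%type}),
  [/\ {ae P, forall w, set_bij [set: nat] (Pihat w) (fun n => X n w)},
      forall n, [/\ P [set w | M n w = (true, true)] = (1 - p)%:E,
                    P [set w | M n w = (true, false)] = (p / 2)%:E &
                    P [set w | M n w = (false, true)] = (p / 2)%:E],
      mutually_independent P (fun o : option nat =>
        if o is Some n then sigma_fun (M n)
        else <<s \bigcup_n sigma_fun (X n) >>) &
      {ae P, forall w,
        Pi0 w = [set X n w | n in [set n | (M n w).1]] /\
        Pir w = [set X n w | n in [set n | (M n w).2]]}].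

End point_processes.

(* Main.v *)
Require Import Defs.
From HB Require Import structures.
From mathcomp Require Import all_boot all_order all_algebra finmap.
From mathcomp Require Import all_classical all_reals all_analysis.
From mathcomp Require Import measurable_realfun.
From mathcomp Require Import ring lra zify.

Set Implicit Arguments.
Unset Strict Implicit.
Unset Printing Implicit Defensive.

Import Order.TTheory GRing.Theory Num.Theory.
Import numFieldNormedType.Exports.

Local Open Scope classical_set_scope.
Local Open Scope ring_scope.

(** A greedy walk on a locally finite set leaves every bounded region
    ([greedy_walk_unbounded]), and far away from a point [X] that it misses it cannot
    change sides, because the step to [X] would be shorter ([walk_transient]). So a
    walk that misses a point tends to one of the two infinities. A reflection
    exchanges the two cases, and it remains to exclude, almost surely, a walk from
    the origin that misses a point and tends to plus infinity
    ([ae_no_right_escape]).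

    Such a walk has short steps, since each of them competes with the step to [X].
    When it moves back it clears everything to its right ([unvisited_behind_left]);
    hence after its last visit to the left of [r] it is, up to its starting point,
    the greedy walk on the part of the configuration to the right of some rational
    number [c] ([transient_short_continuation]). If this happened with positive
    probability, then for suitable rational parameters the walk that is started just
    before [c] would, with positive probability, never make a step that is long
    enough to lead it to a place more than [L] to the left of [c]; this is the event
    [~ long], which depends only on what is to the right of [c].

    This is refuted by a stationarity argument. A block is a pattern of cells which
    has positive probability because some points are on one line only
    ([block_positive]). It forces a walk that comes from its left to cross it along
    one line and to leave points of the other line behind ([block_crossing]). From
    then on the walk agrees with the walk that is started at the end of the block, as
    long as the latter makes no long step ([coalescence]). Call a block escaping if
    the walk that is started at its end never makes a long step. A block and the
    configuration behind its end being independent, blocks would escape with positive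
    probability. Seen from an escaping block, the previous ones come in distances
    whose growth can be controlled with a probability near to 1, because the
    probabilities that a block escapes and the [t] preceding ones do not are summable
    in [t] ([anchored_positive]). Now let such a block be followed by a long empty interval,
    and consider the walk from an escaping block further left. When it arrives at the
    gap, the points that were left behind in the last block are nearer than the other
    side of the gap. After their visit the way across the gap has become longer, and
    the points left behind in the preceding escaping block are again nearer, and so
    on: the walk goes all the way back, which contradicts the choice of its starting
    block ([no_escape]). Therefore no block further left escapes. With positive
    probability some block beyond the gap does, so there would be, up to a bounded
    indeterminacy, a first escaping block. Its position would be equally
    likely to be at each of infinitely many places, which is impossible
    ([escaping_null]).

    All of this uses the random configuration only through the probabilities that a
    pair of sets contains no point of the respective line ([thinned_pair]). They
    follow from the hypotheses by summation over the indices of the points in these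
    sets ([avoided_law]), and they imply stationarity ([event_translation]), the
    independence of disjoint regions ([event_independent]) and the absence of ties
    ([ae_no_ties]). *)

(** * Greedy paths on two lines *)

Section geometry.
Context {R : realType} (r : R).
Hypothesis r_gt0 : 0 < r.
Implicit Types (Z : set (R * R)) (s t u v : R * R) (p : nat -> R * R).

Definition height (l : bool) : R := if l then r else 0.

Definition two_lines Z := forall z, Z z -> exists l, z.2 = height l.

Definition sqdist s t : R := (s.1 - t.1) ^+ 2 + (s.2 - t.2) ^+ 2.

Lemma sqdistC s t : sqdist s t = sqdist t s.
Proof. by rewrite /sqdist -(opprB t.1) -(opprB t.2) !sqrrN. Qed.

Lemma sqdist_ge0 s t : 0 <= sqdist s t.
Proof. by rewrite addr_ge0// sqr_ge0. Qed.

Lemma euclidean_dist_le s t u v :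
  (euclidean_dist s t <= euclidean_dist u v) = (sqdist s t <= sqdist u v).
Proof. by rewrite /euclidean_dist ler_sqrt ?sqdist_ge0// addr_ge0 ?sqr_ge0. Qed.

Lemma sqdist_same s t : s.2 = t.2 -> sqdist s t = (s.1 - t.1) ^+ 2.
Proof. by rewrite /sqdist => ->; rewrite subrr expr0n addr0. Qed.

Lemma sqdist_other s t l m : s.2 = height l -> t.2 = height m -> l != m ->
  sqdist s t = (s.1 - t.1) ^+ 2 + r ^+ 2.
Proof.
rewrite /sqdist => -> ->; case: l; case: m => //= _; congr (_ + _).
  by rewrite subr0.
by rewrite sub0r sqrrN.
Qed.

(** The last point of [p] up to time [n] is included: a greedy path never
    returns to a point, the starting point included. *)
Definition unvisited p n u := forall i, (i <= n)%N -> p i <> u.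

Definition greedy_step Z p n :=
  argmin (euclidean_dist^~ (p n)) (Z `\` [set p i | i in `I_n.+1]) (p n.+1).

Definition greedy_path Z s n p := p 0%N = s /\
  forall i, (i < n)%N -> greedy_step Z p i.

Lemma greedy_stepP Z p n : greedy_step Z p n <->
  [/\ Z (p n.+1), unvisited p n (p n.+1) &
      forall u, Z u -> unvisited p n u ->
        sqdist (p n) (p n.+1) <= sqdist (p n) u].
Proof.
have unvP u : unvisited p n u <-> ~ [set p i | i in `I_n.+1] u.
  split=> [H [i /= iltn pi]|H i ile pi]; first exact: (H i iltn pi).
  by apply: H; exists i.
rewrite /greedy_step /argmin /=; split.
- move=> [[Zp npi] H]; split=> //; first exact/unvP.
  move=> u Zu /unvP uu; have := H u (conj Zu uu).
  by rewrite euclidean_dist_le sqdistC (sqdistC u).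
- move=> [Zp /unvP up H]; split=> // u [Zu /unvP uu].
  by rewrite euclidean_dist_le sqdistC (sqdistC u); exact: H.
Qed.

Lemma greedy_walk_path Z s W : greedy_walk euclidean_dist Z s W <->
  forall n, greedy_path Z s n W.
Proof.
split=> [[W0 H] n|H]; first by split=> // i _; exact: H.
by split=> [|n]; [case: (H 0%N)|case: (H n.+1) => _; apply].
Qed.

Lemma greedy_path_le Z s m n p : (m <= n)%N ->
  greedy_path Z s n p -> greedy_path Z s m p.
Proof. by move=> mn [p0 H]; split=> // i im; apply: H; exact: leq_trans mn. Qed.

Lemma unvisited_le p m n u : (m <= n)%N -> unvisited p n u -> unvisited p m u.
Proof. by move=> mn H i im; apply: H; exact: leq_trans mn. Qed.

Lemma pair_neq1 s t : s.2 = t.2 -> s <> t -> s.1 != t.1.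
Proof.
by case: s => s1 s2; case: t => t1 t2 /= -> st; apply/eqP => h; apply: st; rewrite h.
Qed.

Lemma sqr_le_neg (x y : R) : x ^+ 2 <= y ^+ 2 -> y <= 0 -> y <= x <= - y.
Proof.
move=> h y0; apply/andP; split; rewrite leNgt; apply/negP => hh.
  by move: h; apply/negP; rewrite -ltNge !expr2; nra.
by move: h; apply/negP; rewrite -ltNge !expr2; nra.
Qed.

Lemma sqr_le_right (x y z : R) : x <= y -> y <= z ->
  (x - y) ^+ 2 <= (x - z) ^+ 2.
Proof.
move=> xy yz; rewrite -(sqrrN (x - y)) -(sqrrN (x - z)) !opprB.
by rewrite ler_pXn2r ?nnegrE ?subr_ge0 ?lerD2r//; exact: le_trans yz.
Qed.

(** Two unvisited points on different lines at horizontal distance at most [r]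
    cannot both be left behind: a jump over one of them stays on the opposite
    line and changing line costs at least [r], so a path that comes from the
    left remains, on each of the two lines, to the left of the point there. *)
Lemma close_pair_not_passed Z s n p a b l :
  two_lines Z -> s.2 = height l -> greedy_path Z s n p ->
  Z a -> Z b -> a.2 != b.2 -> b.1 <= a.1 <= b.1 + r -> s.1 < b.1 ->
  unvisited p n a -> unvisited p n b ->
  forall i, (i <= n)%N ->
  ((p i).2 = a.2 /\ (p i).1 < a.1) \/ ((p i).2 = b.2 /\ (p i).1 < b.1).
Proof.
move=> ZE sl [p0 H] Za Zb ab /andP[ba abr] sb ua ub.
have [la ha] := ZE _ Za; have [lb hb] := ZE _ Zb.
have lab : la != lb by apply: contraNneq ab => e; rewrite ha hb e.
have two k : k = la \/ k = lb by move: lab; case: k; case: la {ha}; case: lb {hb}; auto.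
elim=> [_|i IH iltn].
  rewrite p0 sl ha hb; case: (two l) => ->; [left|right]; split=> //.
  exact: lt_le_trans sb ba.
have /greedy_stepP[Zt ut st] := H i iltn.
have {}IH := IH (ltnW iltn).
have sta := st a Za (unvisited_le (ltnW iltn) ua).
have stb := st b Zb (unvisited_le (ltnW iltn) ub).
have [lt ht] := ZE _ Zt.
have ta : p i.+1 <> a by exact: ua.
have tb : p i.+1 <> b by exact: ub.
have r0 := sqr_ge0 ((p i).1 - (p i.+1).1).
case: (two lt) => e0; rewrite {}e0 in ht; [left|right]; split; rewrite ?ht ?ha ?hb //.
- have ne : (p i.+1).2 = a.2 by rewrite ht ha.
  have n1 := pair_neq1 ne ta.
  case: IH => [[e x]|[e x]].
    move: sta; rewrite !sqdist_same ?e ?ht ?ha// => /sqr_le_neg h.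
    by move: n1; rewrite neq_lt => /orP[|] n1; lra.
  move: stb; rewrite (sqdist_other (l:=lb) (m:=la)) ?e 1?eq_sym//.
  rewrite sqdist_same// => h.
  have /sqr_le_neg h' : ((p i).1 - (p i.+1).1) ^+ 2 <= ((p i).1 - b.1) ^+ 2.
    by apply: le_trans h; rewrite lerDl sqr_ge0.
  have {}h : ((p i).1 - (p i.+1).1) ^+ 2 < ((p i).1 - b.1) ^+ 2.
    by apply: lt_le_trans h; rewrite ltrDl exprn_gt0.
  have : (p i).1 - b.1 != (p i).1 - (p i.+1).1.
    by apply: contraTneq h => ->; rewrite ltxx.
  by rewrite neq_lt => /orP[|] n2; lra.
- have ne : (p i.+1).2 = b.2 by rewrite ht hb.
  have n1 := pair_neq1 ne tb.
  case: IH => [[e x]|[e x]]; last first.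
    move: stb; rewrite !sqdist_same ?e ?ht ?hb// => /sqr_le_neg h.
    by move: n1; rewrite neq_lt => /orP[|] n1; lra.
  move: sta; rewrite (sqdist_other (l:=la) (m:=lb)) ?e//.
  rewrite sqdist_same ?e// => h1.
  have /sqr_le_neg h2 : (- r) ^+ 2 <= ((p i).1 - a.1) ^+ 2.
    by apply: le_trans h1; rewrite sqrrN lerDr sqr_ge0.
  move: stb; rewrite !(sqdist_other (l:=la) (m:=lb)) ?e//.
  rewrite lerD2r => /sqr_le_neg h3.
  by move: n1; rewrite neq_lt => /orP[|] n1; lra.
Qed.

Lemma path_height Z s n p l : two_lines Z -> s.2 = height l ->
  greedy_path Z s n p -> forall i, (i <= n)%N -> exists m, (p i).2 = height m.
Proof.
move=> ZE sl [p0 H] [|i] iltn; first by exists l; rewrite p0.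
by have /greedy_stepP[Zt _ _] := H i iltn; exact: ZE.
Qed.

Lemma height_eq l m : (height l == height m) = (l == m).
Proof.
by case: l; case: m; rewrite /= ?eqxx ?(gt_eqF r_gt0) ?(lt_eqF r_gt0).
Qed.

Lemma far_jump (x y z : R) : z <= x -> y + r < z ->
  (x - z) ^+ 2 + r ^+ 2 < (x - y) ^+ 2.
Proof.
move=> zx yz; have r0 := r_gt0; have h : x - z + r < x - y by lra.
apply: (@le_lt_trans _ _ ((x - z + r) ^+ 2)).
  rewrite (sqrrD (x - z)) lerD2r lerDl mulrn_wge0// mulr_ge0 ?subr_ge0//; exact: ltW.
by rewrite ltr_pXn2r ?nnegrE//; lra.
Qed.

(** Behind the record position nothing is left to the right of the walker: a
    jump to the left over an unvisited point would have to start and end on the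
    opposite line, and its end point would form with the skipped point a close
    pair that was passed, unless it is longer than the way to the skipped
    point. *)
Lemma unvisited_behind_left Z s n p u j l :
  two_lines Z -> s.2 = height l -> greedy_path Z s n p ->
  Z u -> unvisited p n u -> s.1 + r < u.1 -> (j <= n)%N -> u.1 < (p j).1 ->
  u.1 <= (p n).1.
Proof.
move=> ZE sl; elim: n j => [|n IH] j pn Zu un su.
  by rewrite leqn0 => /eqP ->; case: pn => -> _; lra.
rewrite leq_eqVlt => /orP[/eqP ->|jn] uj; first exact: ltW.
rewrite leNgt; apply/negP => tu.
have pn' := greedy_path_le (leqnSn n) pn.
have un' := unvisited_le (leqnSn n) un.
have uS := IH j pn' Zu un' su jn uj.
have /greedy_stepP[Zt ut st] := pn.2 n (ltnSn n).
have [lu hu] := ZE _ Zu; have [lt ht] := ZE _ Zt.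
have [lS hS] := path_height ZE sl pn' (leqnn n).
have {}st := st u Zu un'.
have := sqr_ge0 r; move: st; have [eSt|nSt] := eqVneq lS lt; last first.
  rewrite (sqdist_other (l:=lS) (m:=lt))//; have [eSu|nSu] := eqVneq lS lu.
    rewrite sqdist_same ?hS ?hu ?eSu// => h r2.
    suff : ((p n).1 - u.1) ^+ 2 < ((p n).1 - (p n.+1).1) ^+ 2 by lra.
    by rewrite !expr2; nra.
  rewrite (sqdist_other (l:=lS) (m:=lu))// => h r2.
  suff : ((p n).1 - u.1) ^+ 2 < ((p n).1 - (p n.+1).1) ^+ 2 by lra.
  by rewrite !expr2; nra.
rewrite sqdist_same ?hS ?ht ?eSt//; have [eSu|nSu] := eqVneq lS lu.
  rewrite sqdist_same ?hS ?hu ?eSu// => h r2.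
  suff : ((p n).1 - u.1) ^+ 2 < ((p n).1 - (p n.+1).1) ^+ 2 by lra.
  by rewrite !expr2; nra.
rewrite (sqdist_other (l:=lS) (m:=lu))// => h r2.
have far : (p n.+1).1 + r < u.1.
  have [ts|ts] := leP (p n.+1).1 s.1; first lra.
  rewrite ltNge; apply/negP => utr.
  have nh : u.2 != (p n.+1).2 by rewrite hu ht height_eq -eSt eq_sym.
  have := @close_pair_not_passed Z s n p u (p n.+1) l ZE sl pn' Zu Zt nh.
  rewrite utr (ltW tu) => /(_ isT ts un' ut j jn).
  by case=> [[_ ?]|[_ ?]]; lra.
by move: h; apply/negP; rewrite -ltNge; exact: far_jump.
Qed.

(** This allows one to replace the position of a walker by one further to the right
    without a change of the next point. *)
Lemma nearest_shift s e q w l ls lw :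
  s.2 = height ls -> e.2 = height l -> q.2 = height l -> w.2 = height lw ->
  s.1 <= e.1 -> e.1 <= q.1 -> e.1 <= w.1 ->
  sqdist s q <= sqdist s w -> sqdist e q <= sqdist e w.
Proof.
move=> hs he hq hw se eq ew; have r2 := sqr_ge0 r.
have [ls_l|ls_l] := eqVneq ls l; have [lw_l|lw_l] := eqVneq lw l.
- rewrite !sqdist_same ?hs ?he ?hq ?hw ?ls_l ?lw_l// => /sqr_le_neg h.
  by apply: sqr_le_right => //; lra.
- rewrite (sqdist_same (t:=q)) ?hs ?hq ?ls_l//.
  rewrite (sqdist_other (t:=w) (l:=ls) (m:=lw))//; last by rewrite ls_l eq_sym.
  rewrite (sqdist_same (t:=q)) ?he ?hq//.
  rewrite (sqdist_other (t:=w) (l:=l) (m:=lw))//; last by rewrite eq_sym.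
  move=> h; have [qw|wq] := leP q.1 w.1.
    by have := sqr_le_right eq qw; lra.
  have h1 : 0 <= (q.1 - w.1) * (e.1 - s.1) by apply: mulr_ge0; lra.
  have h2 : (s.1 - q.1) ^+ 2 - (s.1 - w.1) ^+ 2 =
    (e.1 - q.1) ^+ 2 - (e.1 - w.1) ^+ 2 + 2 * ((q.1 - w.1) * (e.1 - s.1)).
    by ring.
  by lra.
- rewrite (sqdist_other (t:=q) (l:=ls) (m:=l))//.
  rewrite (sqdist_other (t:=w) (l:=ls) (m:=l)) ?hw ?lw_l//.
  rewrite !sqdist_same ?he ?hq ?hw ?lw_l// lerD2r => /sqr_le_neg h.
  by apply: sqr_le_right => //; lra.
- have e0 : lw = ls by move: ls_l lw_l; case: (lw); case: (ls); case: (l).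
  rewrite (sqdist_other (t:=q) (l:=ls) (m:=l))//.
  rewrite (sqdist_same (t:=w)) ?hs ?hw ?e0//.
  rewrite (sqdist_same (t:=q)) ?he ?hq//.
  rewrite (sqdist_other (t:=w) (l:=l) (m:=lw))//; last by rewrite eq_sym.
  move=> h; have /sqr_le_neg {}h : (s.1 - q.1) ^+ 2 <= (s.1 - w.1) ^+ 2 by lra.
  have qw : q.1 <= w.1 by lra.
  by have := sqr_le_right eq qw; lra.
Qed.

End geometry.

(** * Existence and uniqueness of greedy walks *)

Section walks.
Context {R : realType} (r : R).
Hypothesis r_gt0 : 0 < r.
Implicit Types (Z : set (R * R)) (s t u v : R * R) (p : nat -> R * R).

Definition locally_finite Z :=
  forall a b, finite_set (Z `&` [set z | a <= z.1 <= b]).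

Lemma locally_finite_sub Z Z' : Z' `<=` Z -> locally_finite Z ->
  locally_finite Z'.
Proof. by move=> ZZ H a b; apply: sub_finite_set (H a b) => z [/ZZ]. Qed.

Lemma seq_argmin (T : eqType) (f : T -> R) (x : T) (q : seq T) : x \in q ->
  exists2 y, y \in q & forall z, z \in q -> f y <= f z.
Proof.
elim: q x => //= a q IH x; case: q IH => [|b q] IH xq.
  by exists a; rewrite ?inE// => z; rewrite inE => /eqP ->.
have [y yq H] := IH b (mem_head _ _).
have [fa|fa] := leP (f a) (f y).
  exists a; first by rewrite inE eqxx.
  move=> z; rewrite inE => /orP[/eqP ->//|zq].
  exact: le_trans fa (H z zq).
exists y; first by rewrite inE yq orbT.
move=> z; rewrite inE => /orP[/eqP ->|]; first exact: ltW.
exact: H.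
Qed.

Lemma sqdist_ge_fst s t : (s.1 - t.1) ^+ 2 <= sqdist s t.
Proof. by rewrite /sqdist lerDl sqr_ge0. Qed.

Lemma nearest_exists Z s u : locally_finite Z -> Z u ->
  exists2 t, Z t & forall v, Z v -> sqdist s t <= sqdist s v.
Proof.
move=> lf Zu; pose M := 1 + sqdist s u.
have /finite_seqP[q qE] := lf (s.1 - M) (s.1 + M).
have far v : Z v -> sqdist s v <= sqdist s u -> v \in q.
  move=> Zv sv; suff : [set` q] v by [].
  rewrite -qE; split=> //=.
  have M0 : 1 <= M by rewrite lerDl sqdist_ge0.
  have h : (s.1 - v.1) ^+ 2 <= (- M) ^+ 2.
    rewrite (le_trans (sqdist_ge_fst s v))// (le_trans sv)//.
    rewrite sqrrN (@le_trans _ _ M)// ?lerDr// expr2 ler_peMr// (le_trans _ M0)//.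
  by have := sqr_le_neg h; rewrite opprK => /(_ _)/andP[]; lra.
have [t tq H] := seq_argmin (sqdist s) (far u Zu (lexx _)).
have Zt : Z t by have : [set` q] t by []; rewrite -qE => -[].
exists t => // v Zv; have [vu|vu] := leP (sqdist s v) (sqdist s u).
  exact/H/far.
by apply: le_trans (ltW vu); exact/H/far.
Qed.

Definition right_unbounded Z := forall a, exists2 u, Z u & a < u.1.

Lemma right_unbounded_unvisited Z p n : right_unbounded Z ->
  exists2 u, Z u & unvisited p n u.
Proof.
move=> H; have [M HM] : exists M, forall i, (i <= n)%N -> (p i).1 <= M.
  elim: n => [|n [M HM]]; first by exists (p 0%N).1 => i; rewrite leqn0 => /eqP ->.
  exists (Num.max M (p n.+1).1) => i; rewrite leq_eqVlt => /orP[/eqP ->|/HM h].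
    by rewrite le_max lexx orbT.
  by rewrite le_max h.
have [u Zu Mu] := H M; exists u => // i /HM h e.
by move: Mu; rewrite -e ltNge h.
Qed.

Lemma greedy_walk_exists Z s : locally_finite Z ->
  (forall n p, exists2 u, Z u & unvisited p n u) ->
  exists W, greedy_walk euclidean_dist Z s W.
Proof.
move=> lf inf.
pose nxt (q : seq (R * R)) := xget s [set t | (Z t /\ t \notin q) /\
  forall v, Z v -> v \notin q -> sqdist (last s q) t <= sqdist (last s q) v].
pose f := fix f n := if n is m.+1 then rcons (f m) (nxt (f m)) else [:: s].
pose W n := last s (f n).
have fE n : f n.+1 = rcons (f n) (W n.+1) by rewrite /W /= last_rcons.
have fW n t : t \in f n <-> exists2 i, (i <= n)%N & W i = t.
  elim: n => [|n IH].
    rewrite inE; split=> [/eqP ->|[i]]; first by exists 0%N.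
    by rewrite leqn0 => /eqP -> /= <-.
  rewrite fE mem_rcons inE; split=> [/orP[/eqP ->|/IH[i ile ti]]|[i]].
  - by exists n.+1.
  - by exists i => //; exact: leqW.
  - rewrite leq_eqVlt => /orP[/eqP -> ->|ile ti]; first by rewrite eqxx.
    by apply/orP; right; apply/IH; exists i.
have unvP n t : t \notin f n <-> unvisited W n t.
  split=> [/negP H i ile ti|H]; first by apply/H/fW; exists i.
  by apply/negP => /fW[i /H].
exists W; apply/greedy_walk_path => n; split=> // i _; apply/greedy_stepP.
have [u Zu uu] := inf i W.
have lf' : locally_finite (Z `&` [set t | t \notin f i]).
  by apply: locally_finite_sub lf => z [].
have [t [Zt ti] H] := nearest_exists (W i) lf' (conj Zu ((unvP i u).2 uu)).
have WE : W i.+1 = nxt (f i) by rewrite /W /= last_rcons.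
have : (Z (nxt (f i)) /\ nxt (f i) \notin f i) /\
  forall v, Z v -> v \notin f i ->
    sqdist (last s (f i)) (nxt (f i)) <= sqdist (last s (f i)) v.
  rewrite /nxt; case: xgetP => [x _ [? ?]//|/(_ t) []]; split=> // v Zv vi.
  exact: H.
rewrite -WE => -[[Zn /unvP nn] Hn]; split=> // v Zv /unvP vv; exact: Hn.
Qed.

(** Starting points of the restricted walks below are not points of the
    configuration; only countably many of them occur. *)
Definition grid_point s := exists t : rat, exists l, s = (ratr t, height r l).

Definition no_ties Z := forall s u v, Z s \/ grid_point s -> Z u -> Z v ->
  u <> v -> sqdist s u <> sqdist s v.

Lemma greedy_path_uniq Z Z' s n p W : no_ties Z' -> Z `<=` Z' ->
  Z' s \/ grid_point s ->
  greedy_path Z s n p -> greedy_path Z s n W ->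
  forall i, (i <= n)%N -> p i = W i.
Proof.
move=> nt ZZ gs [p0 H] [W0 H'].
suff K i : (i <= n)%N -> forall j, (j <= i)%N -> p j = W j by move=> i /K; apply.
elim: i => [_ j|i IH iltn j]; first by rewrite leqn0 => /eqP ->; rewrite p0 W0.
rewrite leq_eqVlt => /orP[/eqP ->|]; last exact/IH/ltnW.
have e := IH (ltnW iltn).
have /greedy_stepP[Zp up sp] := H i iltn.
have /greedy_stepP[ZW uW sW] := H' i iltn.
apply: contrapT => ne.
have gp : Z' (p i) \/ grid_point (p i).
  case: i iltn {IH e Zp up sp ZW uW sW ne} => [|i] iltn; first by rewrite p0.
  by left; apply: ZZ; have /greedy_stepP[] := H i (ltnW iltn).
apply: (nt _ _ _ gp (ZZ _ Zp) (ZZ _ ZW) ne); apply: le_anti; apply/andP; split.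
  by apply: sp => // k ki; rewrite e//; exact: uW.
rewrite e//; apply: sW => // k ki; rewrite -e//; exact: up.
Qed.

Lemma greedy_walk_unbounded Z s W : locally_finite Z ->
  greedy_walk euclidean_dist Z s W ->
  forall M, exists N, forall n, (N <= n)%N -> M < `|(W n).1|.
Proof.
move=> lf /greedy_walk_path gW M.
have Wstep n : [/\ Z (W n.+1), unvisited W n (W n.+1) & True].
  by have [_ /(_ n (ltnSn n)) /greedy_stepP[]] := gW n.+1.
have fin : finite_set [set n | `|(W n.+1).1| <= M].
  have inj : {in (fun n => W n.+1) @^-1` (Z `&` [set z | - M <= z.1 <= M]) &,
      injective (fun n => W n.+1)}.
    move=> i j _ _ ij; apply/eqP; rewrite eqn_leq; apply/andP; split.
      rewrite leqNgt; apply/negP => lt; have [_ /(_ j.+1) + _] := Wstep i.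
      by apply => //; rewrite ij.
    rewrite leqNgt; apply/negP => lt; have [_ /(_ i.+1) + _] := Wstep j.
    by apply => //; rewrite ij.
  apply: sub_finite_set (finite_preimage inj (lf (- M) M)) => n /= nM.
  by split; [case: (Wstep n)|rewrite /= -ler_norml].
have /finite_seqP[q qE] := fin.
exists (\max_(i <- q) i.+1).+1 => -[//|n] nN.
rewrite ltNge; apply/negP => nM.
have nq : n \in q by suff : [set` q] n by []; rewrite -qE.
have : (n.+1 <= \max_(i <- q) i.+1)%N by apply: leq_bigmax_seq.
by rewrite leqNgt nN.
Qed.

End walks.

(** * Blocks *)

Ltac natlia := repeat match goal with
  | H : is_true (leq _ _) |- _ => revert H
  | H : is_true (andb (leq _ _) (leq _ _)) |- _ => revert H
  | H : @eq nat _ _ |- _ => revert H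
  end; clear; lia.

Section blocks.
Context {R : realType} (r h L : R) (l : bool) (K m : nat).
Hypothesis r_gt0 : 0 < r.
Hypothesis h_gt0 : 0 < h.
Hypothesis h_small : 4 * h <= r.
Hypothesis m_large : 4 * h + r <= m%:R * h.
Hypothesis mK : (m.+1 < K)%N.
Hypothesis hL : h <= L.
Hypothesis L_small : L <= (K%:R - m%:R - 1) * h.
Implicit Types (Z : set (R * R)) (s t u v : R * R) (p W : nat -> R * R).
Implicit Types (b c : R).

Local Notation height := (height r).
Local Notation two_lines := (two_lines r).

Definition cell b i : set R := [set x | b + i%:R * h <= x < b + i.+1%:R * h].

Definition block_end b := b + K%:R * h.

(** Three empty cells, then points of line [l] only, except for cell number [m],
    which holds the points of the other line that are left behind. That cell is more
    than [r] to the right of the first points of line [l], and at least [L] to the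
    left of the end of the block. *)
Definition pattern i k : bool :=
  if k == l then (3 <= i)%N && (i != m) else i == m.

Definition block b Z := forall i k, (i < K)%N ->
  (exists2 x, cell b i x & Z (x, height k)) <-> pattern i k.

Definition strip (D : set R) Z := Z `&` [set z | D z.1].

Lemma block_strip b D Z : (forall x, b <= x < block_end b -> D x) ->
  block b (strip D Z) <-> block b Z.
Proof.
move=> H; suff E i k : (i < K)%N -> (exists2 x, cell b i x & strip D Z (x, height k)) <->
   (exists2 x, cell b i x & Z (x, height k)).
  by split=> B i k iK; rewrite -B// E.
move=> iK; split=> [[x cx [Zx _]]|[x cx Zx]]; exists x => //; split=> //=.
apply: H; move: cx => /= /andP[h1 h2]; apply/andP; split.
  by rewrite (le_trans _ h1)// lerDl mulr_ge0// ltW.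
by rewrite (lt_le_trans h2)// /block_end lerD2l ler_pM2r// ler_nat.
Qed.

Lemma cell_cover b n x : b <= x < b + n%:R * h ->
  exists2 i, (i < n)%N & cell b i x.
Proof.
elim: n => [|n IH] /andP[bx xn]; first by move: xn; rewrite mul0r; lra.
have [xn'|xn'] := ltP x (b + n%:R * h).
  have [|i iltn ci] := IH; first by rewrite bx xn'.
  by exists i => //; exact: ltnW.
by exists n => //; rewrite /cell /= xn' xn.
Qed.

Lemma natr_gt_m : (m%:R + 2 <= K%:R :> R).
Proof. by rewrite -natrD ler_nat addn2. Qed.

Lemma block_end_ge b n : (n <= K)%N -> b + n%:R * h <= block_end b.
Proof. by move=> nK; rewrite lerD2l ler_pM2r// ler_nat. Qed.

Lemma m_gt4 : (4 < m)%N.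
Proof.
have r0 := r_gt0; have h0 := h_gt0.
have : 4 * h < m%:R * h by have := m_large; lra.
by rewrite ltr_pM2r// ltr_nat.
Qed.

Section facts.
Variables (b : R) (Z : set (R * R)).
Hypothesis blockZ : block b Z.

Lemma cell_point (z : R * R) : b <= z.1 < block_end b -> exists2 i, (i < K)%N & cell b i z.1.
Proof. exact: cell_cover. Qed.

Lemma cell_pattern z i k : Z z -> z.2 = height k -> cell b i z.1 -> (i < K)%N ->
  pattern i k.
Proof.
move=> Zz zk ci iK; apply/(blockZ k iK); exists z.1 => //.
by rewrite -zk -surjective_pairing.
Qed.

Lemma block_moat z k : Z z -> z.2 = height k -> b <= z.1 < block_end b ->
  b + 3 * h <= z.1.
Proof.
move=> Zz zk /cell_point[i iK ci]; have := cell_pattern Zz zk ci iK.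
rewrite /pattern => pt; have i3 : (3 <= i)%N.
  by move: pt; case: eqP => _; [case/andP|move/eqP => ->; have := m_gt4; natlia].
move: ci => /andP[+ _]; apply: le_trans.
by rewrite lerD2l ler_pM2r// ler_nat.
Qed.

Lemma block_mark z : Z z -> z.2 = height (~~ l) -> b <= z.1 < block_end b ->
  cell b m z.1.
Proof.
move=> Zz zk /cell_point[i iK ci]; have := cell_pattern Zz zk ci iK.
by rewrite /pattern; case: (l) => /= /eqP <-.
Qed.

Lemma pattern_point i : pattern i l -> (i < K)%N ->
  exists u, [/\ Z u, u.2 = height l & cell b i u.1].
Proof.
by move=> pt iK; have /blockZ -/(_ iK)[x cx Zx] := pt; exists (x, height l).
Qed.

Lemma block_next x : b + 2 * h <= x -> x < block_end b - h ->
  exists u, [/\ Z u, u.2 = height l, x < u.1 < x + 3 * h & u.1 < block_end b].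
Proof.
move=> bx xe; have h0 := h_gt0.
have [|i iK /andP[ix xi]] := @cell_cover b K x.
  by apply/andP; split; rewrite -?/(block_end b); lra.
have i2 : (2 <= i)%N.
  rewrite -ltnS -(ltr_nat R) -(ltr_pM2r h_gt0); lra.
have iK1 : (i.+1 < K)%N.
  rewrite -(ltr_nat R) -(ltr_pM2r h_gt0); move: xe; rewrite /block_end.
  rewrite -natr1 mulrDl mul1r; lra.
have fin j : (j < K)%N -> (i < j)%N -> (j <= i.+2)%N -> j != m ->
    exists u, [/\ Z u, u.2 = height l, x < u.1 < x + 3 * h & u.1 < block_end b].
  move=> jK ij ji jm; have [|u [Zu ul /andP[uj uj']]] := @pattern_point j _ jK.
    by rewrite /pattern eqxx jm andbT; natlia.
  exists u; split=> //.
    have h1 : i.+1%:R * h <= j%:R * h by rewrite ler_pM2r// ler_nat.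
    have h2 : j.+1%:R * h <= i%:R * h + 3 * h.
      by rewrite -mulrDl ler_pM2r// -natrD ler_nat; natlia.
    by apply/andP; split; lra.
  by apply: lt_le_trans uj' _; apply: block_end_ge.
have [im|im] := eqVneq i.+1 m; last by apply: (fin i.+1) => //.
by apply: (fin i.+2) => //; move: mK; rewrite -?im; natlia.
Qed.

Lemma block_first : exists u, [/\ Z u, u.2 = height l & cell b 3 u.1].
Proof.
have m4 := m_gt4; have mK' := mK; apply: pattern_point; last by natlia.
by rewrite /pattern eqxx /=; apply/eqP; natlia.
Qed.

Lemma block_last : exists u,
  [/\ Z u, u.2 = height l & block_end b - h <= u.1 < block_end b].
Proof.
have m4 := m_gt4; have mK' := mK.
have [||u [Zu ul /andP[h1 h2]]] := @pattern_point K.-1; [|natlia|exists u; split=> //].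
  by rewrite /pattern eqxx; apply/andP; split; [|apply/eqP]; natlia.
have KE : K.-1.+1 = K by natlia.
move: h1 h2; rewrite KE /block_end => h1 h2; rewrite h2 andbT.
by apply: le_trans h1; rewrite -{1}KE -natr1 mulrDl mul1r; lra.
Qed.

Lemma block_mark_exists : exists u,
  [/\ Z u, u.2 = height (~~ l) & cell b m u.1].
Proof.
have iK : (m < K)%N by have := mK; natlia.
have [_ /(_ _)[|x cx Zx]] := blockZ (~~ l) iK; last by exists (x, height (~~ l)).
by rewrite /pattern; case: (l) => /=.
Qed.

End facts.

Lemma height_neg (z : R * R) k : z.2 = height k -> k != l -> z.2 = height (~~ l).
Proof. by move=> ->; case: k; case: (l). Qed.

(** A walker to the left of a block finds its first point of line [l] nearer
    than everything else in the block and beyond: the other points of that line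
    are further, and those of the other line are more than [r] further right. *)
Lemma block_entry b Z s t k : two_lines Z -> block b Z -> s.2 = height k ->
  s.1 < b -> Z t -> b <= t.1 ->
  (forall u, Z u -> b <= u.1 < block_end b -> sqdist s t <= sqdist s u) ->
  [/\ t.2 = height l, t.1 < b + 4 * h &
      forall u, Z u -> u.2 = height l -> b <= u.1 < block_end b -> t.1 <= u.1].
Proof.
move=> ZE B sk sb Zt bt near; have r0 := r_gt0; have h0 := h_gt0.
have [a [Za al /andP[a1 a2]]] := block_first B.
have eb : b + m%:R * h <= block_end b by apply: block_end_ge; have := mK; natlia.
have ae : b <= a.1 < block_end b by have ml := m_large; apply/andP; split; lra.
have sta := near a Za ae.
have same u : t.2 = height l -> Z u -> u.2 = height l -> b <= u.1 < block_end b ->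
    t.1 <= u.1.
  move=> tl Zu ul bu; have := near u Zu bu; have [skl|skl] := eqVneq k l.
    rewrite !sqdist_same ?sk ?tl ?ul ?skl// => /sqr_le_neg.
    by move: bu => /andP[? ?] H; lra.
  rewrite !(sqdist_other (r:=r) (l:=k) (m:=l))// lerD2r => /sqr_le_neg.
  by move: bu => /andP[? ?] H; lra.
have [kt tk] := ZE _ Zt; have [ktl|ktl] := eqVneq kt l.
  have tl : t.2 = height l by rewrite tk ktl.
  split=> //; last by move=> u; apply: same.
  by have := same a tl Za al ae; lra.
exfalso; have tn := height_neg tk ktl.
have tm : a.1 + r < t.1.
  have ml := m_large; have [te|te] := ltP t.1 (block_end b); last lra.
  by have /andP[h1 _] := block_mark B Zt tn (introT andP (conj bt te)); lra.
move: sta; have [skl|skl] := eqVneq k l.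
  rewrite (sqdist_same (t:=a)) ?sk ?al ?skl//.
  rewrite (sqdist_other (r:=r) (t:=t) (l:=k) (m:=kt))//; last by rewrite skl eq_sym.
  move: ae => /andP[ae _].
  have : (s.1 - a.1) ^+ 2 <= (s.1 - t.1) ^+ 2 by apply: sqr_le_right; lra.
  have : 0 < r ^+ 2 by rewrite exprn_gt0.
  by lra.
have kkt : k = kt by move: ktl skl; case: (k); case: (kt); case: (l).
rewrite (sqdist_same (t:=t)) ?sk ?tk ?kkt//.
rewrite (sqdist_other (r:=r) (t:=a) (l:=k) (m:=l))//.
move: ae => /andP[ae _].
have := @far_jump _ r r_gt0 (- s.1) (- t.1) (- a.1).
have E (x : R) : (- s.1 - - x) ^+ 2 = (s.1 - x) ^+ 2.
  by rewrite -sqrrN; congr (_ ^+ 2); ring.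
rewrite !E => H; apply/negP; rewrite -ltNge; apply: H; lra.
Qed.

Section crossing.
Variables (b : R) (Z : set (R * R)) (s : R * R) (k0 : bool) (W : nat -> R * R).
Hypothesis ZE : two_lines Z.
Hypothesis lfZ : locally_finite Z.
Hypothesis blockZ : block b Z.
Hypothesis s_height : s.2 = height k0.
Hypothesis s_left : s.1 < b.
Hypothesis walkW : greedy_walk euclidean_dist Z s W.

Lemma walk_step n : [/\ Z (W n.+1), unvisited W n (W n.+1) &
  forall u, Z u -> unvisited W n u -> sqdist (W n) (W n.+1) <= sqdist (W n) u].
Proof.
by move/greedy_walk_path : walkW => /(_ n.+1)[_ /(_ n (ltnSn n))] /greedy_stepP.
Qed.

Lemma walk_height n : exists k, (W n).2 = height k.
Proof.
case: n => [|n]; first by exists k0; case: walkW => ->.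
by have [Zn _ _] := walk_step n; exact: ZE.
Qed.

(** The invariant of the passage through a block: the points visited so far to the
    right of [b] are those of line [l] up to the position of the walker. *)
Definition traversing n := [/\ (W n).2 = height l, b <= (W n).1 < block_end b,
  forall i, (i <= n)%N -> b <= (W i).1 -> (W i).2 = height l /\ (W i).1 <= (W n).1 &
  forall u, Z u -> u.2 = height l -> b <= u.1 <= (W n).1 ->
    exists2 i, (i <= n)%N & W i = u].

Lemma visited_ex n u : ~ unvisited W n u -> exists2 i, (i <= n)%N & W i = u.
Proof.
move=> H; apply: contrapT => H'; apply: H => i ile e; apply: H'; by exists i.
Qed.

Lemma traversing_start n : b <= (W n).1 ->
  (forall i, (i < n)%N -> (W i).1 < b) -> traversing n.
Proof.
case: n => [|n] bn before; first by move: bn; case: walkW => -> _; rewrite leNgt s_left.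
have [Zn un near] := walk_step n; have [k hk] := walk_height n.
have [|hl h4 first] := block_entry ZE blockZ hk (before n (ltnSn n)) Zn bn.
  move=> u Zu /andP[bu _]; apply: near => // i ile e.
  by have := before i ile; rewrite e ltNge bu.
have m4 := m_gt4; have mK' := mK.
have h4e : b + 4 * h <= block_end b by apply: (@block_end_ge b 4); natlia.
split=> //.
- by rewrite bn; apply: lt_le_trans h4e.
- move=> i; rewrite leq_eqVlt => /orP[/eqP ->//|iltn] bi.
  by have := before i iltn; rewrite ltNge bi.
- move=> u Zu ul /andP[bu un']; exists n.+1 => //.
  have bue : b <= u.1 < block_end b by rewrite bu (le_lt_trans un')// (lt_le_trans h4).
  have e1 : (W n.+1).1 = u.1 by apply: le_anti; rewrite un' first.
  by rewrite [LHS]surjective_pairing [RHS]surjective_pairing e1 hl ul.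
Qed.

Lemma traversing_step n v : traversing n -> Z v -> v.2 = height l ->
  (W n).1 < v.1 < block_end b ->
  traversing n.+1 /\ sqdist (W n) (W n.+1) <= (3 * h) ^+ 2.
Proof.
move=> [hl /andP[bn ne] vis all_] Zv vl /andP[nv ve].
have h0 := h_gt0; have hs := h_small.
have [Zt ut near] := walk_step n.
have unv u : Z u -> (W n).1 < u.1 -> unvisited W n u.
  move=> Zu nu i ile e; have bi : b <= (W i).1 by rewrite e; lra.
  by have [_] := vis i ile bi; rewrite e leNgt nu.
have n3 : b + 3 * h <= (W n).1.
  case: n {vis all_ near ut Zt unv} hl bn ne nv => [|n] hl bn ne nv.
    by move: bn; case: walkW => -> _; rewrite leNgt s_left.
  have [Zn _ _] := walk_step n; apply: (block_moat blockZ Zn hl).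
  by rewrite bn ne.
have [u [Zu ul /andP[nu u3]]] : exists u, [/\ Z u, u.2 = height l &
    (W n).1 < u.1 < (W n).1 + 3 * h].
  have [ne'|ne'] := ltP (W n).1 (block_end b - h).
    have [|u [? ? ? _]] := block_next blockZ _ ne'; [lra|by exists u].
  by exists v; split=> //; apply/andP; split; lra.
have := near u Zu (unv u Zu nu); rewrite (sqdist_same (t:=u)) ?hl ?ul// => tu.
have u9 : ((W n).1 - u.1) ^+ 2 < (3 * h) ^+ 2.
  rewrite -sqrrN opprB ltr_pXn2r ?nnegrE//; lra.
have [kt ht] := ZE Zt; have [ktl|ktl] := eqVneq kt l; last first.
  exfalso; move: tu; rewrite (sqdist_other (r:=r) (l:=l) (m:=kt))// 1?eq_sym// => tu.
  have : (3 * h) ^+ 2 < r ^+ 2 by rewrite ltr_pXn2r ?nnegrE//; lra.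
  by have := sqr_ge0 ((W n).1 - (W n.+1).1); lra.
have tl : (W n.+1).2 = height l by rewrite ht ktl.
move: tu; rewrite sqdist_same ?hl ?tl// => tu.
have nt : (W n).1 < (W n.+1).1.
  rewrite ltNge; apply/negP => tn.
  have [bt|bt] := leP b (W n.+1).1.
    have [|i ile e] := all_ _ Zt tl; first by rewrite bt tn.
    exact: (ut i ile e).
  have : (3 * h) ^+ 2 <= ((W n).1 - (W n.+1).1) ^+ 2 by rewrite ler_pXn2r ?nnegrE//; lra.
  lra.
have right w : Z w -> w.2 = height l -> (W n).1 < w.1 -> (W n.+1).1 <= w.1.
  move=> Zw wl nw; have := near w Zw (unv w Zw nw).
  by rewrite !sqdist_same ?hl ?tl ?wl// => /sqr_le_neg; lra.
split; last by lra.
split=> //.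
- apply/andP; split; first lra.
  exact: le_lt_trans (right v Zv vl nv) ve.
- move=> i; rewrite leq_eqVlt => /orP[/eqP ->//|iltn] bi.
  by have [? ?] := vis i iltn bi; split=> //; lra.
- move=> w Zw wl /andP[bw wt]; have [wn|wn] := leP w.1 (W n).1.
    have [|i ile e] := all_ _ Zw wl; first by rewrite bw wn.
    by exists i => //; exact: leqW.
  exists n.+1 => //; have e1 : (W n.+1).1 = w.1.
    by apply: le_anti; rewrite wt right.
  by rewrite [LHS]surjective_pairing [RHS]surjective_pairing e1 tl wl.
Qed.

(** [t] is the time of entry and [t'] the time at which the last point of line
    [l] is reached. *)
Definition crosses (t t' : nat) := [/\ (t <= t')%N,
  forall i, (i < t)%N -> (W i).1 < b,
  forall i, (t <= i <= t')%N -> traversing i,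
  forall i, (t <= i < t')%N -> sqdist (W i) (W i.+1) <= (3 * h) ^+ 2 &
  forall u, Z u -> u.2 = height l -> u.1 < block_end b -> u.1 <= (W t').1].

Lemma block_crossing n : b <= (W n).1 -> exists t t' : nat, (t <= n)%N /\ crosses t t'.
Proof.
move=> bn; have ex : exists n, b <= (W n).1 by exists n.
pose t := ex_minn ex.
have [bt tmin] : b <= (W t).1 /\ forall i, (i < t)%N -> (W i).1 < b.
  rewrite /t; case: ex_minnP => k bk kmin; split=> // i ik.
  by rewrite ltNge; apply/negP => /kmin; rewrite leqNgt ik.
have tn : (t <= n)%N by rewrite /t; case: ex_minnP => k _; apply.
have trt := traversing_start bt tmin.
have ex' : exists k, (t < k)%N && `[< ~ traversing k >].
  have [N HN] := greedy_walk_unbounded lfZ walkW (Num.max `|b| `|block_end b|).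
  exists (maxn N t.+1); rewrite leq_maxr /=; apply/asboolP => -[_ /andP[h1 h2] _ _].
  have := HN _ (leq_maxl N t.+1); rewrite gt_max => /andP[].
  have := ler_norm (- b); rewrite normrN => ?; have ? := ler_norm (block_end b).
  have [w0|w0] := leP 0 (W (maxn N t.+1)).1.
    by rewrite (ger0_norm w0); lra.
  by rewrite (ltr0_norm w0); lra.
pose k := ex_minn ex'.
have [tk ntk kmin] : [/\ (t < k)%N, ~ traversing k &
    forall i, (t <= i < k)%N -> traversing i].
  rewrite /k; case: ex_minnP => k' /andP[tk' /asboolP ntk'] kmin; split=> // i.
  rewrite leq_eqVlt => /andP[/orP[/eqP <-//|ti] ik].
  apply: contrapT => ni; have := kmin i; rewrite ti /= leqNgt ik.
  by move=> H; have : false by apply: H; apply/asboolP.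
have kE : k = k.-1.+1 by natlia.
exists t, k.-1; split=> //; split=> //.
- by natlia.
- by move=> i it; apply: kmin; natlia.
- move=> i /andP[ti ik].
  have ti1 : traversing i.+1 by apply: kmin; natlia.
  have ti0 : traversing i by apply: kmin; natlia.
  have : (W i).1 < (W i.+1).1.
    have [hl _ _ all_] := ti0; have [hl' /andP[b' _] _ _] := ti1.
    have [Zt ut _] := walk_step i.
    rewrite ltNge; apply/negP => tn'; have [|j ji e] := all_ _ Zt hl'.
      by rewrite b' tn'.
    exact: (ut j ji e).
  have [hl' /andP[_ e'] _ _] := ti1; have [Zt _ _] := walk_step i.
  by move=> lt'; have [|_ +] := traversing_step ti0 Zt hl'; first by rewrite lt' e'.
- move=> u Zu ul ue; rewrite leNgt; apply/negP => lt'.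
  apply: ntk; have tk1 : traversing k.-1 by apply: kmin; natlia.
  by rewrite kE; have [|] := traversing_step tk1 Zu ul; first by rewrite lt' ue.
Qed.

Section crossed.
Variables (t t' : nat).
Hypothesis tt' : crosses t t'.

Lemma crossed_traversing : traversing t'.
Proof. by case: tt' => ? _ H _ _; apply: H; natlia. Qed.

Lemma crossed_last : block_end b - h <= (W t').1 < block_end b.
Proof.
have [_ /andP[_ ->] _ _] := crossed_traversing; rewrite andbT.
have [_ _ _ _ last_] := tt'; have [u [Zu ul /andP[u1 u2]]] := block_last blockZ.
by apply: le_trans u1 _; apply: last_.
Qed.

Lemma crossed_pos : exists2 n, t' = n.+1 & Z (W t').
Proof.
have := crossed_traversing; case: (t') => [[_]|n]; last first.
  by exists n => //; have [] := walk_step n.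
by case: walkW => -> _ /andP[]; rewrite leNgt s_left.
Qed.

Lemma crossed_unvisited u : block_end b <= u.1 -> unvisited W t' u.
Proof.
move=> eu i ile e; have h0 := h_gt0.
have [_ /andP[? ?] vis _] := crossed_traversing.
have [|_] := vis i ile; rewrite e; last by lra.
by apply: le_trans eu; rewrite lerDl mulr_ge0// ltW.
Qed.

Lemma crossed_mark_unvisited u i : u.2 = height (~~ l) -> b <= u.1 ->
  (i <= t')%N -> W i <> u.
Proof.
move=> ul bu ile e; have [_ _ vis _] := crossed_traversing.
have [|] := vis i ile; rewrite e// ul => /eqP.
by rewrite (height_eq r_gt0); case: (l).
Qed.

Lemma crossed_remaining u n : (t' <= n)%N -> Z u -> unvisited W n u ->
  u.1 < block_end b -> u.1 < b + m.+1%:R * h.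
Proof.
move=> tn Zu /(unvisited_le tn) uu ue; have [bu|ub] := leP b u.1; last first.
  by apply: lt_trans ub _; rewrite ltrDl mulr_gt0// ltr0n.
have [k hk] := ZE Zu; have [kl|kl] := eqVneq k l; last first.
  by have /andP[] := block_mark blockZ Zu (height_neg hk kl) (introT andP (conj bu ue)).
have [_ _ _ _ last_] := tt'; have [_ _ _ all_] := crossed_traversing.
have [||i ile e] := all_ _ Zu; [by rewrite hk kl| |by have := uu i ile e].
by rewrite bu last_// hk kl.
Qed.

End crossed.
End crossing.

End blocks.

(** * Long steps and coalescence *)

Section coalescence.
Context {R : realType} (r h L : R) (l : bool) (K m : nat).
Hypothesis r_gt0 : 0 < r.
Hypothesis h_gt0 : 0 < h.
Hypothesis h_small : 4 * h <= r.
Hypothesis m_large : 4 * h + r <= m%:R * h.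
Hypothesis mK : (m.+1 < K)%N.
Hypothesis hL : h <= L.
Hypothesis L_small : L <= (K%:R - m%:R - 1) * h.
Implicit Types (Z : set (R * R)) (s t u v : R * R) (p W : nat -> R * R).
Implicit Types (b c : R).

Local Notation height := (height r).
Local Notation two_lines := (two_lines r).
Local Notation block := (block r h l K m).
Local Notation block_end := (block_end h K).

(** The empty cells at the beginning of the second block would have to contain points
    of the first one. *)
Lemma block_disjoint b j Z : (0 < j < K)%N -> block b Z ->
  ~ block (b + j%:R * h) Z.
Proof.
move=> /andP[j0 jK] B B'; have m4 := m_gt4 r_gt0 h_gt0 m_large.
have mK' := mK; pose o := maxn 3 j; have oK : (o < K)%N by rewrite /o; natlia.
have [k ko] : exists k, pattern l m o k.
  have [om|om] := eqVneq o m.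
    by exists (~~ l); rewrite /pattern om eqxx; case: (l).
  by exists l; rewrite /pattern eqxx om andbT leq_maxl.
have [x cx Zx] := (B o k oK).2 ko.
have jo : (j <= o)%N by exact: leq_maxr.
have oE : (o%:R = (o - j)%:R + j%:R :> R) by rewrite -natrD subnK.
have ojK : (o - j < K)%N by clear -oK; lia.
have : pattern l m (o - j) k.
  apply/(B' _ _ ojK); exists x => //; move: cx => /andP[].
  rewrite -natr1 oE => h1 h2; apply/andP; rewrite -natr1.
  by split; move: h1 h2; rewrite !mulrDl !mul1r; lra.
have o2 : (o - j <= 2)%N by rewrite /o; natlia.
by rewrite /pattern; case: ifP => _; [rewrite ltnNge o2|move/eqP => e; rewrite e in o2; natlia].
Qed.

(** If no step is long, points more than [L] to the left of [c] have no influence on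
    the walk: whatever they are, they are further away than the next point. The
    condition on the first step is there because a walk that arrives from the left
    starts at another point of line [l]. The sets [D] and [T] serve to restrict the
    configuration and the positions in question, so as to obtain events that depend
    on a bounded region. *)
Definition long c (D T : set R) Z := exists n p,
  [/\ greedy_path (strip D Z) (c - h, height l) n.+1 p,
      forall i, (i <= n)%N -> T (p i).1 &
      (n = 0%N /\ (p 1%N).2 <> height l) \/
      ((p n).1 - c + L) ^+ 2 < sqdist (p n) (p n.+1)].

Section crossed_walk.
Variables (pi Z : set (R * R)) (b : R) (s : R * R) (k0 : bool) (W : nat -> R * R).
Variables (t t' : nat) (D T : set R).
Hypothesis piE : two_lines pi.
Hypothesis lfpi : locally_finite pi.
Hypothesis nt : no_ties r pi.
Hypothesis Zpi : Z `<=` pi.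
Hypothesis blockZ : block b Z.
Hypothesis s_height : s.2 = height k0.
Hypothesis s_left : s.1 < b.
Hypothesis walkW : greedy_walk euclidean_dist Z s W.
Hypothesis tt' : crosses r h l K b Z W t t'.
Hypothesis D_right : forall x, D x -> block_end b <= x.
Hypothesis DZ : forall z, pi z -> D z.1 -> Z z.
Hypothesis not_long : ~ long (block_end b) D T pi.
Hypothesis T_start : T (block_end b - h).
Hypothesis stay : forall n, (t' <= n)%N ->
  (forall j, (t' < j <= n)%N -> T (W j).1) -> block_end b <= (W n.+1).1 ->
  D (W n.+1).1.
Hypothesis more : forall n, (t' <= n)%N ->
  (forall j, (t' < j <= n)%N -> T (W j).1) ->
  exists2 u, pi u /\ D u.1 & unvisited W n u.

Local Notation start := (block_end b - h, height l).

Definition shifted i := if i is k.+1 then W (t' + k.+1)%N else start.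

Let ZE : two_lines Z. Proof. by move=> z /Zpi /piE. Qed.

(** All that the walk has left behind during its passage through the block is more
    than [L] to the left of the end of the block, hence too far away as long as the
    walk from the end of the block makes no long step. *)
Lemma coalescence i : (forall j, (t' < j < t' + i)%N -> T (W j).1) ->
  greedy_path (strip D pi) start i shifted.
Proof.
elim: i => [//|i IH Tj]; have gp : greedy_path (strip D pi) start i shifted.
  by apply: IH => j /andP[? ?]; apply: Tj; rewrite addnS; apply/andP; split; natlia.
split=> // k; rewrite ltnS leq_eqVlt => /orP[/eqP ->{k}|]; last exact: gp.2.
set n := (t' + i)%N; have tn : (t' <= n)%N by rewrite leq_addr.
have Tn j : (t' < j <= n)%N -> T (W j).1.
  by move=> /andP[? ?]; apply: Tj; rewrite addnS ltnS; apply/andP.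
have h0 := h_gt0; have hL' := hL.
have [Zt ut near] := walk_step walkW n.
have unvW u : pi u -> D u.1 -> unvisited shifted i u -> unvisited W n u.
  move=> piu Du uu j jn; have [jt|jt] := leqP j t'.
    exact: (crossed_unvisited h_gt0 mK tt' (D_right Du) jt).
  have jE : j = (t' + (j - t'.+1).+1)%N by clear -jt; lia.
  rewrite jE; apply: (uu (j - t'.+1).+1); rewrite /n in jn; natlia.
have unvS u : D u.1 -> unvisited W n u -> unvisited shifted i u.
  move=> Du uu [|j] ji /= e.
    by have := D_right Du; rewrite -e /=; lra.
  by apply: (uu (t' + j.+1)%N) e; rewrite leq_add2l.
have [u0 [piu0 Du0] uu0] := more tn Tn.
have lfU : locally_finite (strip D pi `&` [set u | unvisited shifted i u]).
  by apply: locally_finite_sub lfpi => z [[]].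
have [|q [[piq Dq] uq] nearq] := @nearest_exists _ _ (shifted i) u0 lfU.
  by split; [split|apply: unvS].
have uWq := unvW q piq Dq uq.
pose pq k := if k == i.+1 then q else shifted k.
have pqE j : (j <= i)%N -> pq j = shifted j.
  by rewrite /pq => ji; case: eqP => // e; move: ji; rewrite e ltnn.
have pqq : pq i.+1 = q by rewrite /pq eqxx.
have pathq : greedy_path (strip D pi) start i.+1 pq.
  split=> // k ki; have [->|kni] := eqVneq k i; last first.
    have ki' : (k < i)%N by rewrite ltn_neqAle kni -ltnS.
    have := gp.2 k ki'; rewrite /greedy_step.
    rewrite !pqE ?(ltnW ki')//.
    rewrite (_ : [set pq i0 | i0 in `I_k.+1] = [set shifted i0 | i0 in `I_k.+1])//.
    by apply: eq_imagel => j /= jk; apply: pqE; natlia.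
  apply/greedy_stepP; rewrite pqq pqE//; split=> //.
    by move=> j ji; rewrite pqE//; exact: uq.
  by move=> v Zv uv; apply: nearq; split=> // j ji; have := uv j ji; rewrite pqE.
have Ti j : (j <= i)%N -> T (pq j).1.
  move=> ji; rewrite pqE//; case: j ji => [|j] ji //=; apply: Tn.
  by rewrite /n leq_add2l ji andbT addnS ltnS leq_addr.
have stepq : (i = 0%N -> q.2 = height l) /\
    sqdist (shifted i) q <= ((shifted i).1 - block_end b + L) ^+ 2.
  split=> [i0|].
    apply: contrapT => ql; apply: not_long; exists i, pq; split=> //.
    by left; split=> //; rewrite -[in pq _]i0 pqq.
  rewrite leNgt; apply/negP => ql; apply: not_long; exists i, pq; split=> //.
  by right; rewrite pqq pqE.
have [lastge lastlt] := andP (crossed_last r_gt0 h_gt0 m_large mK blockZ tt').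
have [_ _ vis_ all_] := crossed_traversing mK tt'.
have Wline : (W t').2 = height l by case: (crossed_traversing mK tt').
have stepe : i = 0%N -> sqdist (W n) q <= (L - h) ^+ 2.
  move=> i0; have [/(_ i0) ql] := stepq; rewrite /n i0 addn0 /=.
  rewrite !sqdist_same ?Wline ?ql//= => sq; have := D_right Dq => cq.
  apply: le_trans (_ : (block_end b - h - q.1) ^+ 2 <= _); last first.
    by apply: le_trans sq _; rewrite le_eqVlt; apply/orP; left; apply/eqP; ring.
  rewrite -(sqrrN (_ - q.1)) -(sqrrN (_ - _ - q.1)) !opprB.
  by rewrite ler_pXn2r ?nnegrE//; lra.
have ct : block_end b <= (W n.+1).1.
  rewrite leNgt; apply/negP => tc.
  have := crossed_remaining h_gt0 mK ZE blockZ tt' tn Zt ut tc => tm.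
  have tL : (W n.+1).1 < block_end b - L.
    by apply: lt_le_trans tm _; have := L_small; rewrite /block_end -natr1; lra.
  have := near q (DZ piq Dq) uWq => tq.
  have d1 := sqdist_ge_fst (W n) (W n.+1).
  case: (posnP i) => [i0|i0].
    have := stepe i0; have nE : n = t' by rewrite /n i0 addn0.
    rewrite nE in d1 tq tL *; move=> d2.
    have : (L - h) ^+ 2 < ((W t').1 - (W t'.+1).1) ^+ 2.
      by rewrite ltr_pXn2r ?nnegrE//; lra.
    by lra.
  have [_] := stepq; have -> : shifted i = W n by rewrite /n; case: (i) i0.
  have [_ Dn] : strip D pi (shifted i).
    by case: (i) i0 gp => // i' _ [_ /(_ i' (ltnSn i'))] /greedy_stepP[].
  have : shifted i = W n by rewrite /n; case: (i) i0.
  move=> e; rewrite {}e in Dn; have := D_right Dn => cn d2.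
  have : ((W n).1 - block_end b + L) ^+ 2 < ((W n).1 - (W n.+1).1) ^+ 2.
    by rewrite ltr_pXn2r ?nnegrE//; lra.
  by lra.
have Dt := stay tn Tn ct.
apply/greedy_stepP; rewrite /= addnS; split.
- by split=> //; exact: Zpi.
- exact: unvS.
case: (posnP i) => [i0|i0]; last first.
  have -> : shifted i = W n by rewrite /n; case: (i) i0.
  by move=> u [piu Du] uu; apply: near; [exact: DZ|exact: unvW].
have nE : n = t' by rewrite /n i0 addn0.
have [/(_ i0) ql _] := stepq.
have si : shifted i = start by rewrite i0.
suff <- : q = W n.+1 by move=> u Zu uu; apply: nearq; split.
apply: contrapT => ne; have piWn : pi (W n).
  by rewrite nE; have [? _ /Zpi] := crossed_pos mK s_left walkW tt'.
apply: (nt (or_introl piWn) piq (Zpi Zt) ne).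
apply: le_anti; apply/andP; split; last by apply: near => //; exact: DZ.
have [kt ht] := ZE Zt.
apply: (nearest_shift (r:=r) (s:=start) (l:=l) (ls:=l) (lw:=kt)) => //=.
- by rewrite nE.
- by rewrite nE.
- by rewrite nE; have := D_right Dq; lra.
- by rewrite nE in ct *; lra.
- by rewrite -si; apply: nearq; split; [split=> //; exact: Zpi|apply: unvS].
Qed.

End crossed_walk.
End coalescence.

(** * Escaping blocks *)

Section good_blocks.
Context {R : realType} (r h L : R) (l : bool) (K m : nat).
Hypothesis r_gt0 : 0 < r.
Hypothesis h_gt0 : 0 < h.
Hypothesis h_small : 4 * h <= r.
Hypothesis m_large : 4 * h + r <= m%:R * h.
Hypothesis mK : (m.+1 < K)%N.
Hypothesis hL : h <= L.
Hypothesis L_small : L <= (K%:R - m%:R - 1) * h.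
Implicit Types (Z pi : set (R * R)) (s u : R * R) (p W : nat -> R * R).
Implicit Types (b c y : R).

Local Notation height := (height r).
Local Notation two_lines := (two_lines r).
Local Notation block := (block r h l K m).
Local Notation block_end := (block_end h K).
Local Notation long := (long r h L l).

Definition escaping b pi := block b pi /\
  ~ long (block_end b) [set x | block_end b <= x] setT pi.

(** The part of this condition that is decided to the left of the end of the block
    at [y]. *)
Definition escaping_until y b pi := [/\ block b pi, block y pi &
  ~ long (block_end b) [set x | block_end b <= x < block_end y]
      [set x | x < y] pi].

Definition generic pi :=
  [/\ two_lines pi, locally_finite pi, no_ties r pi & right_unbounded pi].

Lemma lt_hypotenuse (x z : R) : `|x| + r < z -> x ^+ 2 + r ^+ 2 < z ^+ 2.
Proof.
move=> xz; have r0 := r_gt0; have x0 := normr_ge0 x.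
rewrite -(real_normK (num_real x)).
have := @far_jump _ r r_gt0 `|x| (`|x| - z) 0.
by rewrite subr0 subKr; apply => //; lra.
Qed.

Lemma sqdist_le_hypotenuse pi s u k : two_lines pi -> s.2 = height k -> pi u ->
  sqdist s u <= (s.1 - u.1) ^+ 2 + r ^+ 2.
Proof.
move=> piE sk piu; have [k' hk] := piE _ piu; have [kk|kk] := eqVneq k k'.
  by rewrite sqdist_same ?sk ?hk ?kk// lerDl sqr_ge0.
by rewrite (sqdist_other (r:=r) (l:=k) (m:=k')).
Qed.

Lemma nearer_than_behind pi b s a u k : two_lines pi -> s.2 = height k ->
  s.1 < b -> pi a -> cell h b 3 a.1 -> block_end b <= u.1 ->
  sqdist s a <= sqdist s u.
Proof.
move=> piE sk sb pia /andP[a1 a2] bu; have r0 := r_gt0; have h0 := h_gt0.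
apply: le_trans (sqdist_le_hypotenuse piE sk pia) _.
apply: le_trans (_ : (s.1 - u.1) ^+ 2 <= _); last exact: sqdist_ge_fst.
have mu := block_end_ge h_gt0 b (ltnW (ltnW mK)); have ml := m_large.
rewrite -(sqrrN (s.1 - u.1)) ltW//; apply: lt_hypotenuse.
rewrite ltr0_norm; lra.
Qed.

Lemma cell3_end b : b + 4 * h < block_end b.
Proof.
have h0 := h_gt0; apply: lt_le_trans (block_end_ge h_gt0 b mK).
by rewrite ltrD2l ltr_pM2r// ltr_nat; have := m_gt4 r_gt0 h_gt0 m_large; natlia.
Qed.

Lemma block_inf b c Z : c <= b -> block b (strip [set x | c <= x] Z) <-> block b Z.
Proof.
move=> cb; apply: block_strip => // x /andP[bx _]; exact: le_trans bx.
Qed.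

(** For a walk that has not reached [y] yet, the first points of the block at [y] are
    nearer than everything beyond that block, so the configuration there does not
    matter. *)
Lemma escaping_restrict b y pi : generic pi -> block_end b <= y ->
  escaping b pi -> block y pi -> escaping_until y b pi.
Proof.
move=> [piE lfpi nt ru] by_ [B nl] By; split=> // -[n [p [gp Tp lp]]].
apply: nl; exists n, p; split=> //; split; first exact: gp.1.
move=> i ilen; have /greedy_stepP[[Zp /andP[Dp _]] up near] := gp.2 i ilen.
apply/greedy_stepP; split=> // u [piu Du] uu.
have [ue|ue] := ltP u.1 (block_end y); first by apply: near => //; split=> //; apply/andP.
have [a [pia al ca]] := block_first r_gt0 h_gt0 m_large mK By.
have h0 := h_gt0; have ca' := ca; move: ca' => /andP[a1 a2].
have ya : y <= a.1 by lra.
have [k hk] : exists k, (p i).2 = height k.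
  apply: (path_height _ _ gp) => //; last exact: ltnW.
  by move=> z [/piE].
apply: le_trans (nearer_than_behind piE hk (Tp i ilen) pia ca ue).
apply: near; first split=> //=; last first.
  move=> j ji e; have := Tp j (leq_trans ji ilen); rewrite e /=; lra.
apply/andP; split; first lra.
by have := cell3_end y; lra.
Qed.

Lemma strip_sub D Z : strip D Z `<=` Z.
Proof. by move=> z []. Qed.

Lemma generic_strip c pi : generic pi ->
  [/\ two_lines (strip [set x | c <= x] pi),
      locally_finite (strip [set x | c <= x] pi) &
      right_unbounded (strip [set x | c <= x] pi)].
Proof.
move=> [piE lfpi _ ru]; split; first by move=> z /strip_sub /piE.
  apply: locally_finite_sub lfpi; exact: strip_sub.
move=> a; have [u piu] := ru (Num.max a c).
by rewrite gt_max => /andP[au cu]; exists u => //; split=> //=; exact: ltW.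
Qed.

Lemma strip_walk c s pi : generic pi -> exists W,
  greedy_walk euclidean_dist (strip [set x | c <= x] pi) s W.
Proof.
move=> gpi; have [_ lf ru] := generic_strip c gpi.
by apply: greedy_walk_exists lf _ => n p; exact: right_unbounded_unvisited.
Qed.

Lemma entry_bound b Z s W k n : two_lines Z -> block b Z -> s.2 = height k ->
  greedy_walk euclidean_dist Z s W -> (forall j, (j <= n)%N -> (W j).1 < b) ->
  b <= (W n.+1).1 -> (W n.+1).1 < b + 4 * h.
Proof.
move=> ZE B sk gW before bW; have [Zt ut near] := walk_step gW n.
have [k' hk'] := walk_height ZE sk gW n.
have [|_ //] := block_entry r_gt0 h_gt0 m_large mK ZE B hk' (before n (leqnn n)) Zt bW.
move=> u Zu /andP[bu _]; apply: near => // i ile e.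
by have := before i ile; rewrite e ltNge bu.
Qed.

(** Once the walk has passed through the block at [y], it agrees with the walk from
    the end of that block, and a step which is short for [y] is short for [b]. *)
Lemma escaping_extend b y pi : generic pi -> grid_point r (block_end b - h, height l) ->
  block_end b <= y -> escaping_until y b pi -> escaping y pi -> escaping b pi.
Proof.
move=> gpi gr by_ [B _ nl] [By nly]; split=> // -[n [p [gp _ lp]]].
have [piE lfpi nt ru] := gpi; have h0 := h_gt0; have hL' := hL.
have [ZE lfZ ruZ] := generic_strip (block_end b) gpi.
pose Z := strip [set x | block_end b <= x] pi.
have [W gW] := strip_walk (block_end b) (block_end b - h, height l) gpi.
have eqW i : (i <= n.+1)%N -> p i = W i.
  have gW' := (greedy_walk_path _ _ _).1 gW n.+1.
  exact: (greedy_path_uniq nt (@strip_sub _ pi) (or_intror gr) gp gW').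
rewrite (eqW n (leqnSn n)) (eqW n.+1 (leqnn _)) (eqW 1%N isT) in lp.
have ByZ : block y Z by apply/block_inf => //; exact: le_trans by_.
have W0 : W 0%N = (block_end b - h, height l) by case: gW.
have Zge i : block_end b <= (W i.+1).1 by have [[]] := walk_step gW i.
have ye := cell3_end y.
have [[i iln yi]|before] := pselect (exists2 i, (i <= n)%N & y <= (W i).1); last first.
  have before' i : (i <= n)%N -> (W i).1 < y.
    by move=> iln; rewrite ltNge; apply/negP => yi; apply: before; exists i.
  apply: nl; exists n, W; split=> //; split=> // i iln.
  have [[piWi ci] ui near] := walk_step gW i.
  apply/greedy_stepP; split=> //; last by move=> u [piu /andP[cu _]]; apply: near.
  split=> //; apply/andP; split=> //=; have [yW|Wy] := leP y (W i.+1).1; last lra.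
  have := entry_bound ZE ByZ (erefl : (_, height l).2 = _) gW _ yW.
  move=> H; have {}H : (W i.+1).1 < y + 4 * h.
    by apply: H => j ji; apply: before'; natlia.
  by lra.
have sy : (block_end b - h, height l).1 < y by rewrite /=; lra.
have [t [t' [ti tt']]] := block_crossing r_gt0 h_gt0 h_small m_large mK ZE lfZ ByZ
  (erefl : (_, height l).2 = _) sy gW yi.
have tr := crossed_traversing mK tt'.
have [trl /andP[try tre] _ _] := tr.
have [nt'|t'n] := ltnP n t'.
  have [_ _ H H3 _] := tt'; have tn : (t <= n)%N := leq_trans ti iln.
  have [tln /andP[yn ne] _ _] := H n (introT andP (conj tn (ltnW nt'))).
  have n0 : n <> 0%N.
    by move=> n0; move: yn; rewrite n0 W0 /=; move: sy => /=; rewrite leNgt => ->.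
  have n3 : y + 3 * h <= (W n).1.
    have [n' nE] : exists n', n = n'.+1 by exists n.-1; clear -n0; lia.
    move: tln yn ne; rewrite nE => tln yn ne.
    have [Zn _ _] := walk_step gW n'.
    by apply: (block_moat r_gt0 h_gt0 m_large mK ByZ Zn tln); rewrite yn ne.
  have := H3 n (introT andP (conj tn nt')).
  case: lp => [[/n0]//|lp] s3.
  have : (3 * h) ^+ 2 <= ((W n).1 - block_end b + L) ^+ 2.
    by rewrite ler_pXn2r ?nnegrE//; lra.
  by lra.
have coal i' : greedy_path (strip [set x | block_end y <= x] pi)
    (block_end y - h, height l) i' (shifted r h l K y W t').
  apply: (coalescence (T := setT) r_gt0 h_gt0 m_large mK hL L_small piE lfpi nt
    (@strip_sub _ pi) ByZ sy gW tt') => //.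
  - by move=> z piz yz; split=> //=; have := yz; rewrite /=; lra.
  - move=> n' _ _; have [_ ruy] := generic_strip (block_end y) gpi.
    by move=> /(right_unbounded_unvisited W n')[u [piu yu] uu]; exists u.
have n0 : n <> 0%N.
  move=> n0; move: t'n; rewrite n0 leqn0 => /eqP t0; move: try.
  by rewrite t0 W0; move: sy => /= ?; lra.
case: lp => [[/n0]//|lp].
have step i' : sqdist (shifted r h l K y W t' i') (shifted r h l K y W t' i'.+1) <=
    ((shifted r h l K y W t' i').1 - block_end y + L) ^+ 2.
  rewrite leNgt; apply/negP => lt'; apply: nly; exists i'; eexists; split.
  - exact: coal.
  - by [].
  - by right.
have := step (n - t')%N; case E : (n - t')%N => [|k] /=.
  have nE : n = t' by natlia.
  have lq : (W (t' + 1)%N).2 = height l.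
    apply: contrapT => lq; apply: nly; exists 0%N; eexists; split; [exact: coal|by []|].
    by left.
  have [_ cq] : strip [set x | block_end y <= x] pi (W (t' + 1)%N).
    by have [_ /(_ 0%N isT) /greedy_stepP[]] := coal 1%N.
  rewrite nE in lp; rewrite addn1 in lq cq *; rewrite sqdist_same/= ?lq//.
  have := crossed_last r_gt0 h_gt0 m_large mK ByZ tt' => /andP[le' _].
  move: lp; rewrite (sqdist_same (s := W t')) ?trl ?lq//.
  rewrite /= in cq; move=> lp sq.
  have : ((W t').1 - (W t'.+1).1) ^+ 2 <= (block_end y - h - (W t'.+1).1) ^+ 2.
    rewrite -(sqrrN ((W t').1 - _)) -(sqrrN (_ - _ - (W t'.+1).1)) !opprB.
    by rewrite ler_pXn2r ?nnegrE//; lra.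
  have : (block_end y - h - block_end y + L) ^+ 2 <= ((W t').1 - block_end b + L) ^+ 2.
    by rewrite ler_pXn2r ?nnegrE//; lra.
  by lra.
have nE : (t' + k.+1)%N = n by natlia.
have nE' : (t' + k.+2)%N = n.+1 by natlia.
rewrite nE nE' => st.
have [_ cn] : strip [set x | block_end y <= x] pi (W n).
  by have [_ /(_ k (leqnn _)) /greedy_stepP[]] := coal k.+1; rewrite /= nE.
rewrite /= in cn.
have : ((W n).1 - block_end y + L) ^+ 2 <= ((W n).1 - block_end b + L) ^+ 2.
  by rewrite ler_pXn2r ?nnegrE//; have := cell3_end y; lra.
by lra.
Qed.

Lemma step_far pi s (t : R * R) u (k : bool) : two_lines pi -> s.2 = height k ->
  pi u -> `|s.1 - u.1| + r < t.1 - s.1 -> ~ sqdist s t <= sqdist s u.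
Proof.
move=> piE sk piu lt_ le_; have := lt_hypotenuse lt_.
have := sqdist_le_hypotenuse piE sk piu; have := sqdist_ge_fst s t.
by rewrite -(sqrrN (s.1 - t.1)) opprB; lra.
Qed.

(** The bound on the distance from one escaping block to the next one on its left
    grows with the distance to [y], as does the way back across a gap behind [y]. The
    use of [escaping_until] makes this an event to the left of the end of the block
    at [y]. *)
Definition anchored g y pi := block y pi /\
  forall i : nat, i = 0%N \/ escaping_until y (y - i%:R * h) pi ->
  exists2 j : nat, (i < j <= i + i + g)%N & escaping_until y (y - j%:R * h) pi.

Lemma blocks_apart y i pi : (0 < i)%N -> block (y - i%:R * h) pi -> block y pi ->
  block_end (y - i%:R * h) <= y.
Proof.
move=> i0 Bi By; have [iK|Ki] := ltnP i K.
  exfalso; apply: (block_disjoint r_gt0 h_gt0 m_large mK _ Bi (j := i)).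
    by rewrite i0.
  by rewrite subrK.
have : (K%:R * h <= i%:R * h) by rewrite ler_pM2r// ler_nat.
by rewrite /block_end; lra.
Qed.

(** When the walk from an escaping block on the left arrives at the end of an
    anchored block with a long gap in front of it, it returns through everything it
    has left behind, block by block: there is always something nearer than the
    point behind the gap. *)
Lemma no_escape g G y pi t0 : generic pi -> anchored g y pi ->
  (forall z, pi z -> ~ (block_end y <= z.1 < block_end y + G%:R * h)) ->
  (g + K)%:R * h + r <= G%:R * h -> (0 < t0)%N ->
  ~ escaping (y - t0%:R * h) pi.
Proof.
move=> gpi [By anch] gap Glarge t00 [Bx nlx].
have [piE lfpi nt ru] := gpi; have h0 := h_gt0; have r0 := r_gt0; have hL' := hL.
have ml := m_large; have Ls := L_small.
set x := y - t0%:R * h in Bx nlx.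
have xy : block_end x <= y := blocks_apart t00 Bx By.
have [ZE lfZ ruZ] := generic_strip (block_end x) gpi.
set Z := strip [set x0 | block_end x <= x0] pi in ZE lfZ ruZ.
have [W gW] := strip_walk (block_end x) (block_end x - h, height l) gpi.
rewrite -/Z in gW.
have W0 : W 0%N = (block_end x - h, height l) by case: gW.
have Zpi : Z `<=` pi := @strip_sub _ pi.
have Zge i : block_end x <= (W i.+1).1 by have [[]] := walk_step gW i.
have stepW n : sqdist (W n) (W n.+1) <= ((W n).1 - block_end x + L) ^+ 2.
  rewrite leNgt; apply/negP => lt_; apply: nlx; exists n, W; split=> //; last by right.
  exact: (greedy_walk_path _ _ _).1 gW n.+1.
have ye := cell3_end y.
have sx : (block_end x - h, height l).2 = height l by [].
have Wk n := walk_height ZE sx gW n.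
(* the first step beyond the gap *)
have exN : exists N, block_end y <= (W N).1.
  have [N HN] := greedy_walk_unbounded lfZ gW (`|block_end y| + `|block_end x|).
  exists N.+1; have := HN N.+1 (leqnSn N); have := Zge N.
  have := ler_norm (block_end y); have := ler_norm (- block_end x); rewrite normrN.
  have := normr_ge0 (block_end y); have := normr_ge0 (block_end x).
  have [w0|w0] := leP 0 (W N.+1).1; first by rewrite (ger0_norm w0); lra.
  by rewrite (ltr0_norm w0); lra.
pose N := ex_minn exN.
have [NW Nmin] : block_end y <= (W N).1 /\ forall i, (i < N)%N -> (W i).1 < block_end y.
  rewrite /N; case: ex_minnP => k bk kmin; split=> // i ik.
  by rewrite ltNge; apply/negP => /kmin; rewrite leqNgt ik.
have N0 : (0 < N)%N.
  by rewrite lt0n; apply/eqP => N0; move: NW; rewrite N0 W0 /=; lra.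
have [n NE] : exists n, N = n.+1 by exists N.-1; clear -N0; lia.
rewrite NE in NW Nmin; have [ZN uN nearN] := walk_step gW n.
have {}NW : block_end y + G%:R * h <= (W n.+1).1.
  rewrite leNgt; apply/negP => lt_; apply: (gap _ (Zpi _ ZN)).
  by rewrite NW lt_.
have Wn := Nmin n (ltnSn n).
have ByZ : block y Z by apply/block_inf => //; exact: le_trans xy.
have sy : (block_end x - h, height l).1 < y by rewrite /=; lra.
have yN : y <= (W n.+1).1 by have := mulr_ge0 (ler0n R G) (ltW h0); lra.
have [t [t' [tN tt']]] := block_crossing r_gt0 h_gt0 h_small m_large mK ZE lfZ ByZ
  sx sy gW yN.
have [tt before trav _ lastW] := tt'.
have tr := crossed_traversing mK tt'; have [trl /andP[try tre] trvis _] := tr.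
have t'n : (t' <= n)%N.
  rewrite leqNgt; apply/negP => nt'; have [_ /andP[_ +] _ _] := trav n.+1 (introT andP (conj tN nt')).
  by have := mulr_ge0 (ler0n R G) (ltW h0); lra.
have /andP[lege _] := crossed_last r_gt0 h_gt0 m_large mK ByZ tt'.
have Gg : g%:R * h + K%:R * h + r <= G%:R * h by move: Glarge; rewrite natrD mulrDl.
have gh : 0 <= g%:R * h by rewrite mulr_ge0// ltW.
have mKh : (m%:R + 2) * h <= K%:R * h by rewrite ler_pM2r// natr_gt_m.
have Km : 0 <= (K%:R - m%:R - 1) * h by lra.
have mark_late v u i : escaping_until y v pi -> block_end x <= v -> block_end v <= y ->
    pi u -> u.2 = height (~~ l) -> v <= u.1 < block_end v -> (i <= t')%N -> W i <> u.
  move=> [Bv _ nlv] xv vy piu ul /andP[vu uv] it'.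
  have BvZ : block v Z by apply/block_inf.
  have sv : (block_end x - h, height l).1 < v by rewrite /=; lra.
  have vt : v <= (W t).1.
    have [_ /andP[? _] _ _] := trav t (introT andP (conj (leqnn _) tt)).
    by have := cell3_end v; lra.
  have [tv [tv' [tvt ttv]]] := block_crossing r_gt0 h_gt0 h_small m_large mK ZE lfZ BvZ
    sx sv gW vt.
  have [ttv' beforev travv _ _] := ttv.
  have Wt : y <= (W t).1 by have [_ /andP[]] := trav t (introT andP (conj (leqnn _) tt)).
  have tv't : (tv' < t)%N.
    rewrite ltnNge; apply/negP => ttv''.
    have [_ /andP[_ +] _ _] := travv t (introT andP (conj tvt ttv'')); lra.
  have [iv|iv] := leqP i tv'; first exact: (crossed_mark_unvisited r_gt0 mK ttv).
  have [ti|it] := ltnP t i.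
    have [_ /andP[+ _] _ _] := trav i (introT andP (conj (ltnW ti) it')) => yi e.
    by move: yi; rewrite e; lra.
  have Wv j : (j <= tv')%N -> (W j).1 < y.
    move=> jv; have [jtv|tvj] := ltnP j tv; first by have := beforev j jtv; have := cell3_end v; lra.
    have [_ /andP[_ +] _ _] := travv j (introT andP (conj tvj jv)); lra.
  have coal : greedy_path (strip [set x0 | block_end v <= x0 < block_end y] pi)
      (block_end v - h, height l) (t - tv') (shifted r h l K v W tv').
    apply: (coalescence (T := [set x0 | x0 < y]) r_gt0 h_gt0 m_large mK hL L_small
      piE lfpi nt Zpi BvZ sv gW ttv) => //.
    - by move=> z /= /andP[].
    - by move=> z piz /andP[vz _]; split=> //=; have := cell3_end v; lra.
    - by rewrite /=; lra.
    - move=> k tk Tk ck; rewrite /= ck /=; have [yk|ky] := leP y (W k.+1).1; last lra.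
      have := entry_bound ZE ByZ sx gW _ yk => H; suff : (W k.+1).1 < y + 4 * h by lra.
      by apply: H => j jk; have [jv|vj] := leqP j tv'; [exact: Wv|apply: Tk; rewrite vj].
    - move=> k tk Tk; have [a [Za al /andP[a1 a2]]] := block_first r_gt0 h_gt0 m_large mK By.
      exists a; first by split=> //=; apply/andP; split; lra.
      move=> j jk e; suff : (W j).1 < y by rewrite e; lra.
      by have [jv|vj] := leqP j tv'; [exact: Wv|apply: Tk; rewrite vj].
    - by move=> j /andP[_ jt]; apply: before; move: jt; rewrite subnKC// ltnW.
  have iE : i = (tv' + (i - tv'.+1).+1)%N by clear -iv; lia.
  have [_ /(_ (i - tv'.+1)%N)] := coal; case; first by clear -iv it; lia.
  by rewrite /= -iE => -[[_ /andP[+ _]] _] _ e; rewrite e; lra.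
have mark_late0 u i : u.2 = height (~~ l) -> y <= u.1 -> (i <= t')%N -> W i <> u.
  by move=> ul yu it'; exact: (crossed_mark_unvisited r_gt0 mK tt').
have Wnx : block_end x - h <= (W n).1.
  by case: (n) => [|n']; [rewrite W0|have := Zge n'; lra].
have not_near u : pi u -> `|(W n).1 - u.1| + r < (W n.+1).1 - (W n).1 ->
    block_end x <= u.1 -> ~ unvisited W n u.
  move=> piu lt_ xu uu; have [k hk] := Wk n.
  by apply: (step_far piE hk piu lt_); apply: nearN.
(* the leftmost block among those that are completely cleared *)
pose cleared i := [/\ i = 0%N \/ escaping_until y (y - i%:R * h) pi, (i < t0)%N &
  forall u, pi u -> u.2 = height (~~ l) ->
    y - i%:R * h <= u.1 < block_end (y - i%:R * h) -> ~ unvisited W n u].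
have cleared0 : cleared 0%N.
  split=> //; [by left|]; rewrite mul0r subr0 => u piu ul /andP[yu uy].
  apply: not_near => //; last by lra.
  have := normr_ge0 ((W n).1 - u.1).
  rewrite /block_end in Wn uy NW.
  have [w0|w0] := leP 0 ((W n).1 - u.1); first by rewrite (ger0_norm w0); lra.
  by rewrite (ltr0_norm w0); lra.
have exC : exists i, `[< cleared i >] by exists 0%N; apply/asboolP.
have ubC i : `[< cleared i >] -> (i <= t0)%N by move=> /asboolP[_ /ltnW].
have [i /asboolP[iV it0 iC] imax] := ex_maxnP exC ubC.
set v := y - i%:R * h in iV iC.
have Bv : block v pi by case: iV => [i0|[]//]; rewrite /v i0 mul0r subr0.
have xv : block_end x <= v.
  have xE : x = v - (t0 - i)%:R * h by rewrite /x /v natrB 1?ltnW//; ring.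
  have d0 : (0 < t0 - i)%N by rewrite subn_gt0.
  by rewrite xE; apply: (blocks_apart d0 _ Bv); rewrite -xE.
have vy : v <= y by rewrite /v gerBl mulr_ge0// ltW.
have [u [piu ul /andP[u1 u2]]] := block_mark_exists mK Bv.
have uv : v <= u.1 < block_end v.
  rewrite /block_end; apply/andP; split; first by have := mulr_ge0 (ler0n R m) (ltW h0); lra.
  by move: u2; rewrite -natr1; lra.
have [i0 i0n Wi0] := visited_ex (iC u piu ul uv).
have t'i0 : (t' < i0)%N.
  rewrite ltnNge; apply/negP => i0t'; move: Wi0; case: iV => [iz|iV].
    by apply: mark_late0 => //; move: uv; rewrite /v iz mul0r subr0 => /andP[].
  have [iz|iz] := posnP i.
    by apply: mark_late0 => //; move: uv; rewrite /v iz mul0r subr0 => /andP[].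
  by apply: mark_late iV xv _ piu ul uv i0t'; exact: (blocks_apart iz Bv By).
(* the walk has cleared everything between this block and the gap, hence stays
   to the left of it *)
have Wnu : (W n).1 <= u.1.
  move: i0n; rewrite leq_eqVlt => /orP[/eqP <-|i0n]; first by rewrite Wi0.
  rewrite leNgt; apply/negP => unW.
  have [n' nE] : exists n', n = n'.+1 by exists n.-1; clear -i0n; lia.
  have [Zn un _] := walk_step gW n'; rewrite -nE in Zn un.
  have un' j : (j <= i0)%N -> W j <> W n by move=> ji; apply: un; clear -ji i0n nE; lia.
  have [Wt'|Wt'] := ltP (W n).1 (W t').1.
    have := @unvisited_behind_left _ r r_gt0 Z _ i0 W (W n) t' l ZE sx
      ((greedy_walk_path _ _ _).1 gW i0) Zn un' _ (ltnW t'i0) Wt'.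
    by rewrite Wi0 /= => H; have := H _; lra.
  have [kn hkn] := ZE _ Zn; have [knl|knl] := eqVneq kn l.
    have e1 : (W n).1 = (W t').1.
      by apply: le_anti; rewrite Wt' lastW// hkn knl.
    apply: (un' t' (ltnW t'i0)).
    by rewrite [LHS]surjective_pairing [RHS]surjective_pairing e1 trl hkn knl.
  have /andP[_] := block_mark ByZ Zn (height_neg hkn knl) (introT andP (conj (le_trans try Wt') Wn)).
  by move: lege; rewrite /block_end -natr1; lra.
have [j /andP[ij jig] jV] := anch i iV.
have jh : j%:R * h <= (i%:R + i%:R + g%:R) * h by rewrite ler_pM2r// -!natrD ler_nat.
have ih : i%:R * h + h <= j%:R * h.
  by rewrite -[X in _ + X]mul1r -mulrDl ler_pM2r// natr1 ler_nat.
rewrite !mulrDl in jh mKh; have u2' : u.1 < v + m%:R * h + h.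
  by move: u2; rewrite -natr1 mulrDl mul1r addrA.
rewrite /block_end in NW Wn lege Wnx.
have [jt0|t0j] := ltnP j t0; last first.
  have t0h : t0%:R * h <= j%:R * h by rewrite ler_pM2r// ler_nat.
  have := stepW n; have := sqdist_ge_fst (W n) (W n.+1).
  have : ((W n).1 - block_end x + L) ^+ 2 < ((W n).1 - (W n.+1).1) ^+ 2.
    rewrite -(sqrrN (_ - (W n.+1).1)) opprB; rewrite /v in u2'; rewrite /x in Wnx *.
    by rewrite /block_end ltr_pXn2r ?nnegrE//; lra.
  by lra.
have [w [piw wl wj uw]] : exists w, [/\ pi w, w.2 = height (~~ l),
    y - j%:R * h <= w.1 < block_end (y - j%:R * h) & unvisited W n w].
  apply: contrapT => H; have : (j <= i)%N.
    apply: imax; apply/asboolP; split=> //; first by right.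
    by move=> w piw wl wj uw; apply: H; exists w.
  by rewrite leqNgt ij.
have [Bj _ _] := jV.
have /andP[w1 w2] := block_mark Bj piw wl wj.
have xw : block_end x <= w.1.
  have xE : x = (y - j%:R * h) - (t0 - j)%:R * h by rewrite /x natrB 1?ltnW//; ring.
  have : block_end x <= y - j%:R * h.
    have d0 : (0 < t0 - j)%N by rewrite subn_gt0.
    by rewrite xE; apply: (blocks_apart d0 _ Bj); rewrite -xE.
  by move: wj => /andP[? _]; lra.
have w2' : w.1 < y - j%:R * h + m%:R * h + h.
  by move: w2; rewrite -natr1 mulrDl mul1r addrA.
apply: (not_near w piw _ xw uw); rewrite /v in u2'.
have [w0|w0] := leP 0 ((W n).1 - w.1); first by rewrite (ger0_norm w0); lra.
by rewrite (ltr0_norm w0); lra.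
Qed.

End good_blocks.

(** * Walks that escape to the right *)

Section escape.
Context {R : realType} (r : R).
Hypothesis r_gt0 : 0 < r.
Implicit Types (Z pi : set (R * R)) (s u : R * R) (W : nat -> R * R).
Local Notation height := (height r).

Lemma seq_gap (a : R) (q : seq R) : exists2 a1, a < a1 &
  forall x, x \in q -> ~ (a < x < a1).
Proof.
elim: q => [|x q [a1 aa1 H]]; first by exists (a + 1); rewrite ?ltrDl.
have [ax|xa] := ltP a x; last first.
  by exists a1 => // y; rewrite inE => /orP[/eqP ->|/H//]; rewrite ltNge xa.
exists (Num.min a1 x); first by rewrite lt_min aa1.
move=> y; rewrite inE lt_min => /orP[/eqP ->|/H yq].
  by rewrite ltxx !andbF.
by move=> /and3P[ay ya1 _]; apply: yq; rewrite ay.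
Qed.

Lemma gap_right pi a : locally_finite pi -> exists2 a1, a < a1 &
  forall z, pi z -> ~ (a < z.1 < a1).
Proof.
move=> lf; have /finite_seqP[q qE] := lf a (a + 1).
have [a1 aa1 H] := seq_gap a (map fst q).
exists (Num.min a1 (a + 1)); first by rewrite lt_min aa1 ltrDl ltr01.
move=> z piz; rewrite lt_min => /and3P[az za1 za]; apply: (H z.1); last by rewrite az.
apply: map_f; suff : [set` q] z by []; rewrite -qE; split=> //=.
by rewrite !ltW.
Qed.

Lemma gap_left pi a : locally_finite pi -> exists2 a0, a0 < a &
  forall z, pi z -> ~ (a0 < z.1 < a).
Proof.
move=> lf; have /finite_seqP[q qE] := lf (a - 1) a.
have [a1 aa1 H] := seq_gap (- a) [seq - z.1 | z <- q].
exists (Num.max (- a1) (a - 1)); first by rewrite gt_max ltrNl aa1 ltrBlDr ltrDl ltr01.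
move=> z piz; rewrite gt_max => /andP[/andP[az za1] za].
apply: (H (- z.1)); last by rewrite ltrN2 za ltrNl.
apply: map_f; suff : [set` q] z by []; rewrite -qE; split=> //=.
by rewrite !ltW.
Qed.

(** Since the gap lies between the two rationals, the walk that starts there
    sees only what is beyond the gap. *)
Lemma rational_start (a0 a1 e : R) : a0 < a1 -> 0 < e -> exists c h : rat,
  [/\ a0 < ratr c - ratr h :> R, ratr c < a1, 0 < h & ratr h < e].
Proof.
move=> a01 e0; have /rat_in_itvoo[c] : (a0 + a1) / 2 < a1 by lra.
rewrite in_itv /= => /andP[c0 c1].
have : 0 < Num.min (ratr c - a0) e by rewrite lt_min e0 andbT; lra.
move/rat_in_itvoo => [h]; rewrite in_itv /= lt_min => /and3P[h0 h1 h2].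
exists c, h; split=> //; first lra.
by rewrite -(ltr0q R).
Qed.

(** The first [N] steps have some bound, and [X] bounds the later ones. *)
Lemma walk_not_long pi c h l T X N : generic r pi ->
  grid_point r (c - h, height l) -> 0 < h ->
  greedy_walk euclidean_dist (strip [set x | c <= x] pi) (c - h, height l) T ->
  (T 1%N).2 = height l -> pi X ->
  (forall n, (N <= n)%N -> sqdist (T n) (T n.+1) <= sqdist (T n) X) ->
  exists2 L : nat, h <= L%:R & ~ long r h L%:R l c [set x | c <= x] setT pi.
Proof.
move=> [piE lfpi nt ru] gr h0 gT T1 piX near.
have r0 := r_gt0; have T0 : T 0%N = (c - h, height l) by case: gT.
have [M M0 HM] : exists2 M, 0 <= M &
    forall n, (n < N)%N -> sqdist (T n) (T n.+1) <= M ^+ 2.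
  elim: N {near} => [|N [M M0 HM]]; first by exists 0.
  have s0 := sqdist_ge0 (T N) (T N.+1).
  exists (1 + M + sqdist (T N) (T N.+1)); first by lra.
  move=> n; rewrite ltnS leq_eqVlt => /orP[/eqP ->|/HM h1].
    set q := sqdist _ _ in s0 *.
    apply: (@le_trans _ _ (1 + M + q)); first by lra.
    by rewrite expr2 ler_peMr; lra.
  by apply: le_trans h1 _; rewrite ler_pXn2r ?nnegrE//; lra.
have [L HL] : exists L : nat, h + M + `|c - X.1| + h + r < L%:R.
  exists (Num.bound (h + M + `|c - X.1| + h + r)); apply: archi_boundP.
  by have := normr_ge0 (c - X.1); lra.
have n0 := normr_ge0 (c - X.1).
exists L; first lra; move=> [n [p [gp _ lp]]].
have gT' := (greedy_walk_path _ _ _).1 gT n.+1.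
have eqT := greedy_path_uniq nt (@strip_sub _ _ pi) (or_intror gr) gp gT'.
rewrite (eqT n (leqnSn n)) (eqT n.+1 (leqnn _)) (eqT 1%N isT) in lp.
case: lp => [[_ /(_ T1)//]|]; apply/negP; rewrite -leNgt.
have Tn : c - h <= (T n).1.
  case: (n) => [|n']; first by rewrite T0.
  by have [[_ /= ?] _ _] := walk_step gT n'; lra.
have [nN|Nn] := ltnP n N.
  by apply: le_trans (HM n nN) _; rewrite ler_pXn2r ?nnegrE//; lra.
apply: le_trans (near n Nn) _.
have [k hk] : exists k, (T n).2 = height k.
  by apply: (walk_height _ _ gT (k0 := l)) => // z [/piE].
apply: le_trans (sqdist_le_hypotenuse piE hk piX) _.
apply/ltW/(lt_hypotenuse r_gt0).
have : `|(T n).1 - X.1| <= `|(T n).1 - c| + `|c - X.1|.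
  by rewrite -[X in `|X|](subrKA c) ler_normD.
have : `|(T n).1 - c| <= (T n).1 - c + h + h.
  have [w0|w0] := leP 0 ((T n).1 - c); first by rewrite ger0_norm; lra.
  by rewrite ltr0_norm; lra.
by lra.
Qed.

Section transient.
Variables (pi : set (R * R)) (W : nat -> R * R) (X : R * R).
Hypothesis gpi : generic r pi.
Hypothesis walkW : greedy_walk euclidean_dist pi (0, 0) W.
Hypothesis piX : pi X.
Hypothesis notX : forall n, W n <> X.

Let piE : two_lines r pi. Proof. by case: gpi. Qed.
Let lfpi : locally_finite pi. Proof. by case: gpi. Qed.

Let nearX n : sqdist (W n) (W n.+1) <= sqdist (W n) X.
Proof. by have [_ _] := walk_step walkW n; apply => // i _. Qed.

Lemma origin_height : ((0, 0) : R * R).2 = height false.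
Proof. by []. Qed.

Definition short_continuation := exists (c h : rat) (L : nat) l,
  [/\ 0 < h, 4 * ratr h <= r, ratr h <= L%:R :> R &
      ~ long r (ratr h) L%:R l (ratr c) [set x | ratr c <= x] setT pi].

(** From time [n] on the walk only uses the part of the configuration to the right of
    [a0], of which it has not seen anything before. *)
Lemma fresh_cut n a0 : (W n).1 <= a0 ->
  (forall z, pi z -> a0 < z.1 -> unvisited W n z) ->
  (forall m, (n < m)%N -> a0 < (W m).1) -> short_continuation.
Proof.
move=> Wn fresh stay; have r0 := r_gt0.
have [a1 a01 nogap] := gap_right a0 lfpi.
have [|c [h [c0 c1 h0 hr]]] := @rational_start a0 a1 (r / 4) a01; first lra.
have h0' : 0 < ratr h :> R by rewrite ltr0q.
have [l hl] := piE (let: And3 H _ _ := walk_step walkW n in H).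
have far z : pi z -> a0 < z.1 -> ratr c <= z.1.
  move=> piz az; rewrite leNgt; apply/negP => zc; apply: (nogap z piz).
  by rewrite az (lt_trans zc).
have st m : [/\ pi (W m.+1), unvisited W m (W m.+1) &
  forall u, pi u -> unvisited W m u -> sqdist (W m) (W m.+1) <= sqdist (W m) u].
  exact: (walk_step walkW).
pose T i := if i is j.+1 then W (n + j.+1)%N else (ratr c - ratr h, height l).
have gT : greedy_walk euclidean_dist (strip [set x | ratr c <= x] pi)
    (ratr c - ratr h, height l) T.
  apply/greedy_walk_path => N; split=> // i _; apply/greedy_stepP.
  rewrite /= addnS; have [Zt ut near] := st (n + i)%N.
  have Wt : ratr c <= (W (n + i).+1).1 by apply: far => //; apply: stay; rewrite ltnS leq_addr.
  have unv u : pi u -> ratr c <= u.1 -> unvisited T i u -> unvisited W (n + i) u.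
    move=> piu cu uu j jn; have [jn'|nj] := leqP j n.
      by apply: (fresh u piu _ j jn'); lra.
    have jE : j = (n + (j - n.+1).+1)%N by clear -nj; lia.
    by rewrite jE; apply: (uu (j - n.+1).+1); natlia.
  split.
  - by split.
  - move=> [|j] ji /= e; first by move: Wt; rewrite -e /=; lra.
    by apply: (ut (n + j.+1)%N) e; rewrite leq_add2l.
  - case: i {Wt} unv Zt ut near => [|i] unv Zt ut near u [piu cu] uu; last first.
      by apply: near => //; apply: unv.
    have [k hk] := piE piu; have [k' hk'] := walk_height piE origin_height walkW n.
    rewrite addn0 in unv near ut Zt *.
    apply: (nearest_shift (r := r) (s := W n) (l := l) (ls := k') (lw := k)) => //=.
    + lra.
    + suff : ratr c <= (W n.+1).1 by lra.
      by apply: far => //; apply: stay.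
    + by move: cu => /=; lra.
    + by apply: near => //; apply: unv.
have [|||L hL nl] := @walk_not_long pi (ratr c) (ratr h) l T X 1%N gpi _ h0' gT _ piX.
- by exists (c - h), l; rewrite rmorphB.
- by rewrite /T addn1.
- by case=> // k _ /=; rewrite !addnS; exact: nearX.
- by exists c, h, L, l; split=> //; lra.
Qed.

(** The point [v] has been visited, but another point just above or below it has
    not; a walk that starts just before [v] visits it first and is then in the
    same situation as [W] after time [n]. *)
Lemma fresh_cut_pair n a0 v l : (W n).1 <= a0 -> pi v -> a0 < v.1 ->
  v.2 = height l -> (forall z, pi z -> ~ (a0 < z.1 < v.1)) ->
  ~ unvisited W n v ->
  (forall z, pi z -> a0 < z.1 -> z <> v -> unvisited W n z) ->
  (forall m, (n < m)%N -> a0 < (W m).1) -> v.1 < (W n.+1).1 ->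
  (W n.+1).2 = height l -> short_continuation.
Proof.
move=> Wn piv a0v vl nogap vis fresh stay vq ql; have r0 := r_gt0.
have [||c [h [c0 c1 h0 hr]]] := @rational_start (Num.max a0 (v.1 - r)) v.1 (r / 4).
- by rewrite gt_max a0v; lra.
- by lra.
have h0' : 0 < ratr h :> R by rewrite ltr0q.
move: c0; rewrite gt_max => /andP[c0 cr].
have far z : pi z -> a0 < z.1 -> v.1 <= z.1.
  by move=> piz az; rewrite leNgt; apply/negP => zc; apply: (nogap z piz); rewrite az.
have st m := walk_step walkW m.
pose T i := match i with 0%N => (ratr c - ratr h, height l) | 1%N => v
  | j.+2 => W (n + j.+1)%N end.
have visv m : (n <= m)%N -> ~ unvisited W m v.
  by move=> nm uv; apply: vis; exact: unvisited_le uv.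
have gT : greedy_walk euclidean_dist (strip [set x | ratr c <= x] pi)
    (ratr c - ratr h, height l) T.
  apply/greedy_walk_path => N; split=> // i _; apply/greedy_stepP.
  case: i => [|i] /=.
    split.
    - by split=> //=; lra.
    - by case=> // _ /= e; move: c1 c0; rewrite -e /=; lra.
    move=> u [piu /= cu] uu; have [k hk] := piE piu.
    have vu : v.1 <= u.1 by apply: far => //; lra.
    have vs := @sqr_le_right _ (ratr c - ratr h) v.1 u.1.
    have [kl|kl] := eqVneq k l.
      by rewrite !sqdist_same ?hk ?kl ?vl//=; apply: vs; lra.
    rewrite (sqdist_other (r := r) (t := u) (l := l) (m := k)) 1?eq_sym//.
    rewrite sqdist_same ?vl//=.
    by rewrite (le_trans (vs _ vu)) ?lerDl ?sqr_ge0//; lra.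
  rewrite addnS; have [Zt ut near] := st (n + i)%N.
  have Wt : v.1 <= (W (n + i).+1).1 by apply: far => //; apply: stay; rewrite ltnS leq_addr.
  have unv u : pi u -> ratr c <= u.1 -> unvisited T i.+1 u -> unvisited W (n + i) u.
    move=> piu cu uu j jn; have uv : v <> u by exact: (uu 1%N).
    have [jn'|nj] := leqP j n.
      by apply: (fresh u piu _ _ j jn') => [|e]; [lra|apply: uv].
    have jE : j = (n + (j - n.+1).+1)%N by clear -nj; lia.
    by rewrite jE; apply: (uu (j - n.+1).+2); natlia.
  split.
  - by split=> //=; lra.
  - move=> [|[|j]] ji /= e; first by move: Wt; rewrite -e /=; lra.
      by apply: (visv (n + i)%N (leq_addr _ _)); rewrite e.
    by apply: (ut (n + j.+1)%N) e; rewrite leq_add2l.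
  - case: i {Wt} unv Zt ut near => [|i] unv Zt ut near u [piu cu] uu; last first.
      by apply: near => //; apply: unv.
    have [k hk] := piE piu; have [k' hk'] := walk_height piE origin_height walkW n.
    rewrite addn0 in unv near ut Zt *.
    apply: (nearest_shift (r := r) (s := W n) (l := l) (ls := k') (lw := k)) => //=.
    + lra.
    + lra.
    + by move: cu => /= cu; apply: far => //; lra.
    + by apply: near => //; apply: unv.
have [||L hL nl] := @walk_not_long pi (ratr c) (ratr h) l T X 2%N gpi _ h0' gT vl piX.
- by exists (c - h), l; rewrite rmorphB.
- by case=> [|[|k]]// _ /=; rewrite !addnS; exact: nearX.
- by exists c, h, L, l; split=> //; lra.
Qed.

Hypothesis W_right : exists N, forall n, (N <= n)%N -> r < (W n).1.

(** The cut is made after the last visit to the left of [r], at the record position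
    reached by then: everything before it has been cleared. *)
Lemma transient_short_continuation : short_continuation.
Proof.
have r0 := r_gt0; have W0 : W 0%N = (0, 0) by case: walkW.
have [N HN] := W_right.
have ex0 : exists n, (W n).1 <= r by exists 0%N; rewrite W0 ltW.
have ub n : (W n).1 <= r -> (n <= N)%N.
  by move=> Wn; rewrite leqNgt; apply/negP => /ltnW /HN; rewrite ltNge Wn.
have [n Wn nmax] := ex_maxnP ex0 ub.
have right m : (n < m)%N -> r < (W m).1.
  by move=> nm; rewrite ltNge; apply/negP => /nmax; rewrite leqNgt nm.
have st m := walk_step walkW m.
have [[j0 [j0n j0r]]|none] := pselect (exists j, (j <= n)%N /\ r < (W j).1); last first.
  apply: (fresh_cut Wn) => // z piz rz i ile e.
  by apply: none; exists i; rewrite ile e.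
have [v [piv vr [jv jvn Wjv] vmax]] : exists v, [/\ pi v, r < v.1,
    exists2 j, (j <= n)%N & W j = v & forall j, (j <= n)%N -> (W j).1 <= v.1].
  have [j /= _ jmax] := @arg_maxP _ _ _ (Ordinal (j0n : (j0 < n.+1)%N)) xpredT
    (fun j : 'I_n.+1 => (W j).1) isT.
  have jr : r < (W j).1 by apply: lt_le_trans j0r _; exact: (jmax (Ordinal (j0n : (j0 < n.+1)%N))).
  exists (W j); split=> //; last 2 first.
  - by exists j => //; rewrite -ltnS.
  - by move=> i ile; exact: (jmax (Ordinal (ile : (i < n.+1)%N))).
  case: (nat_of_ord j) jr => [|j']; first by rewrite W0 /=; lra.
  by have [] := st j'.
have [l vl] := piE piv.
have visv : ~ unvisited W n v by move=> /(_ jv jvn).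
have cleared z : pi z -> r < z.1 -> z.1 < v.1 -> ~ unvisited W n z.
  move=> piz rz zv uz.
  have := unvisited_behind_left r_gt0 piE origin_height
    ((greedy_walk_path _ _ _).1 walkW n) piz uz _ jvn.
  by rewrite Wjv /= add0r => /(_ rz zv); lra.
have late m : (n < m)%N -> unvisited W n (W m).
  by case: m => // m nm; have [_ + _] := st m; apply: unvisited_le.
have piW m : (n < m)%N -> pi (W m) by case: m => // m _; have [] := st m.
have record m : (n < m)%N -> v.1 <= (W m).1.
  move=> nm; rewrite leNgt; apply/negP => Wv.
  exact: cleared (piW m nm) (right m nm) Wv (late m nm).
pose v' := (v.1, height (~~ l)).
have at_v z : pi z -> z.1 = v.1 -> z = v \/ z = v'.
  move=> piz zv; have [k hk] := piE piz; have [kl|kl] := eqVneq k l.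
    by left; rewrite [LHS]surjective_pairing [RHS]surjective_pairing zv hk kl vl.
  right; rewrite [LHS]surjective_pairing zv /v' hk; congr (_, height _).
  by move: kl; case: (k); case: (l).
have beyond m : (n < m)%N -> W m <> v' -> v.1 < (W m).1.
  move=> nm Wv'; have := record m nm; rewrite le_eqVlt => /orP[/eqP e|//].
  have [Wv|//] := at_v _ (piW m nm) (esym e).
  by exfalso; apply: visv; rewrite -Wv; apply: late.
have fresh z : v.1 < z.1 -> unvisited W n z.
  by move=> vz i ile e; have := vmax i ile; rewrite e leNgt vz.
have [[m [nm Wm]]|never] := pselect (exists m, (n < m)%N /\ W m = v'); last first.
  apply: (@fresh_cut n v.1) => //; first by lra.
    by move=> z _; exact: fresh.
  by move=> m nm; apply: beyond => // e; apply: never; exists m.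
have uv' : unvisited W n v' by rewrite -Wm; apply: late.
have piv' : pi v' by rewrite -Wm; apply: piW.
have [Wn1|Wn1] := pselect (W n.+1 = v').
  apply: (@fresh_cut n.+1 v.1) => //; first by rewrite Wn1.
    move=> z _ vz i; rewrite leq_eqVlt => /orP[/eqP ->|]; last exact: fresh.
    by rewrite Wn1 => e; move: vz; rewrite -e ltxx.
  move=> k nk; apply: beyond; first exact: ltnW.
  move=> e; case: k nk e => // k nk; have [_ uk _] := st k => e.
  by apply: (uk n.+1) => //; rewrite Wn1.
have vq := beyond n.+1 (ltnSn n) Wn1.
have [a0 a0v nogap] := gap_left v.1 lfpi.
apply: (@fresh_cut_pair n (Num.max a0 r) v l) => //.
- by rewrite le_max Wn orbT.
- by rewrite gt_max a0v.
- by move=> z piz; rewrite gt_max => /andP[/andP[az _] zv]; apply: (nogap z piz); rewrite az.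
- move=> z piz; rewrite gt_max => /andP[az rz] zv.
  have : v.1 <= z.1 by rewrite leNgt; apply/negP => ?; apply: (nogap z piz); rewrite az.
  rewrite le_eqVlt => /orP[/eqP e|]; last exact: fresh.
  by have [//|->] := at_v z piz (esym e).
- by move=> k nk; have := record k nk; rewrite gt_max right// andbT; lra.
have [Zq uq near] := st n; have [k hk] := piE Zq; rewrite hk.
have [->//|kl] := eqVneq k l; exfalso.
have kl' : k = ~~ l by move: kl; case: (k); case: (l).
have := near v' piv' uv'; have [k' hk'] := walk_height piE origin_height walkW n.
have v'h : v'.2 = height (~~ l) by [].
have lt_ : ((W n).1 - v.1) ^+ 2 < ((W n).1 - (W n.+1).1) ^+ 2.
  rewrite -(sqrrN ((W n).1 - v.1)) -(sqrrN (_ - (W n.+1).1)) !opprB.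
  by rewrite ltr_pXn2r ?nnegrE//; lra.
have [kk|kk] := eqVneq k' k.
  by rewrite !sqdist_same ?hk' ?hk ?v'h ?kk ?kl'//; rewrite -?[v'.1]/(v.1); lra.
rewrite (sqdist_other (r := r) (s := W n) (t := W n.+1) (l := k') (m := k))//.
rewrite (sqdist_other (r := r) (s := W n) (t := v') (l := k') (m := k))//.
  by rewrite -[v'.1]/(v.1); lra.
by rewrite v'h kl'.
Qed.

End transient.
End escape.

(** * Laws on generated sigma-algebras *)

Section pi_lambda.
Context {d : measure_display} {Omega : measurableType d} {R : realType}.
Variable P : probability Omega R.
Local Open Scope ereal_scope.

Lemma dynkin_ext (T : Type) (G : set (set T)) (Q : set T -> Prop) :
  setI_closed G -> (forall B, G B -> Q B) -> Q setT ->
  (forall B, Q B -> Q (~` B)) ->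
  (forall F : nat -> set T, trivIset setT F -> (forall n, Q (F n)) ->
    Q (\bigcup_n F n)) ->
  forall B, <<s G >> B -> Q B.
Proof.
move=> GI GQ QT QC QU B; rewrite -setI_closed_g_dynkin_g_sigma_algebra//.
by move: B; apply: smallest_sub.
Qed.

Lemma sigma_algebra_ind (T : Type) (G : set (set T)) (Q : set T -> Prop) :
  (forall B, G B -> Q B) -> Q set0 -> (forall B, Q B -> Q (~` B)) ->
  (forall F : nat -> set T, (forall n, Q (F n)) -> Q (\bigcup_n F n)) ->
  forall B, <<s G >> B -> Q B.
Proof.
move=> GQ Q0 QC QU; apply: smallest_sub => //; split=> // A QA.
by rewrite setTD; exact: QC.
Qed.

Section random_elements.
Variables (T : Type) (G : set (set T)).

Lemma measurable_preimage (f : Omega -> T) :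
  (forall B, G B -> measurable (f @^-1` B)) ->
  forall B, <<s G >> B -> measurable (f @^-1` B).
Proof.
move=> H; apply: sigma_algebra_ind => //.
- by rewrite preimage_set0.
- by move=> B mB; rewrite preimage_setC; exact: measurableC.
- by move=> F mF; rewrite preimage_bigcup; exact: bigcup_measurable.
Qed.

Hypothesis GI : setI_closed G.

Lemma preimage_trivIset (f : Omega -> T) (F : nat -> set T) :
  trivIset setT F -> trivIset setT (fun n => f @^-1` F n).
Proof.
by move=> tF i j _ _ [w [/= Fi Fj]]; apply: tF => //; exists (f w).
Qed.

Lemma law_ext (f g : Omega -> T) :
  (forall B, G B -> measurable (f @^-1` B)) ->
  (forall B, G B -> measurable (g @^-1` B)) ->
  (forall B, G B -> P (f @^-1` B) = P (g @^-1` B)) ->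
  forall B, <<s G >> B -> P (f @^-1` B) = P (g @^-1` B).
Proof.
move=> mf mg fg B GB.
pose Q B := [/\ measurable (f @^-1` B), measurable (g @^-1` B) &
  P (f @^-1` B) = P (g @^-1` B)].
suff [] : Q B by [].
move: B GB; apply: (dynkin_ext GI (Q := Q)).
- by move=> B GB; split; [apply: mf|apply: mg|apply: fg].
- by split; rewrite ?preimage_setT.
- rewrite /Q => B [mfB mgB e]; rewrite 2!preimage_setC !probability_setC// e.
  by split=> //; exact: measurableC.
- rewrite /Q => F tF H; rewrite 2!preimage_bigcup; split.
  + by apply: bigcup_measurable => n _; case: (H n).
  + by apply: bigcup_measurable => n _; case: (H n).
  rewrite 2?measure_semi_bigcup//.
  + by apply: eq_eseriesr => n _; case: (H n).
  + by move=> n; case: (H n).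
  + exact: preimage_trivIset.
  + by apply: bigcup_measurable => n _; case: (H n).
  + by move=> n; case: (H n).
  + exact: preimage_trivIset.
  + by apply: bigcup_measurable => n _; case: (H n).
Qed.

Lemma indep_ext (f : Omega -> T) (E : set Omega) : measurable E ->
  (forall B, G B -> measurable (f @^-1` B)) ->
  (forall B, G B -> P (f @^-1` B `&` E) = P (f @^-1` B) * P E) ->
  forall B, <<s G >> B -> P (f @^-1` B `&` E) = P (f @^-1` B) * P E.
Proof.
move=> mE mf fE B GB.
pose Q B := measurable (f @^-1` B) /\ P (f @^-1` B `&` E) = P (f @^-1` B) * P E.
suff [] : Q B by [].
move: B GB; apply: (dynkin_ext GI (Q := Q)).
- by move=> B GB; split; [apply: mf|apply: fE].
- by split; rewrite preimage_setT ?setTI ?probability_setT ?mul1e.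
- rewrite /Q => B [mfB e]; rewrite preimage_setC; split; first exact: measurableC.
  rewrite probability_setC// muleBl//; last by rewrite fin_num_measure.
  rewrite mul1e -e setIC -setDE measureD//; first by rewrite (setIC E).
  by rewrite (le_lt_trans (probability_le1 _ _))// ltry.
- rewrite /Q => F tF H; rewrite preimage_bigcup; split.
    by apply: bigcup_measurable => n _; case: (H n).
  have mF n : measurable (f @^-1` F n) by case: (H n).
  rewrite setI_bigcupl !measure_semi_bigcup//.
  + rewrite muleC -(fineK (_ : P E \is a fin_num)) ?fin_num_measure//.
    rewrite -nneseriesZl//; apply: eq_eseriesr => n _.
    by rewrite fineK ?fin_num_measure// muleC; case: (H n).
  + exact: preimage_trivIset.
  + by apply: bigcup_measurable.
  + by move=> n; apply: measurableI.
  + apply: trivIset_setIr; exact: preimage_trivIset.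
  + by apply: bigcup_measurable => n _; apply: measurableI.
Qed.

End random_elements.
End pi_lambda.

Section real_intervals.
Context {R : realType}.

Lemma set_co (a b : R) : [set x | a <= x < b] = `[a, b[%classic.
Proof. by apply/seteqP; split=> x; rewrite /= in_itv. Qed.

Lemma measurable_co (a b : R) : measurable [set x | a <= x < b].
Proof. by rewrite set_co; exact: measurable_itv. Qed.

Lemma co_bounded (a b : R) : exists M, forall x, a <= x < b -> `|x| <= M.
Proof.
exists (`|a| + `|b|) => x /andP[ax xb]; rewrite ler_norml.
have := ler_norm b; have := ler_norm (- a); rewrite normrN.
by have := normr_ge0 a; have := normr_ge0 b => *; apply/andP; split; lra.
Qed.

Lemma measurable_lt_set (t : R) : measurable [set x : R | x < t].
Proof.
rewrite (_ : [set x | _] = `]-oo, t[%classic); first exact: measurable_itv.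
by apply/seteqP; split=> x; rewrite /= in_itv.
Qed.

Lemma measurable_ge_set (t : R) : measurable [set x : R | t <= x].
Proof.
rewrite (_ : [set x | _] = `[t, +oo[%classic); first exact: measurable_itv.
by apply/seteqP; split=> x; rewrite /= in_itv /= andbT.
Qed.


Lemma lebesgue_measure_translation (s : R) (A : set R) : measurable A ->
  lebesgue_measure [set x | A (x + s)] = lebesgue_measure A.
Proof.
move=> mA.
have ms : measurable_fun setT (fun x : measurableTypeR R => (x + s : measurableTypeR R)).
  exact: measurable_funD.
pose f : {mfun measurableTypeR R >-> measurableTypeR R} :=
  HB.pack (fun x : measurableTypeR R => (x + s : measurableTypeR R))
    (isMeasurableFun.Build _ _ _ _ _ ms).
rewrite -[LHS]/(pushforward lebesgue_measure f A).
apply/esym/lebesgue_measure_unique => //= _ [[a b]] _ <-.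
rewrite /pushforward /=.
rewrite (_ : _ @^-1` _ = `]a - s, b - s]%classic).
  rewrite !lebesgue_measure_itv/= !lte_fin ltrD2r.
  by case: ifPn => // _; rewrite -!EFinB; congr (_%:E); ring.
by apply/seteqP; split=> x /=; rewrite !in_itv/= ltrBlDr lerBrDr.
Qed.

End real_intervals.

(** * Random configurations on two lines *)

Section configurations.
Context {R : realType} (r : R).
Implicit Types (pi : set (R * R)) (D : set R) (A : bool -> set R).
Implicit Types (Q : set (R * R) -> Prop).
Local Notation height := (height r).

Definition avoiding A : set (set (R * R)) :=
  [set pi | forall l x, A l x -> ~ pi (x, height l)].

Definition admissible D A := forall l,
  [/\ measurable (A l), A l `<=` D & exists M, forall x, A l x -> `|x| <= M].

Definition avoidances D : set (set (set (R * R))) :=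
  [set B | exists2 A, admissible D A & B = avoiding A].

Lemma avoidingU A A' : avoiding A `&` avoiding A' = avoiding (fun l => A l `|` A' l).
Proof.
apply/seteqP; split=> pi.
  by move=> [vA vA'] l x [/vA|/vA'].
by move=> v; split=> l x Ax; apply: v; [left|right].
Qed.

Lemma admissibleU D D' A A' : admissible D A -> admissible D' A' ->
  admissible (D `|` D') (fun l => A l `|` A' l).
Proof.
move=> adA adA' l; have [mA AD [M AM]] := adA l; have [mA' AD' [M' AM']] := adA' l.
split; first exact: measurableU.
  by apply: setUSS.
exists (Num.max M M') => x; rewrite le_max.
by case=> [/AM ->//|/AM' ->]; rewrite orbT.
Qed.

Lemma admissibleW D D' A : D `<=` D' -> admissible D A -> admissible D' A.
Proof. by move=> DD adA l; have [? AD ?] := adA l; split=> // x /AD /DD. Qed.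

Lemma avoidances_setI D : setI_closed (avoidances D).
Proof.
move=> _ _ [A adA ->] [A' adA' ->]; exists (fun l => A l `|` A' l).
  by rewrite -[D]setUid; exact: admissibleU.
exact: avoidingU.
Qed.

(** The unordered configurations that matter: for these, an event is measurable
    if it agrees with a countable combination of avoiding events. *)
Definition tame pi := two_lines r pi /\ locally_finite pi.

Definition event D Q := exists2 B, <<s avoidances D >> B &
  forall pi, tame pi -> (Q pi <-> B pi).

Lemma event_ext D Q Q' : (forall pi, tame pi -> (Q pi <-> Q' pi)) ->
  event D Q -> event D Q'.
Proof. by move=> QQ [B sB H]; exists B => // pi tpi; rewrite -QQ// H. Qed.

Lemma eventW D D' Q : D `<=` D' -> event D Q -> event D' Q.
Proof.
move=> DD [B sB H]; exists B => //; move: sB; apply: sub_smallest2r.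
  exact: smallest_sigma_algebra.
by move=> _ [A adA ->]; exists A => //; exact: admissibleW adA.
Qed.

Lemma event_avoiding D A : admissible D A -> event D (avoiding A).
Proof.
move=> adA; exists (avoiding A) => //; apply: sub_sigma_algebra; by exists A.
Qed.

Lemma event_not D Q : event D Q -> event D (fun pi => ~ Q pi).
Proof.
move=> [B sB H]; exists (~` B); last by move=> pi /H ->.
have [_ C _] := smallest_sigma_algebra setT (avoidances D).
by rewrite -setTD; exact: C.
Qed.

Lemma event_exists D (I : countType) (Q : I -> set (R * R) -> Prop) :
  (forall i, event D (Q i)) -> event D (fun pi => exists i, Q i pi).
Proof.
move=> eQ; pose F n := if (choice.unpickle n : option I) is Some i then
  sval (cid2 (eQ i)) else set0.
exists (\bigcup_n F n).
  have [S0 _ SU] := smallest_sigma_algebra setT (avoidances D); apply: SU => n.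
  by rewrite /F; case: choice.unpickle => // i; case: cid2.
move=> pi tpi; split=> [[i Qi]|[n _]].
  exists (choice.pickle i) => //; rewrite /F choice.pickleK; case: cid2 => /= B _ H.
  exact/H.
rewrite /F; case: choice.unpickle => // i; case: cid2 => /= B _ H /H Qi.
by exists i; apply: Qi.
Qed.

Lemma event_forall D (I : countType) (Q : I -> set (R * R) -> Prop) :
  (forall i, event D (Q i)) -> event D (fun pi => forall i, Q i pi).
Proof.
move=> eQ; apply: (event_ext (Q := fun pi => ~ exists i, ~ Q i pi)).
  move=> pi _; split=> [H i|H [i]]; last by apply.
  by apply: contrapT => nQ; apply: H; exists i.
by apply/event_not/event_exists => i; exact: event_not.
Qed.

Lemma event_and D Q Q' : event D Q -> event D Q' ->
  event D (fun pi => Q pi /\ Q' pi).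
Proof.
move=> eQ eQ'; apply: (event_ext (Q := fun pi => forall b : bool, if b then Q pi else Q' pi)).
  by move=> pi _; split=> [H|[? ?] []//]; split; [exact: (H true)|exact: (H false)].
by apply: event_forall; case.
Qed.

Lemma event_or D Q Q' : event D Q -> event D Q' ->
  event D (fun pi => Q pi \/ Q' pi).
Proof.
move=> eQ eQ'; apply: (event_ext (Q := fun pi => exists b : bool, if b then Q pi else Q' pi)).
  move=> pi _; split=> [[[] ?]|[?|?]]; [by left|by right|by exists true|by exists false].
by apply: event_exists; case.
Qed.

Lemma event_cst D (S : Prop) : event D (fun=> S).
Proof.
have [S0 C _] := smallest_sigma_algebra setT (avoidances D).
have [s|ns] := pselect S.
  by exists (setT `\` set0) => [|pi _]; [exact: C|rewrite setD0].
by exists set0 => // pi _; split.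
Qed.

Lemma event_imply D Q Q' : event D Q -> event D Q' ->
  event D (fun pi => Q pi -> Q' pi).
Proof.
move=> eQ eQ'; apply: (event_ext (Q := fun pi => ~ Q pi \/ Q' pi)).
  move=> pi _; split=> [[nq /nq//|q' _]|H]; first exact: q'.
  by have [/H|] := pselect (Q pi); [right|left].
by apply: event_or => //; exact: event_not.
Qed.

Lemma event_iff D Q (b : Prop) : event D Q -> event D (fun pi => Q pi <-> b).
Proof.
move=> eQ; have eb := event_cst D b.
by apply: event_and; exact: event_imply.
Qed.

Lemma height_surj (z : R * R) pi : two_lines r pi -> pi z ->
  exists l, z = (z.1, height l).
Proof. by move=> H /H[l zl]; exists l; rewrite -zl -surjective_pairing. Qed.

(** ** The law of the configuration *)

Definition intensity (p : R) A : R :=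
  (1 - p / 2) * fine (lebesgue_measure
    ((A false `\` A true) `|` (A true `\` A false))) +
  fine (lebesgue_measure (A false `&` A true)).

(** The law of the process is determined by its avoidance probabilities: a point that
    belongs to both lines has to avoid both sets, any other point one of them. *)
Definition thinned_pair d (Omega : measurableType d) (P : probability Omega R)
    (p : R) (w : Omega -> set (R * R)) :=
  (forall x, tame (w x)) /\
  forall A, admissible setT A -> measurable (w @^-1` avoiding A) /\
    P (w @^-1` avoiding A) = (expR (- intensity p A))%:E.

Lemma bounded_lebesgue_fin (A : set R) M : measurable A -> (forall x, A x -> `|x| <= M) ->
  lebesgue_measure A \is a fin_num.
Proof.
move=> mA AM; rewrite ge0_fin_numE//.
apply: (@le_lt_trans _ _ (lebesgue_measure (`[- M, M]%classic : set R))).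
  apply: le_measure; rewrite ?inE//.
  by move=> x /AM; rewrite /= in_itv /= ler_norml.
by rewrite lebesgue_measure_itv/=; case: ifP => _; rewrite ?ltry// -EFinB ltry.
Qed.

Lemma fine_lebesgueU (A B : set R) M : measurable A -> measurable B ->
  (forall x, A x -> `|x| <= M) -> (forall x, B x -> `|x| <= M) ->
  A `&` B = set0 -> fine (lebesgue_measure (A `|` B)) =
  fine (lebesgue_measure A) + fine (lebesgue_measure B).
Proof.
move=> mA mB AM BM AB; rewrite measureU// fineD//;
  exact: (@bounded_lebesgue_fin _ M).
Qed.

Lemma admissible_bound D A : admissible D A ->
  exists M, forall l x, A l x -> `|x| <= M.
Proof.
move=> adA; have [_ _ [M HM]] := adA true; have [_ _ [N HN]] := adA false.
exists (Num.max M N) => -[] x => [/HM|/HN]; rewrite le_max => ->//.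
by rewrite orbT.
Qed.

Lemma intensityU p D D' A A' : D `&` D' = set0 -> admissible D A ->
  admissible D' A' ->
  intensity p (fun l => A l `|` A' l) = intensity p A + intensity p A'.
Proof.
move=> DD adA adA'.
have [M HM] := admissible_bound (admissibleU adA adA').
have mA l : measurable (A l) by case: (adA l).
have mA' l : measurable (A' l) by case: (adA' l).
have dis l l' x : A l x -> ~ A' l' x.
  move=> Ax A'x; suff : (D `&` D') x by rewrite DD.
  by split; [case: (adA l) => _ + _|case: (adA' l') => _ + _]; apply.
rewrite /intensity.
rewrite (_ : (_ `\` _) `|` (_ `\` _) = ((A false `\` A true) `|` (A true `\` A false)) `|`
   ((A' false `\` A' true) `|` (A' true `\` A' false))); last first.
  apply/seteqP; split=> x /=; first by tauto.
  move=> [[[a b]|[a b]]|[[a b]|[a b]]]; [left|right|left|right];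
    split; [by left|case=> //; exact: dis a|by left|case=> //; exact: dis a|
     by right| |by right|]; case=> // c; exact: (dis _ _ _ c a).
rewrite (_ : (A false `|` A' false) `&` _ = (A false `&` A true) `|` (A' false `&` A' true)); last first.
  apply/seteqP; split=> x /=; last by tauto.
  move=> [[a|a] [b|b]]; [by left| | |by right]; exfalso; first exact: dis a b.
  exact: dis b a.
rewrite (@fine_lebesgueU _ _ M).
- rewrite (@fine_lebesgueU (A false `&` A true) _ M); first by rewrite mulrDr; ring.
  + exact: measurableI.
  + exact: measurableI.
  + by move=> x [a _]; apply: (HM false); left.
  + by move=> x [a _]; apply: (HM false); right.
  + by apply/seteqP; split=> x //= [[a _] [b _]]; apply: dis a b.
- by apply: measurableU; exact: measurableD.
- by apply: measurableU; exact: measurableD.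
- by move=> x [[a _]|[a _]]; [apply: (HM false)|apply: (HM true)]; left.
- by move=> x [[a _]|[a _]]; [apply: (HM false)|apply: (HM true)]; right.
- by apply/seteqP; split=> x //= [[[a _]|[a _]] [[b _]|[b _]]]; apply: dis a b.
Qed.

Lemma intensity_translation p s A : admissible setT A ->
  intensity p (fun l => [set x | A l (x + s)]) = intensity p A.
Proof.
move=> adA; have mA l : measurable (A l) by case: (adA l).
have mD : measurable ((A false `\` A true) `|` (A true `\` A false)).
  by apply: measurableU; exact: measurableD.
have mI : measurable (A false `&` A true) by exact: measurableI.
rewrite /intensity -(lebesgue_measure_translation s mD).
by rewrite -(lebesgue_measure_translation s mI).
Qed.

Definition translate s pi : set (R * R) := [set z | pi (z.1 - s, z.2)].

Lemma translate_tame s pi : tame pi -> tame (translate s pi).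
Proof.
move=> [piE lfpi]; split; first by move=> z /piE.
move=> a b; apply: (sub_finite_set _ (finite_image (fun z => (z.1 + s, z.2))
  (lfpi (a - s) (b - s)))).
move=> z [piz /= zab]; exists (z.1 - s, z.2); last by rewrite /= subrK -surjective_pairing.
by split=> //=; rewrite !lerD2r.
Qed.

Lemma admissible_translation s A : admissible setT A ->
  admissible setT (fun l => [set x | A l (x + s)]).
Proof.
move=> adA l; have [mA _ [M HM]] := adA l; split=> //.
  have ms : measurable_fun setT (fun x : R => x + s) by exact: measurable_funD.
  by have := ms measurableT _ mA; rewrite setTI.
exists (M + `|s|) => x /HM H.
have -> : x = x + s - s by rewrite addrK.
by rewrite (le_trans (ler_normB _ _))// lerD2r.
Qed.

Lemma translate_avoiding s A :
  translate s @^-1` avoiding A = avoiding (fun l => [set x | A l (x + s)]).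
Proof.
apply/seteqP; split=> pi /= H l x Ax.
  by have := H l _ Ax; rewrite /translate /= addrK.
by rewrite /translate /=; apply: H; rewrite /= subrK.
Qed.

Section law.
Context {d : measure_display} {Omega : measurableType d}.
Variables (P : probability Omega R) (p : R) (w : Omega -> set (R * R)).
Hypothesis wP : thinned_pair P p w.
Local Open Scope ereal_scope.

Lemma thinned_tame x : tame (w x). Proof. exact: wP.1. Qed.

Lemma measurable_avoiding D B : avoidances D B -> measurable (w @^-1` B).
Proof.
by move=> [A adA ->]; have [] := wP.2 A (admissibleW (@subsetT _ D) adA).
Qed.

Lemma event_measurable D Q : event D Q -> measurable [set x | Q (w x)].
Proof.
move=> [B sB H]; rewrite (_ : [set x | _] = w @^-1` B).
  by apply: measurable_preimage sB => B'; exact: measurable_avoiding.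
by apply/seteqP; split=> x /=; have /H -> := thinned_tame x.
Qed.

Lemma event_translation s D Q : event D Q ->
  P [set x | Q (translate s (w x))] = P [set x | Q (w x)].
Proof.
move=> [B sB H].
rewrite (_ : [set x | Q (w x)] = w @^-1` B); last first.
  by apply/seteqP; split=> x /=; have /H -> := thinned_tame x.
rewrite (_ : [set x | _] = (translate s \o w) @^-1` B); last first.
  by apply/seteqP; split=> x /=; have /H -> := translate_tame s (thinned_tame x).
apply: (law_ext (@avoidances_setI D)) sB => B'; last 2 first.
- exact: measurable_avoiding.
- move=> [A adA ->]; have adA' := admissibleW (@subsetT _ D) adA.
  rewrite comp_preimage translate_avoiding.
  rewrite (wP.2 _ (admissible_translation s adA')).2 (wP.2 _ adA').2.
  by rewrite intensity_translation.
- move=> [A adA ->]; have adA' := admissibleW (@subsetT _ D) adA.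
  rewrite comp_preimage translate_avoiding.
  exact: (wP.2 _ (admissible_translation s adA')).1.
Qed.

Lemma event_translation_measurable s D Q : event D Q ->
  measurable [set x | Q (translate s (w x))].
Proof.
move=> [B sB H].
rewrite (_ : [set x | _] = (translate s \o w) @^-1` B); last first.
  by apply/seteqP; split=> x /=; have /H -> := translate_tame s (thinned_tame x).
apply: measurable_preimage sB => B' [A adA ->].
have adA' := admissibleW (@subsetT _ D) adA.
rewrite comp_preimage translate_avoiding.
exact: (wP.2 _ (admissible_translation s adA')).1.
Qed.

Lemma event_independent D D' Q Q' : D `&` D' = set0 -> event D Q -> event D' Q' ->
  P [set x | Q (w x) /\ Q' (w x)] = P [set x | Q (w x)] * P [set x | Q' (w x)].
Proof.
move=> DD eQ eQ'; have mQ := event_measurable eQ; have mQ' := event_measurable eQ'.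
case: eQ => B sB H; case: eQ' => B' sB' H'.
have QE : [set x | Q (w x)] = w @^-1` B.
  by apply/seteqP; split=> x /=; have /H -> := thinned_tame x.
have QE' : [set x | Q' (w x)] = w @^-1` B'.
  by apply/seteqP; split=> x /=; have /H' -> := thinned_tame x.
rewrite -[LHS]/(P ([set x | Q (w x)] `&` [set x | Q' (w x)])).
rewrite QE QE' in mQ mQ' *.
apply: (indep_ext (@avoidances_setI D)) sB => // [C|C [A adA ->]]; first exact: measurable_avoiding.
rewrite setIC muleC; have mA : measurable (w @^-1` avoiding A).
  by apply: (@measurable_avoiding D); exists A.
apply: (indep_ext (@avoidances_setI D')) sB' => // [C'|C' [A' adA' ->]]; first exact: measurable_avoiding.
rewrite -preimage_setI avoidingU.
have adT D0 A0 := @admissibleW D0 setT A0 (@subsetT _ D0).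
rewrite (wP.2 _ (adT _ _ (admissibleU adA' adA))).2.
rewrite (wP.2 _ (adT _ _ adA)).2 (wP.2 _ (adT _ _ adA')).2.
rewrite -EFinM -expRD (intensityU p _ adA' adA); last by rewrite setIC.
by rewrite opprD.
Qed.

End law.
End configurations.

(** * Measurability of events about greedy paths *)

Section path_events.
Context {R : realType} (r : R).
Hypothesis r_gt0 : 0 < r.
Variables (D : set R) (x0 : R) (l0 : bool).
Hypothesis mD : measurable D.
Implicit Types (pi : set (R * R)) (J : set R).
Local Notation height := (height r).

Definition occupied l J pi := exists2 x, J x & pi (x, height l).

Lemma event_occupied l J : measurable J -> J `<=` D ->
  (exists M, forall x, J x -> `|x| <= M) -> event r D (occupied l J).
Proof.
move=> mJ JD [M JM]; pose A k := if k == l then J else set0.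
apply: (event_ext (Q := fun pi => ~ avoiding r A pi)).
  move=> pi _; split=> [H|[x Jx pix] H].
    apply: contrapT => H'; apply: H => k x; rewrite /A; case: eqP => // -> Jx pix.
    by apply: H'; exists x.
  by apply: (H l x) pix; rewrite /A eqxx.
apply/event_not/event_avoiding => k; rewrite /A; case: eqP => _; split=> //.
- by exists M.
- by exists 0.
Qed.

(** A point is coded by its line and a rational interval that contains no other
    point of that line; the code [None] stands for the starting point. *)
Definition code := option (bool * (rat * rat)).

Definition code_line (i : code) := if i is Some (l, _) then l else l0.

Definition window (i : bool * (rat * rat)) : set R :=
  [set x | ratr i.2.1 <= x < ratr i.2.2] `&` D.

Definition sole (i : code) pi := if i is Some j then
  exists! x, window j x /\ pi (x, height j.1) else True.

Definition spot (i : code) pi : R := if i is Some j then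
  xget 0 [set x | window j x /\ pi (x, height j.1)] else x0.

Definition point i pi := (spot i pi, height (code_line i)).

Definition located (i : code) J pi := if i is Some j then
  occupied j.1 (window j `&` J) pi else J x0.

Lemma soleP i pi x : sole (Some i) pi -> window i x -> pi (x, height i.1) ->
  x = spot (Some i) pi.
Proof.
move=> [y [[wy piy] yuniq]] wx pix; rewrite /spot.
case: xgetP => [z _ [wz piz]|/(_ y)]; last by case; split.
by rewrite -(yuniq x (conj wx pix)) -(yuniq z (conj wz piz)).
Qed.

Lemma spotP i pi : sole (Some i) pi ->
  window i (spot (Some i) pi) /\ pi (spot (Some i) pi, height i.1).
Proof.
move=> [y [[wy piy] yuniq]]; rewrite /spot.
by case: xgetP => [z _ [wz piz]|/(_ y)]; last by case; split.
Qed.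

Lemma locatedP i J pi : sole i pi -> (located i J pi <-> J (spot i pi)).
Proof.
case: i => [i|//] si; split=> [[x [wx Jx] pix]|Js].
  by rewrite -(soleP si wx pix).
by have [ws pis] := spotP si; exists (spot (Some i) pi).
Qed.

Lemma window_measurable i : measurable (window i).
Proof.
apply: measurableI => //.
exact: measurable_co.
Qed.

Lemma window_bounded i : exists M, forall x, window i x -> `|x| <= M :> R.
Proof.
by have [M HM] := @co_bounded R (ratr i.2.1) (ratr i.2.2); exists M => x [/HM].
Qed.

Lemma event_located i J : measurable J -> event r D (located i J).
Proof.
case: i => [i|] mJ /=; last exact: event_cst.
apply: event_occupied; first by apply: measurableI => //; exact: window_measurable.
  by move=> x [[]].
by have [M HM] := window_bounded i; exists M => x [/HM].
Qed.

Lemma event_sole i : event r D (sole i).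
Proof.
case: i => [i|]; last exact: event_cst.
apply: (event_ext (Q := fun pi => located (Some i) setT pi /\
  forall t : rat, ~ (located (Some i) [set x | x < ratr t] pi /\
    located (Some i) [set x | ratr t <= x] pi))).
  move=> pi _; split=> [[[x [wx _] pix] H]|si].
    exists x; split=> // y [wy piy]; apply: contrapT => xy.
    have [lt|lt|//] := ltgtP x y.
      have /rat_in_itvoo[t] := lt; rewrite in_itv /= => /andP[h1 h2].
      by apply: (H t); split; [exists x|exists y] => //; split=> //=; exact: ltW.
    have /rat_in_itvoo[t] := lt; rewrite in_itv /= => /andP[h1 h2].
    by apply: (H t); split; [exists y|exists x] => //; split=> //=; exact: ltW.
  split; first exact/(locatedP _ si).
  move=> t [/(locatedP _ si) /= h1 /(locatedP _ si) /= h2].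
  by move: h1; rewrite ltNge h2.
apply: event_and; first exact: event_located.
apply: event_forall => t; apply/event_not/event_and; apply: event_located.
  exact: measurable_lt_set.
exact: measurable_ge_set.
Qed.

Definition lipschitz3 (f : R -> R -> R -> R) := forall x y z x' y' z',
  `|f x' y' z' - f x y z| <= `|x' - x| + `|y' - y| + `|z' - z|.

Lemma near_rat (x e : R) : 0 < e -> exists a b : rat,
  [/\ ratr a <= x, x < ratr b & forall y : R, ratr a <= y < ratr b -> `|y - x| <= e].
Proof.
move=> e0; have /rat_in_itvoo[a] : x - e < x by rewrite ltrBlDr ltrDl.
rewrite in_itv /= => /andP[a1 a2].
have /rat_in_itvoo[b] : x < x + e by rewrite ltrDl.
rewrite in_itv /= => /andP[b1 b2]; exists a, b; split=> //; first exact: ltW.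
by move=> y /andP[h1 h2]; rewrite ler_norml; apply/andP; split; lra.
Qed.

Lemma square_close (a a' e : R) : 0 <= e -> `|a' - a| <= e ->
  a' ^+ 2 <= a ^+ 2 + 2 * e * `|a| + e ^+ 2 /\ a ^+ 2 - 2 * e * `|a| <= a' ^+ 2.
Proof.
move=> e0; rewrite ler_norml => /andP[h1 h2].
have := normr_ge0 a; have := ler_norm a; have := ler_norm (- a); rewrite normrN.
have [a0|a0] := leP 0 a; [rewrite (ger0_norm a0)|rewrite (ltr0_norm a0)] => _ _ _.
  have p1 : 0 <= (e - (a' - a)) * a by apply: mulr_ge0; lra.
  have p2 : 0 <= (e + (a' - a)) * a by apply: mulr_ge0; lra.
  have p3 : 0 <= (e - (a' - a)) * (e + (a' - a)) by apply: mulr_ge0; lra.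
  have p4 : 0 <= (a' - a) ^+ 2 by exact: sqr_ge0.
  by split; move: p1 p2 p3 p4; rewrite !expr2; lra.
have p1 : 0 <= (e - (a' - a)) * (- a) by apply: mulr_ge0; lra.
have p2 : 0 <= (e + (a' - a)) * (- a) by apply: mulr_ge0; lra.
have p3 : 0 <= (e - (a' - a)) * (e + (a' - a)) by apply: mulr_ge0; lra.
have p4 : 0 <= (a' - a) ^+ 2 by exact: sqr_ge0.
by split; move: p1 p2 p3 p4; rewrite !expr2; lra.
Qed.

(** A strict inequality that holds at the coded points holds throughout a product
    of rational intervals around them. *)
Lemma event_square_lt i j k (f g : R -> R -> R -> R) (a b : R) :
  lipschitz3 f -> lipschitz3 g ->
  event r D (fun pi => [/\ sole i pi, sole j pi & sole k pi] /\
    f (spot i pi) (spot j pi) (spot k pi) ^+ 2 + a <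
    g (spot i pi) (spot j pi) (spot k pi) ^+ 2 + b).
Proof.
move=> lf lg.
pose box (q : (rat * rat) * (rat * rat) * (rat * rat)) (x y z : R) :=
  [/\ ratr q.1.1.1 <= x < ratr q.1.1.2, ratr q.1.2.1 <= y < ratr q.1.2.2 &
      ratr q.2.1 <= z < ratr q.2.2].
pose within (q : rat * rat) : set R := [set x | ratr q.1 <= x < ratr q.2].
have mw q : measurable (within q) by exact: measurable_co.
apply: (event_ext (Q := fun pi => (sole i pi /\ (sole j pi /\ sole k pi)) /\
  exists q, (forall x y z, box q x y z -> f x y z ^+ 2 + a < g x y z ^+ 2 + b) /\
   (located i (within q.1.1) pi /\ (located j (within q.1.2) pi /\
    located k (within q.2) pi)))).
  move=> pi _; split.
    move=> [[si [sj sk]] [q [H [/(locatedP _ si) qi [/(locatedP _ sj) qj /(locatedP _ sk) qk]]]]].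
    by split=> //; apply: H.
  move=> [[si sj sk]]; set x := spot i pi; set y := spot j pi; set z := spot k pi => lt_.
  split=> //; set u := f x y z in lt_; set v := g x y z in lt_.
  pose C := 6 * `|u| + 6 * `|v| + 9.
  have C0 : 0 < C by have := normr_ge0 u; have := normr_ge0 v; rewrite /C; lra.
  have d0 : 0 < v ^+ 2 + b - (u ^+ 2 + a) by lra.
  pose e := Num.min 1 ((v ^+ 2 + b - (u ^+ 2 + a)) / (2 * C)).
  have e0 : 0 < e by rewrite lt_min ltr01 divr_gt0//; lra.
  have e1 : e <= 1 by rewrite ge_min lexx.
  have eC : e * C < v ^+ 2 + b - (u ^+ 2 + a).
    have : e <= (v ^+ 2 + b - (u ^+ 2 + a)) / (2 * C) by rewrite ge_min lexx orbT.
    rewrite ler_pdivlMr; last lra.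
    lra.
  have [a1 [b1 [ax xb Hx]]] := near_rat x e0.
  have [a2 [b2 [ay yb Hy]]] := near_rat y e0.
  have [a3 [b3 [az zb Hz]]] := near_rat z e0.
  exists ((a1, b1), (a2, b2), (a3, b3)); split; last first.
    split; first by apply/locatedP => //; rewrite /within /= -/x ax xb.
    split; first by apply/locatedP => //; rewrite /within /= -/y ay yb.
    by apply/locatedP => //; rewrite /within /= -/z az zb.
  move=> x' y' z' [/= /Hx hx /Hy hy /Hz hz].
  have e3 : 0 <= 3 * e by lra.
  have hf : `|f x' y' z' - u| <= 3 * e by have := lf x y z x' y' z'; rewrite -/u; lra.
  have hg : `|g x' y' z' - v| <= 3 * e by have := lg x y z x' y' z'; rewrite -/v; lra.
  have [F1 _] := square_close e3 hf; have [_ G1] := square_close e3 hg.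
  have ee : (3 * e) ^+ 2 <= 9 * e.
    rewrite expr2; have : e * e <= e * 1 by rewrite ler_pM2l. by lra.
  by move: eC; rewrite /C; lra.
apply: event_and; first by do 2?apply: event_and; exact: event_sole.
apply: event_exists => q; apply: event_and; first exact: event_cst.
by do 2?apply: event_and; exact: event_located.
Qed.

Lemma lipschitz3_cst c : lipschitz3 (fun _ _ _ => c).
Proof. by move=> x y z x' y' z'; rewrite subrr normr0 !addr_ge0. Qed.

Lemma lipschitz3_12 : lipschitz3 (fun x y _ => x - y).
Proof.
move=> x y z x' y' z'; have := ler_normB (x' - x) (y' - y).
have := normr_ge0 (z' - z); rewrite (_ : x' - y' - (x - y) = x' - x - (y' - y)); last ring.
by lra.
Qed.

Lemma lipschitz3_13 : lipschitz3 (fun x _ z => x - z).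
Proof.
move=> x y z x' y' z'; have := ler_normB (x' - x) (z' - z).
have := normr_ge0 (y' - y); rewrite (_ : x' - z' - (x - z) = x' - x - (z' - z)); last ring.
by lra.
Qed.

Lemma lipschitz3_1 c : lipschitz3 (fun x _ _ => x + c).
Proof.
move=> x y z x' y' z'; have := normr_ge0 (y' - y); have := normr_ge0 (z' - z).
by rewrite (_ : x' + c - (x + c) = x' - x); [lra|ring].
Qed.

Lemma event_nearer i j k : event r D (fun pi => [/\ sole i pi, sole j pi & sole k pi] /\
  sqdist (point i pi) (point k pi) < sqdist (point i pi) (point j pi)).
Proof.
exact: (@event_square_lt i j k _ _ ((height (code_line i) - height (code_line k)) ^+ 2)
  ((height (code_line i) - height (code_line j)) ^+ 2) lipschitz3_13 lipschitz3_12).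
Qed.

Lemma event_distinct i j : event r D (fun pi => [/\ sole i pi, sole j pi & sole j pi] /\
  0 < sqdist (point i pi) (point j pi)).
Proof.
have := @event_square_lt i j j (fun _ _ _ => 0) _ 0
  ((height (code_line i) - height (code_line j)) ^+ 2) (lipschitz3_cst 0) lipschitz3_12.
by rewrite expr0n addr0.
Qed.

Lemma event_step_long i j c : event r D (fun pi => [/\ sole i pi, sole j pi & sole j pi] /\
  ((point i pi).1 + c) ^+ 2 < sqdist (point i pi) (point j pi)).
Proof.
have := @event_square_lt i j j _ _ 0
  ((height (code_line i) - height (code_line j)) ^+ 2) (lipschitz3_1 c) lipschitz3_12.
by apply: event_ext => pi _; rewrite addr0.
Qed.

Lemma sqdist_gt0 (u v : R * R) : 0 < sqdist u v <-> u <> v.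
Proof.
split=> [lt_ e|ne].
  by move: lt_; rewrite e /sqdist !subrr expr0n addr0 ltxx.
rewrite lt_def sqdist_ge0 andbT; apply/eqP => /eqP.
rewrite paddr_eq0 ?sqr_ge0// !sqrf_eq0 !subr_eq0 => /andP[/eqP e1 /eqP e2]; apply: ne.
by rewrite [LHS]surjective_pairing [RHS]surjective_pairing e1 e2.
Qed.

Lemma code_exists pi u : tame r pi -> strip D pi u ->
  exists j, sole (Some j) pi /\ point (Some j) pi = u.
Proof.
move=> [piE lfpi] [piu Du]; have [l ul] := piE u piu.
have [a1 ua1 right] := gap_right u.1 lfpi; have [a0 a0u left_] := gap_left u.1 lfpi.
have /rat_in_itvoo[a] := a0u; rewrite in_itv /= => /andP[a0a au].
have /rat_in_itvoo[b] := ua1; rewrite in_itv /= => /andP[ub ba1].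
pose j := (l, (a, b)); have wu : window j u.1 by split=> //=; rewrite (ltW au).
have piu' : pi (u.1, height l) by rewrite -ul -surjective_pairing.
have uniq x : window j x -> pi (x, height l) -> u.1 = x.
  move=> [/= /andP[ax xb] _] pix; apply: contrapT => /eqP.
  rewrite neq_lt => /orP[ux|xu].
    by apply: (right _ pix); rewrite /= ux; lra.
  by apply: (left_ _ pix); rewrite /= xu; lra.
have sj : sole (Some j) pi by exists u.1; split=> // x [wx pix]; exact: uniq.
exists j; split=> //; rewrite /point -(soleP sj wu piu') /= -ul.
by rewrite -surjective_pairing.
Qed.

Definition nth_code (s : seq (bool * (rat * rat))) k : code :=
  if k is k'.+1 then Some (nth (false, (0, 0)) s k') else None.

(** The points of the path have one of countably many sequences of codes, and for
    given codes a step is greedy if no coded point that is still unvisited is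
    nearer. *)
Lemma event_path (T : set R) n (F : (nat -> R * R) -> Prop) :
  measurable T ->
  (forall s, event r D (fun pi => (forall k, (k <= n)%N -> sole (nth_code s k.+1) pi) /\
     F (fun k => point (nth_code s k) pi))) ->
  (forall p q, (forall k, (k <= n.+1)%N -> p k = q k) -> F p -> F q) ->
  event r D (fun pi => exists p,
    [/\ greedy_path (strip D pi) (x0, height l0) n.+1 p,
        forall i, (i <= n)%N -> T (p i).1 & F p]).
Proof.
move=> mT eF extF.
pose Q s pi :=
  ((forall k, (k <= n)%N -> sole (nth_code s k.+1) pi) /\
     F (fun k => point (nth_code s k) pi)) /\
  ((forall k k', (k <= n)%N -> (k' <= k)%N ->
      [/\ sole (nth_code s k') pi, sole (nth_code s k.+1) pi & sole (nth_code s k.+1) pi] /\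
      0 < sqdist (point (nth_code s k') pi) (point (nth_code s k.+1) pi)) /\
  ((forall k j, (k <= n)%N -> sole (Some j) pi ->
    (exists k', (k' <= k)%N /\ ~ ([/\ sole (nth_code s k') pi, sole (Some j) pi & sole (Some j) pi] /\
      0 < sqdist (point (nth_code s k') pi) (point (Some j) pi))) \/
    ~ ([/\ sole (nth_code s k) pi, sole (nth_code s k.+1) pi & sole (Some j) pi] /\
      sqdist (point (nth_code s k) pi) (point (Some j) pi) <
      sqdist (point (nth_code s k) pi) (point (nth_code s k.+1) pi))) /\
  (forall k, (k <= n)%N -> located (nth_code s k) T pi))).
have soles s pi : (forall k, (k <= n)%N -> sole (nth_code s k.+1) pi) ->
    forall k, (k <= n.+1)%N -> sole (nth_code s k) pi.
  by move=> H [|k] // kn; exact: H.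
apply: (event_ext (Q := fun pi => exists s, Q s pi)); last first.
  apply: event_exists => s; apply: event_and => //; apply: event_and.
    do 2?[apply: event_forall => ?]; do 2?[apply: event_imply; first exact: event_cst].
    exact: event_distinct.
  apply: event_and.
    do 2?[apply: event_forall => ?]; apply: event_imply; first exact: event_cst.
    apply: event_imply; first exact: event_sole.
    apply: event_or; last exact/event_not/event_nearer.
    apply: event_exists => k'; apply: event_and; first exact: event_cst.
    exact/event_not/event_distinct.
  apply: event_forall => k; apply: event_imply; first exact: event_cst.
  exact: event_located.
move=> pi tpi; split.
  move=> [s [[so Fs] [dist [near loc]]]].
  exists (fun k => point (nth_code s k) pi).
  have so' := soles s pi so; split=> //; last first.
    by move=> i iltn; apply/(locatedP T (so' i (leqW iltn))); exact: loc.
  split=> // i; rewrite ltnS => iltn; apply/greedy_stepP; split.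
  - have [[_ Dj] pij] := spotP (so i iltn).
    by split.
  - move=> j ji; apply/sqdist_gt0; exact: (dist i j iltn ji).2.
  move=> u Zu uu; have [j [sj ju]] := code_exists tpi Zu.
  case: (near i j iltn sj) => [[k' [k'i H]]|H].
    exfalso; apply: H; split; first by split=> //; apply: so'; exact: leq_trans k'i (leqW iltn).
    by rewrite ju; apply/sqdist_gt0; exact: uu.
  rewrite leNgt; apply/negP => lt_; apply: H; split; last by rewrite ju.
  by split=> //; apply: so' => //; exact: leqW.
move=> [p [[p0 gp] Tp Fp]].
have /choice[cd cdP] : forall k, exists j, (k <= n)%N ->
    sole (Some j) pi /\ point (Some j) pi = p k.+1.
  move=> k; have [kn|nk] := leqP k n; last by exists (false, (0, 0)).
  have /greedy_stepP[Zk _ _] := gp k kn.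
  by have [j jP] := code_exists tpi Zk; exists j.
pose s := mkseq cd n.+1.
have sE k : (k <= n)%N -> nth_code s k.+1 = Some (cd k) by move=> kn; rewrite /= nth_mkseq.
have so k : (k <= n)%N -> sole (nth_code s k.+1) pi.
  by move=> kn; rewrite sE//; case: (cdP k kn).
have so' := soles s pi so.
have pE k : (k <= n.+1)%N -> point (nth_code s k) pi = p k.
  case: k => [|k] kn; first by rewrite p0.
  by rewrite sE//; case: (cdP k kn).
exists s; split; first by split=> //; apply: (extF p) => // k kn; rewrite pE.
split.
  move=> k k' kn k'k; have k'n : (k' <= n.+1)%N := leq_trans k'k (leqW kn).
  split; first by split; [exact: so'|exact: so|exact: so].
  have /greedy_stepP[_ uk _] := gp k kn.
  by rewrite !pE//; apply/sqdist_gt0; exact: uk.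
split; last by move=> k kn; apply/(locatedP T (so' k (leqW kn))); have := Tp k kn; rewrite -pE ?leqW.
move=> k j kn sj; have /greedy_stepP[_ _ near] := gp k kn.
have [wj pij] := spotP sj.
have [uj|nuj] := pselect (unvisited p k (point (Some j) pi)).
  right=> -[_]; rewrite !pE//; last exact: leqW.
  by rewrite ltNge near//; split=> //; case: wj.
left; have [k' k'k pk'] := visited_ex nuj.
exists k'; split=> // -[_]; rewrite pE ?pk'; last exact: leq_trans k'k (leqW kn).
by move/sqdist_gt0.
Qed.

End path_events.

Section long_event.
Context {R : realType} (r h L : R) (l : bool) (K m : nat).
Hypothesis h_gt0 : 0 < h.
Implicit Types (pi : set (R * R)) (b c : R) (D T : set R).

Lemma event_long c D T : measurable D -> measurable T ->
  event r D (long r h L l c D T).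
Proof.
move=> mD mT; apply: event_exists => n.
pose F (p : nat -> R * R) := (n = 0%N /\ (p 1%N).2 <> height r l) \/
  ((p n).1 - c + L) ^+ 2 < sqdist (p n) (p n.+1).
apply: (@event_path R r D (c - h) l mD T n F mT); last first.
  by move=> p q pq; rewrite /F !pq.
move=> s; pose code k := nth_code s k; pose pt k pi := point r D (c - h) l (code k) pi.
apply: (event_ext (Q := fun pi =>
   (forall k, (k <= n)%N -> sole r D (code k.+1) pi) /\
   ((n = 0%N /\ height r (code_line l (code 1%N)) <> height r l) \/
    ([/\ sole r D (code n) pi, sole r D (code n.+1) pi & sole r D (code n.+1) pi] /\
     ((pt n pi).1 + (L - c)) ^+ 2 < sqdist (pt n pi) (pt n.+1 pi))))).
  have E (x : R) : x - c + L = x + (L - c) by ring.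
  move=> pi _; rewrite /F E; split=> [[so H]|[so H]]; split=> //.
    by case: H => [H|[_ H]]; [left|right].
  case: H => [H|H]; [by left|right]; split=> //; split; try exact: so.
  by case: (n) so => // k so; apply: so.
apply: event_and.
  apply: event_forall => k; apply: event_imply; first exact: event_cst.
  exact: event_sole.
by apply: event_or; [exact: event_cst|exact: event_step_long].
Qed.

End long_event.

Section block_events.
Context {R : realType} (r h L : R) (l : bool) (K m : nat).
Hypothesis h_gt0 : 0 < h.
Implicit Types (pi : set (R * R)) (b c y : R) (D T J : set R).

Lemma event_void D (b c : R) : (forall x, b <= x < c -> D x) ->
  event r D (fun pi => forall z, pi z -> ~ (b <= z.1 < c)).
Proof.
move=> bcD; apply: (event_ext (Q := avoiding r (fun=> [set x | b <= x < c]))); last first.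
  by apply: event_avoiding => k; split=> //; [exact: measurable_co|exact: co_bounded].
move=> pi [piE _]; split=> [H z piz bz|H k x bx pix]; last exact: H pix bx.
by have [k zk] := height_surj piE piz; apply: (H k z.1 bz); rewrite -zk.
Qed.

Lemma event_block b D : (forall x, b <= x < block_end h K b -> D x) ->
  event r D (block r h l K m b).
Proof.
move=> bD; apply: event_forall => i; apply: event_forall => k.
have [iK|Ki] := ltnP i K; last first.
  by apply: (event_ext (Q := fun=> True)) => [pi _|]; [split|exact: event_cst].
apply: (event_ext (Q := fun pi => occupied r k (cell h b i) pi <-> pattern l m i k)).
  by move=> pi _; split=> // H; exact: H.
apply: event_iff; apply: event_occupied; [exact: measurable_co| |exact: co_bounded].
move=> x /andP[h1 h2]; apply: bD; rewrite /block_end; apply/andP; split.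
  by apply: le_trans h1; rewrite lerDl mulr_ge0// ltW.
by apply: (lt_le_trans h2); rewrite lerD2l ler_pM2r// ler_nat.
Qed.

Lemma event_escaping b : event r [set x | b <= x] (escaping r h L l K m b).
Proof.
have mge t := measurable_ge_set t; apply: event_and.
  by apply: event_block => x /andP[].
apply/event_not; apply: (eventW (D := [set x | block_end h K b <= x])); last first.
  exact: event_long.
by move=> x /=; apply: le_trans; rewrite /block_end lerDl mulr_ge0// ltW.
Qed.

Lemma event_escaping_until y b : b <= y ->
  event r [set x | x < block_end h K y] (escaping_until r h L l K m y b).
Proof.
move=> by_; have Kh : 0 <= K%:R * h by rewrite mulr_ge0// ltW.
pose Q pi := block r h l K m b pi /\ block r h l K m y pi /\
  ~ long r h L l (block_end h K b) [set x | block_end h K b <= x < block_end h K y]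
      [set x | x < y] pi.
apply: (event_ext (Q := Q)); first by move=> pi _; split=> [[? []]|[]].
apply: event_and.
  by apply: event_block => x /andP[_ /lt_le_trans] /=; apply; rewrite lerD2r.
apply: event_and; first by apply: event_block => x /andP[].
apply/event_not/(eventW (D := [set x | block_end h K b <= x < block_end h K y])).
  by move=> x /= /andP[].
by apply: event_long; [exact: measurable_co|exact: measurable_lt_set].
Qed.

Lemma event_anchored g y :
  event r [set x | x < block_end h K y] (anchored r h L l K m g y).
Proof.
apply: event_and; first by apply: event_block => x /andP[].
have ih i : y - i%:R * h <= y by rewrite gerBl mulr_ge0// ltW.
apply: event_forall => i; apply: event_imply.
  by apply: event_or; [exact: event_cst|exact: event_escaping_until].
apply: (event_ext (Q := fun pi => exists j : nat, (i < j <= i + i + g)%N /\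
  escaping_until r h L l K m y (y - j%:R * h) pi)).
  by move=> pi _; split=> [[j []]|[j]]; exists j.
apply: event_exists => j; apply: event_and; first exact: event_cst.
exact: event_escaping_until.
Qed.

Lemma greedy_path_translate Z (t : R) u n p :
  greedy_path (translate t Z) u n p ->
  greedy_path Z (u.1 - t, u.2) n (fun i => ((p i).1 - t, (p i).2)).
Proof.
move=> [p0 gp]; split; first by rewrite p0.
move=> i /gp/greedy_stepP[Zp up near]; apply/greedy_stepP; split => //.
  move=> j /up H e; apply: H; case: e.
  by rewrite [p j]surjective_pairing [p i.+1]surjective_pairing => /addIr /= -> ->.
move=> v Zv uv; have := near (v.1 + t, v.2); rewrite /translate/= addrK -surjective_pairing.
move=> /(_ Zv); rewrite /sqdist /=.
rewrite (_ : (p i).1 - t - v.1 = (p i).1 - (v.1 + t)); last by ring.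
rewrite (_ : (p i).1 - t - ((p i.+1).1 - t) = (p i).1 - (p i.+1).1); last by ring.
apply=> j /uv H e; apply: H; rewrite e /= addrK; exact/esym/surjective_pairing.
Qed.

Lemma long_translate_imp t c D T pi : long r h L l c D T (translate t pi) ->
  long r h L l (c - t) [set x | D (x + t)] [set x | T (x + t)] pi.
Proof.
move=> [n [p [gp Tp H]]]; exists n, (fun i => ((p i).1 - t, (p i).2)); split.
- rewrite (_ : c - t - h = (c - h) - t); last by ring.
  apply: (@greedy_path_translate _ t (c - h, height r l)).
  rewrite (_ : translate _ _ = strip D (translate t pi))//.
  by apply/seteqP; split=> z; rewrite /strip /translate /= subrK.
- by move=> i /Tp; rewrite /= subrK.
case: H => [[n0 H]|H]; [by left|right].
rewrite /sqdist /= in H *.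
rewrite (_ : (p n).1 - t - ((p n.+1).1 - t) = (p n).1 - (p n.+1).1); last by ring.
by rewrite (_ : (p n).1 - t - (c - t) + L = (p n).1 - c + L)//; ring.
Qed.

Lemma translateK t pi : translate (- t) (translate t pi) = pi.
Proof.
by apply/seteqP; split=> z; rewrite /translate /= opprK addrK -surjective_pairing.
Qed.

Lemma long_translate t c D T pi : long r h L l c D T (translate t pi) <->
  long r h L l (c - t) [set x | D (x + t)] [set x | T (x + t)] pi.
Proof.
split; first exact: long_translate_imp.
rewrite -{1}(translateK t pi) => /long_translate_imp; rewrite opprK subrK.
by under eq_set do rewrite /= subrK; under [X in long _ _ _ _ _ _ X]eq_set do rewrite /= subrK.
Qed.

Lemma block_translate t b pi :
  block r h l K m b (translate t pi) <-> block r h l K m (b - t) pi.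
Proof.
suff E i k : (exists2 x, cell h b i x & translate t pi (x, height r k)) <->
   (exists2 x, cell h (b - t) i x & pi (x, height r k)).
  by split=> B i k iK; rewrite -B// E.
rewrite /cell; split=> [[x /= /andP[h1 h2] px]|[x /= /andP[h1 h2] px]].
  by exists (x - t) => //=; apply/andP; split; lra.
exists (x + t); first by apply/andP; split; lra.
by rewrite /translate /= addrK.
Qed.

Lemma escaping_translate t b pi :
  escaping r h L l K m b (translate t pi) <-> escaping r h L l K m (b - t) pi.
Proof.
rewrite /escaping block_translate long_translate.
have -> : block_end h K (b - t) = block_end h K b - t by rewrite /block_end; ring.
rewrite (_ : [set x | _ (x + t)] = [set x | block_end h K b - t <= x])//.
by apply/seteqP; split=> x /=; rewrite lerBlDr.
Qed.

End block_events.

(** * Escaping blocks have probability zero *)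

Section almost_sure.
Context {d : measure_display} {Omega : measurableType d} {R : realType}.
Variable P : probability Omega R.
Local Open Scope ereal_scope.

Lemma probability_le_null (A B N : set Omega) : measurable A -> measurable B ->
  measurable N -> P N = 0 -> A `<=` B `|` N -> P A <= P B.
Proof.
move=> mA mB mN N0 sub; apply: (@le_trans _ _ (P (B `|` N))).
  by apply: le_measure; rewrite ?inE//; exact: measurableU.
rewrite (le_trans (measureU2 P mB mN))// -[leRHS]adde0 leeD2l// le_eqVlt.
by apply/orP; left; apply/eqP; exact: N0.
Qed.

Lemma probability_le_ae (A B : set Omega) : measurable A -> measurable B ->
  {ae P, forall x, A x -> B x} -> P A <= P B.
Proof.
move=> mA mB [N [mN N0 sub]]; apply: (probability_le_null mA mB mN N0) => x Ax.
have [Nx|nNx] := pselect (N x); first by right.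
by left; apply: contrapT => nBx; apply: nNx; apply: sub => /(_ Ax).
Qed.

Lemma probability_disjoint_le1 (F : nat -> set Omega) :
  (forall n, measurable (F n)) -> trivIset setT F -> \sum_(0 <= n <oo) P (F n) <= 1.
Proof.
move=> mF tF; rewrite -measure_semi_bigcup//; last by apply: bigcup_measurable.
by apply: probability_le1; apply: bigcup_measurable.
Qed.

(** Infinitely many disjoint events cannot have the same positive probability. *)
Lemma probability_disjoint_eq0 (F : nat -> set Omega) (q : \bar R) :
  (forall n, measurable (F n)) -> trivIset setT F -> (forall n, P (F n) = q) -> q = 0.
Proof.
move=> mF tF Fq; have le1 := probability_disjoint_le1 mF tF.
have q0 : 0 <= q by rewrite -(Fq 0%N).
have qfin : q \is a fin_num by rewrite -(Fq 0%N) fin_num_measure.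
apply/eqP; rewrite eq_le q0 andbT leNgt; apply/negP => qgt.
have fq : (0 < fine q)%R by rewrite fine_gt0// qgt ltey_eq qfin.
pose n := (Num.truncn (fine q)^-1).+1.
have := le_trans (nneseries_lim_ge n (fun k _ _ => measure_ge0 P (F k))) le1.
rewrite (eq_bigr (fun=> (fine q)%:E)); last by move=> i _; rewrite fineK//; exact: Fq.
rewrite sumEFin lee_fin sumr_const_nat subn0.
rewrite leNgt -mulr_natr -ltr_pdivrMl// mulr1 => /negP; apply.
exact: truncnS_gt.
Qed.

Lemma small_tail (f : nat -> \bar R) (e : R) : (forall n, 0 <= f n) ->
  \sum_(0 <= n <oo) f n <= 1 -> (0 < e)%R ->
  exists g, \sum_(0 <= n <oo) f (n + g)%N < e%:E.
Proof.
move=> f0 f1 e0.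
have /fine_cvgP[fin /cvgr_lt/(_ e e0) lt_] : \sum_(N <= k <oo) f k @[N --> \oo] --> 0%R%:E.
  by apply: nneseries_tail_cvg => //; rewrite (le_lt_trans f1)// ltry.
have [g _ H] : \forall N \near \oo, \sum_(N <= k <oo) f k < e%:E.
  near=> N; rewrite -(fineK (_ : \sum_(N <= k <oo) f k \is a fin_num)); last by near: N.
  by rewrite lte_fin; near: N.
exists g; rewrite nneseries_addn//; exact: H (leqnn g).
Unshelve. all: by end_near. Qed.

End almost_sure.

Section patterns.
Context {d : measure_display} {Omega : measurableType d} {R : realType}.
Variables (P : probability Omega R) (r p : R) (w : Omega -> set (R * R)).
Hypothesis p01 : 0 < p <= 1.
Hypothesis wP : thinned_pair r P p w.
Variables (h : R) (l : bool) (K m : nat).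
Hypothesis h_gt0 : 0 < h.
Local Open Scope ereal_scope.

Lemma avoiding_positive A : admissible setT A -> 0 < P (w @^-1` avoiding r A).
Proof. by move=> /wP.2[_ ->]; rewrite lte_fin expR_gt0. Qed.

Lemma lebesgue_measure_cell (b : R) i : lebesgue_measure (cell h b i) = h%:E.
Proof.
rewrite /cell set_co lebesgue_measure_itv/= lte_fin -natr1 mulrDl mul1r addrA ltrDl h_gt0.
by rewrite -EFinB; congr (_%:E); rewrite [X in (X - _)%R]addrC addrK.
Qed.

Lemma cell_admissible D (b : R) i (k : pred bool) : cell h b i `<=` D ->
  admissible D (fun l => if k l then cell h b i else set0).
Proof.
move=> cD l'; case: ifP => _; split=> //; first exact: measurable_co.
  exact: co_bounded.
by exists 0%R.
Qed.

(** A point of the thinned line can be absent from the other line: the two lines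
    are not avoided together as often as one of them. *)
Lemma one_line_positive (b : R) i k :
  0 < P [set x | occupied r k (cell h b i) (w x) /\
                 ~ occupied r (~~ k) (cell h b i) (w x)].
Proof.
pose A l' := if l' == ~~ k then cell h b i else set0.
pose B (l' : bool) := if true then cell h b i else set0.
have adA : admissible setT A by apply: (@cell_admissible _ b i (fun l' => l' == ~~ k)).
have adB : admissible setT B by apply: (@cell_admissible _ b i xpredT).
have [mA PA] := wP.2 _ adA; have [mB PB] := wP.2 _ adB.
have mE : measurable [set x | occupied r k (cell h b i) (w x) /\
                 ~ occupied r (~~ k) (cell h b i) (w x)].
  have ev k' : event r setT (occupied r k' (cell h b i)).
    apply: event_occupied => //; [exact: measurable_co|exact: co_bounded].
  by apply: (event_measurable wP (D := setT) (Q := fun pi => occupied r k (cell h b i) pi /\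
    ~ occupied r (~~ k) (cell h b i) pi)); apply: event_and => //; exact: event_not.
rewrite lt_def measure_ge0 andbT; apply/eqP => P0.
suff : P (w @^-1` avoiding r A) <= P (w @^-1` avoiding r B).
  rewrite PA PB lee_fin ler_expR lerN2 /intensity.
  have -> : (A false `&` A true = set0).
    by rewrite /A; case: (k) => /=; rewrite ?setI0 ?set0I.
  have -> : ((A false `\` A true) `|` (A true `\` A false) = cell h b i).
    by rewrite /A; case: (k) => /=; rewrite ?setD0 ?set0D ?setU0 ?set0U.
  rewrite /B setIid setDv setU0 measure0 lebesgue_measure_cell /= mulr0 add0r addr0.
  move: p01 => /andP[p0 _]; rewrite leNgt gtr_pMl// gtrBl//.
  by rewrite divr_gt0.
apply: (probability_le_null mA mB mE P0) => x Ax.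
have [[y cy wy]|nocc] := pselect (occupied r k (cell h b i) (w x)).
    right; split; first by exists y.
    by move=> [z cz wz]; apply: (Ax (~~ k) z) wz; rewrite /A eqxx.
  left=> l' y; rewrite /B => cy wy; have [lk|lk] := eqVneq l' (~~ k).
    by apply: (Ax l' y) wy; rewrite /A lk eqxx.
  apply: nocc; exists y => //.
  by move: wy; have -> // : l' = k; move: lk; case: (l'); case: (k).
Qed.

Definition cell_matches b i pi := forall k, occupied r k (cell h b i) pi <-> pattern l m i k.

Lemma cell_matches_positive b i : 0 < P [set x | cell_matches b i (w x)].
Proof.
have [k|E] := pselect (exists k, pattern l m i k /\ ~~ pattern l m i (~~ k)).
  case: k => k [pk npk]; rewrite (_ : [set x | _] = [set x | occupied r k (cell h b i) (w x) /\
                 ~ occupied r (~~ k) (cell h b i) (w x)]).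
    exact: one_line_positive.
  apply/seteqP; split=> x /=.
    by move=> H; split; [apply/H|move/H; rewrite (negbTE npk)].
  move=> [ok nok] k'; have [->|kk] := eqVneq k' k; first by split.
  have -> : k' = ~~ k by move: kk; case: (k'); case: (k).
  by split=> // pk'; move: npk; rewrite pk'.
have none k : pattern l m i k = false.
  apply/negP => pk; apply: E; exists k; split=> //.
  move: pk; rewrite /pattern; case: (k); case: (l) => /=; by [case: eqP; rewrite ?andbF|case/andP].
rewrite (_ : [set x | _] = w @^-1` avoiding r (fun=> cell h b i)).
  apply: avoiding_positive; exact: (@cell_admissible _ b i xpredT).
apply/seteqP; split=> x /=.
  by move=> H k y cy wy; have /H : occupied r k (cell h b i) (w x) by [exists y]; rewrite none.
by move=> H k; rewrite none; split=> // -[y cy wy]; exfalso; apply: H cy wy.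
Qed.

Lemma event_cell_matches D b i : cell h b i `<=` D -> event r D (cell_matches b i).
Proof.
move=> cD; apply: event_forall => k; apply: event_iff; apply: event_occupied => //.
  exact: measurable_co.
exact: co_bounded.
Qed.

(** The cells of a block are independent. *)
Lemma block_positive b : 0 < P [set x | block r h l K m b (w x)].
Proof.
pose B n pi := forall i, (i < n)%N -> cell_matches b i pi.
have BK : [set x | block r h l K m b (w x)] = [set x | B K (w x)].
  by apply/seteqP; split=> x H => [i iK k|i k iK]; apply: H.
rewrite BK; elim: K => [|n IH].
  by rewrite (_ : [set x | _] = setT) ?probability_setT//; apply/seteqP; split=> x.
have lehc (i j : nat) : (i <= j)%N -> (b + i%:R * h <= b + j%:R * h)%R.
  by move=> ij; rewrite lerD2l ler_pM2r// ler_nat.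
rewrite (_ : [set x | _] = [set x | B n (w x) /\ cell_matches b n (w x)]).
  rewrite (event_independent wP (D := [set x | x < b + n%:R * h]%R)
    (D' := [set x | b + n%:R * h <= x]%R) (Q := B n) (Q' := cell_matches b n)).
  - by rewrite mule_gt0// cell_matches_positive.
  - by apply/seteqP; split=> // x [/= h1 h2]; move: h1; rewrite ltNge h2.
  - apply: event_forall => i; have [iln|nlei] := ltnP i n; last first.
      by apply: (event_ext (Q := fun=> True)) => [pi _|]; [split|exact: event_cst].
    apply: (event_ext (Q := cell_matches b i)); first by move=> pi _; split=> // H; exact: H.
    by apply: event_cell_matches => x /andP[_ /lt_le_trans]; apply; exact: lehc.
  - by apply: event_cell_matches => x /andP[].
apply/seteqP; split=> x /=.
  by move=> H; split=> [i iln|]; apply: H => //; exact: leqW.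
by move=> [H Hn] i; rewrite ltnS leq_eqVlt => /orP[/eqP ->//|]; exact: H.
Qed.

End patterns.

Section no_escaping_block.
Context {d : measure_display} {Omega : measurableType d} {R : realType}.
Variables (P : probability Omega R) (r p : R) (w : Omega -> set (R * R)).
Hypothesis r_gt0 : 0 < r.
Hypothesis wP : thinned_pair r P p w.
Hypothesis ae_generic : {ae P, forall x, generic r (w x)}.
Variables (c hq : rat) (L : R) (l : bool) (K m : nat).
Let h : R := ratr hq.
Hypothesis h_gt0 : 0 < h.
Hypothesis h_small : 4 * h <= r.
Hypothesis m_large : 4 * h + r <= m%:R * h.
Hypothesis mK : (m.+1 < K)%N.
Hypothesis hL : h <= L.
Hypothesis L_small : L <= (K%:R - m%:R - 1) * h.
Local Open Scope ereal_scope.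
Local Notation escaping := (escaping r h L l K m).
Local Notation anchored := (anchored r h L l K m).

Definition first_escaping t (y : R) pi := escaping y pi /\
  forall i, (0 < i <= t)%N -> ~ escaping (y - i%:R * h)%R pi.

Lemma event_escapingT y : event r setT (escaping y).
Proof. by apply: (eventW (@subsetT _ _)); exact: event_escaping. Qed.

Lemma event_first_escaping t y : event r setT (first_escaping t y).
Proof.
apply: event_and; first exact: event_escapingT.
apply: event_forall => i; apply: event_imply; first exact: event_cst.
by apply: event_not; exact: event_escapingT.
Qed.

Lemma first_escaping_translate t s y pi :
  first_escaping t y (translate s pi) <-> first_escaping t (y - s)%R pi.
Proof.
rewrite /first_escaping escaping_translate.
have E i : escaping (y - i%:R * h)%R (translate s pi) <-> escaping (y - s - i%:R * h)%R pi.
  by rewrite escaping_translate (_ : y - i%:R * h - s = y - s - i%:R * h)%R//; ring.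
by split=> -[? H]; split=> // i /H nE /E.
Qed.

Lemma first_escaping_stationary t y y' :
  P [set x | first_escaping t y (w x)] = P [set x | first_escaping t y' (w x)].
Proof.
rewrite -(event_translation wP (y - y') (event_first_escaping t y)).
have yy : (y - (y - y') = y')%R by rewrite opprB addrC subrK.
congr (P _); apply/seteqP; split=> x /=.
  by move/first_escaping_translate; rewrite yy.
by move=> H; apply/first_escaping_translate; rewrite yy.
Qed.

(** By stationarity the summands are the probabilities that, of the blocks at [y],
    [y + h], ..., the one number [t] is the first that escapes; these are disjoint
    events. *)
Lemma first_escaping_summable y : \sum_(0 <= t <oo) P [set x | first_escaping t y (w x)] <= 1.
Proof.
pose F t := [set x | first_escaping t (y + t%:R * h)%R (w x)].
rewrite (eq_eseriesr (g := fun t => P (F t))); last by move=> t _; exact: first_escaping_stationary.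
apply: probability_disjoint_le1 => [t|]; first exact: (event_measurable wP (event_first_escaping _ _)).
suff lt_disj t t' x : (t < t')%N -> F t x -> F t' x -> False.
  move=> t t' _ _ [x [Ft Ft']]; have [lt_|lt_|//] := ltngtP t t'; exfalso.
    exact: lt_disj lt_ Ft Ft'.
  exact: lt_disj lt_ Ft' Ft.
move=> tt' [At _] [_ nA]; apply: (nA (t' - t)%N).
  by rewrite subn_gt0 tt' leq_subr.
by rewrite natrB 1?ltnW// (_ : _ - _ = y + t%:R * h)%R//; ring.
Qed.

Let b : R := (ratr c - K%:R * h)%R.

Lemma grid_block_end i : grid_point r (block_end h K (b - i%:R * h)%R - h, height r l)%R.
Proof.
exists (c - i%:R * hq - hq)%R, l; congr (_, _).
by rewrite 2!rmorphB rmorphM /= ratr_nat /block_end /b /h; ring.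
Qed.

(** For an escaping block at [b], the blocks to its left escape as soon as they escape
    until [b]; a failure of the distance bound is a long interval without escaping
    blocks to the left of one of them. *)
Lemma not_anchored g pi : generic r pi -> escaping b pi -> ~ anchored g b pi ->
  exists i, first_escaping (i + g) (b - i%:R * h)%R pi.
Proof.
move=> gpi eb nanch; apply: contrapT => H; apply: nanch; split; first by case: eb.
have eE i : i = 0%N \/ escaping_until r h L l K m b (b - i%:R * h)%R pi -> escaping (b - i%:R * h)%R pi.
  have [->|i0] := posnP i; first by rewrite mul0r subr0.
  case=> [i0'|eu]; first by rewrite i0' in i0.
  apply: (escaping_extend r_gt0 h_gt0 h_small m_large mK hL L_small gpi _ _ eu eb).
    exact: grid_block_end.
  by case: eu => Bi Bb _; exact: (blocks_apart r_gt0 h_gt0 m_large mK i0 Bi Bb).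
move=> i /eE ei; apply: contrapT => nj; apply: H; exists i; split=> //.
move=> k /andP[k0 kig]; rewrite -addrA -opprD -mulrDl -natrD => ek.
have [Bk _] := ek; have [Bb _] := eb.
apply: nj; exists (i + k)%N.
  by rewrite -{1}[i]addn0 ltn_add2l k0 -addnA leq_add2l.
apply: (escaping_restrict r_gt0 h_gt0 m_large mK gpi _ ek Bb).
by apply: (blocks_apart r_gt0 h_gt0 m_large mK _ Bk Bb); rewrite addn_gt0 k0 orbT.
Qed.

Lemma event_anchoredT g : event r setT (anchored g b).
Proof. by apply: (eventW (@subsetT _ _)); exact: event_anchored. Qed.

(** The probabilities of the failures add up to the tail of a convergent series. *)
Lemma anchored_positive : 0 < P [set x | escaping b (w x)] ->
  exists g, 0 < P [set x | anchored g b (w x)].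
Proof.
move=> e0; pose f t := P [set x | first_escaping t b (w x)].
have me Q : event r setT Q -> measurable [set x | Q (w x)] by exact: (event_measurable wP (Q := Q)).
have efin : P [set x | escaping b (w x)] \is a fin_num.
  by rewrite fin_num_measure//; apply: me; exact: event_escapingT.
have [||g tail] := @small_tail _ f (fine (P [set x | escaping b (w x)])) _ (first_escaping_summable b).
- by move=> t; exact: measure_ge0.
- by rewrite fine_gt0// e0 ltey_eq efin.
exists g; rewrite lt_def measure_ge0 andbT; apply/eqP => a0.
move: tail; rewrite fineK// ltNge => /negP; apply.
pose F i := [set x | first_escaping (i + g) (b - i%:R * h)%R (w x)].
have mF i : measurable (F i) by apply: me; exact: event_first_escaping.
rewrite (eq_eseriesr (g := fun i => P (F i))); last by move=> t _; exact: first_escaping_stationary.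
have mU : measurable (\bigcup_i F i) by exact: bigcup_measurable.
apply: (@le_trans _ _ (P (\bigcup_i F i))); last exact: measure_sigma_subadditive.
have mA : measurable [set x | anchored g b (w x)] by apply: me; exact: event_anchoredT.
have mE : measurable [set x | escaping b (w x)] by apply: me; exact: event_escapingT.
apply: (@le_trans _ _ (P (\bigcup_i F i `|` [set x | anchored g b (w x)]))).
  apply: probability_le_ae => //; first exact: measurableU.
  apply: filterS ae_generic => x gx ex.
  have [|na] := pselect (anchored g b (w x)); first by right.
  by left; have [i Fi] := not_anchored gx ex na; exists i.
by apply: (probability_le_null (N := [set x | anchored g b (w x)])) => //; exact: measurableU.
Qed.

(** An anchored block at [b], a gap behind it and an escaping block at the end [y] of
    the gap occur together with positive probability. Then the block at [y] escapes
    and none to the left of [b] does; this event and its translates by multiples of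
    a larger distance exclude each other. *)
Lemma escaping_null : P [set x | escaping b (w x)] = 0.
Proof.
apply/eqP; rewrite eq_le measure_ge0 andbT leNgt; apply/negP => e0.
have [g a0] := anchored_positive e0.
pose G := (Num.truncn (((g + K)%:R * h + r) / h)).+1.
have Gl : ((g + K)%:R * h + r <= G%:R * h)%R.
  by rewrite -ler_pdivrMr// ltW// truncnS_gt.
pose J := (G + K)%N; pose y : R := (b + J%:R * h)%R.
pose void pi := forall z : R * R, pi z ->
  ~ (block_end h K b <= z.1 < block_end h K b + G%:R * h)%R.
have yE : y = (block_end h K b + G%:R * h)%R by rewrite /y /J natrD /block_end; ring.
have Gh : (0 <= G%:R * h)%R by rewrite mulr_ge0// ltW.
(* the far block after the gap is independent of the gap and of the anchored block *)
pose Q pi := anchored g b pi /\ (void pi /\ escaping y pi).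
have ev : event r [set x | block_end h K b <= x < y]%R void.
  by apply: event_void => x; rewrite yE.
have ee : event r [set x | y <= x]%R (escaping y) by exact: event_escaping.
have eve : event r [set x | block_end h K b <= x]%R (fun pi => void pi /\ escaping y pi).
  apply: event_and; first by apply: eventW ev => x /andP[].
  by apply: eventW ee => x /=; apply: le_trans; rewrite yE lerDl.
have ea : event r [set x | x < block_end h K b]%R (anchored g b) by exact: event_anchored.
have Q0 : 0 < P [set x | Q (w x)].
  rewrite (event_independent wP _ ea eve); last first.
    by apply/seteqP; split=> // x [/= h1 h2]; move: h1; rewrite ltNge h2.
  rewrite mule_gt0// (event_independent wP _ ev ee); last first.
    by apply/seteqP; split=> // x [/= /andP[_ h1] h2]; move: h1; rewrite ltNge h2.
  rewrite mule_gt0//; last first.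
    have := first_escaping_stationary 0 y b; rewrite /first_escaping.
    have E0 u : [set x | escaping u (w x) /\ forall i, (0 < i <= 0)%N ->
        ~ escaping (u - i%:R * h)%R (w x)] = [set x | escaping u (w x)].
      apply/seteqP; split=> x; first by case.
      by move=> ex; split=> // -[].
    by rewrite !E0 => ->.
  rewrite (_ : [set x | void (w x)] =
      w @^-1` avoiding r (fun=> [set x | block_end h K b <= x < y]%R)).
    apply: (avoiding_positive wP) => k.
    by split=> //; [exact: measurable_co|exact: co_bounded].
  rewrite yE; apply/seteqP; split=> x /= H.
    by move=> k z bz wz; exact: H wz bz.
  move=> z wz bz; have [k zk] := height_surj (thinned_tame wP x).1 wz.
  by apply: (H k z.1 bz); rewrite -zk.
pose F0 pi := escaping y pi /\ forall i, (0 < i)%N -> ~ escaping (b - i%:R * h)%R pi.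
have eF0 : event r setT F0.
  apply: event_and; first exact: event_escapingT.
  apply: event_forall => i; apply: event_imply; first exact: event_cst.
  by apply: event_not; exact: event_escapingT.
pose F n := [set x | F0 (translate (- (n * J.+1)%:R * h)%R (w x))].
have PF n : P (F n) = P [set x | F0 (w x)] by exact: (event_translation wP _ eF0).
have mF n : measurable (F n) by exact: (event_translation_measurable wP _ eF0).
suff q0 : P [set x | F0 (w x)] = 0.
  move: Q0; rewrite ltNge => /negP; apply; rewrite -q0; apply: probability_le_ae.
  - apply: (event_measurable wP (D := setT) (Q := Q)); apply: event_and.
      exact: event_anchoredT.
    exact: eventW (@subsetT _ _) eve.
  - exact: (event_measurable wP eF0).
  apply: filterS ae_generic => x gx [ax [vx ex]]; split=> // i i0.
  exact: (no_escape r_gt0 h_gt0 h_small m_large mK hL L_small gx ax vx Gl i0).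
apply: (@probability_disjoint_eq0 _ _ _ _ F) => //.
suff lt_disj n n' x : (n < n')%N -> F n x -> F n' x -> False.
  move=> n n' _ _ [x [Fn Fn']]; have [lt_|lt_|//] := ltngtP n n'; exfalso.
    exact: lt_disj lt_ Fn Fn'.
  exact: lt_disj lt_ Fn' Fn.
move=> nn' [/escaping_translate ey _] [_ nA].
have Jn : (n * J.+1 + J < n' * J.+1)%N.
  by rewrite -addnS -mulSnr leq_mul2r nn' orbT.
apply: (nA (n' * J.+1 - (n * J.+1 + J))%N); first by rewrite subn_gt0.
apply/escaping_translate; rewrite natrB 1?ltnW// natrD.
by rewrite (_ : _ - _ = y - - (n * J.+1)%:R * h)%R//; rewrite /y; ring.
Qed.

End no_escaping_block.

Lemma ae_forall_count d (Omega : measurableType d) (R : realType)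
  (P : probability Omega R) (I : countType) (Q : I -> Omega -> Prop) :
  (forall i, {ae P, forall x, Q i x}) -> {ae P, forall x, forall i, Q i x}.
Proof.
move=> H; have : {ae P, forall x, forall n : nat,
    if (choice.unpickle n : option I) is Some i then Q i x else True}.
  apply: ae_foralln => n; case: choice.unpickle => [i|]; first exact: H.
  exact: aeW.
by apply: filterS => x Hx i; have := Hx (choice.pickle i); rewrite choice.pickleK.
Qed.

Section long_steps.
Context {d : measure_display} {Omega : measurableType d} {R : realType}.
Variables (P : probability Omega R) (r p : R) (w : Omega -> set (R * R)).
Hypothesis r_gt0 : 0 < r.
Hypothesis p01 : 0 < p <= 1.
Hypothesis wP : thinned_pair r P p w.
Hypothesis ae_generic : {ae P, forall x, generic r (w x)}.

(** The number [c] is the end of a block that is independent of what follows. *)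
Lemma ae_long (c h : rat) (L : nat) l : 0 < h -> 4 * ratr h <= r -> ratr h <= L%:R :> R ->
  {ae P, forall x, long r (ratr h) L%:R l (ratr c) [set x | ratr c <= x] setT (w x)}.
Proof.
move=> h0 hr hL; pose H : R := ratr h; have H0 : 0 < H by rewrite ltr0q.
pose m := (Num.truncn ((4 * H + r) / H)).+1.
have m_large : 4 * H + r <= m%:R * H by rewrite -ler_pdivrMr// ltW// truncnS_gt.
pose K := ((Num.truncn (L%:R / H)).+1 + m.+2)%N.
have mK : (m.+1 < K)%N by exact: leq_addl.
have L_small : L%:R <= (K%:R - m%:R - 1) * H.
  rewrite -ler_pdivrMr//; apply: (@le_trans _ _ (Num.truncn (L%:R / H)).+1%:R).
    by rewrite ltW// truncnS_gt.
  by rewrite /K natrD -(natr1 m.+1) -(natr1 m); lra.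
pose D : set R := [set x | ratr c <= x].
have mD : measurable D by exact: measurable_ge_set.
have el : event r D (fun pi => ~ long r H L%:R l (ratr c) D setT pi).
  by apply: event_not; exact: event_long.
have ml : measurable [set x | ~ long r H L%:R l (ratr c) D setT (w x)].
  exact: (event_measurable wP el).
exists [set x | ~ long r H L%:R l (ratr c) D setT (w x)]; split=> //.
pose b := ratr c - K%:R * H.
have bE : block_end H K b = ratr c by rewrite /block_end subrK.
have eb : event r [set x | x < ratr c] (block r H l K m b).
  by apply: event_block => // x /andP[_]; rewrite bE.
have := escaping_null r_gt0 wP ae_generic c l H0 hr m_large mK hL L_small.
rewrite /escaping -/H -/b bE (event_independent wP _ eb el); last first.
  by apply/seteqP; split=> // x [/= h1 h2]; move: h1; rewrite ltNge h2.
by move/eqP; rewrite mule_eq0 gt_eqF /= ?(block_positive p01 wP)// => /eqP.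
Qed.

Lemma ae_no_short_continuation : {ae P, forall x, ~ short_continuation r (w x)}.
Proof.
pose I : countType := (rat * rat * nat * bool)%type.
have : {ae P, forall x, forall i : I, 0 < i.1.1.2 -> 4 * ratr i.1.1.2 <= r ->
    ratr i.1.1.2 <= i.1.2%:R :> R ->
    long r (ratr i.1.1.2) i.1.2%:R i.2 (ratr i.1.1.1) [set x | ratr i.1.1.1 <= x] setT (w x)}.
  apply: ae_forall_count => -[[[c h] L] l] /=.
  have [H|H] := pselect ([/\ 0 < h, 4 * ratr h <= r & ratr h <= L%:R :> R]).
    by case: H => h1 h2 h3; apply: filterS (ae_long c l h1 h2 h3).
  by apply: aeW => x h1 h2 h3; exfalso; apply: H.
apply: filterS => x H [c [h [L [l [h1 h2 h3]]]]]; apply.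
exact: (H (c, h, L, l)).
Qed.

Lemma ae_no_right_escape : {ae P, forall x, forall W X,
  greedy_walk euclidean_dist (w x) (0, 0) W -> w x X -> (forall n, W n <> X) ->
  ~ exists N, forall n, (N <= n)%N -> r < (W n).1}.
Proof.
apply: filterS2 ae_generic ae_no_short_continuation => x gx nsc W X gW wX nX esc.
exact/nsc/(transient_short_continuation r_gt0 gx gW wX nX esc).
Qed.

End long_steps.

(** * The walk visits every point *)

Section reflection.
Context {R : realType} (r : R).
Implicit Types (pi : set (R * R)).

Definition reflect pi : set (R * R) := [set z | pi (- z.1, z.2)].

Lemma reflect_walk pi W : greedy_walk euclidean_dist pi (0, 0) W ->
  greedy_walk euclidean_dist (reflect pi) (0, 0) (fun n => (- (W n).1, (W n).2)).
Proof.
move=> gW; apply/greedy_walk_path => n; split=> [|i _].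
  by case: gW => -> _ /=; rewrite oppr0.
have [Wi Wu near] := walk_step gW i; apply/greedy_stepP; split.
- by rewrite /reflect /= opprK -surjective_pairing.
- move=> j ji [/oppr_inj e1 e2]; apply: (Wu j ji).
  by rewrite [LHS]surjective_pairing [RHS]surjective_pairing e1 e2.
move=> u pu uu; have := near _ pu; rewrite /sqdist /=.
rewrite -(sqrrN (_ - _ u.1)) -(sqrrN (- _ - - _)) !opprD !opprK; apply=> j ji e.
by apply: (uu j ji); rewrite e /= opprK -surjective_pairing.
Qed.

Lemma reflect_tame pi : tame r pi -> tame r (reflect pi).
Proof.
move=> [piE lfpi]; split; first by move=> z /piE.
move=> a b; apply: (sub_finite_set _ (finite_image (fun z => (- z.1, z.2)) (lfpi (- b) (- a)))).
move=> z [piz /= /andP[az zb]]; exists (- z.1, z.2); last by rewrite /= opprK -surjective_pairing.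
by split=> //=; rewrite !lerN2 zb.
Qed.

Lemma reflect_thinned d (Omega : measurableType d) (P : probability Omega R) p
  (w : Omega -> set (R * R)) : thinned_pair r P p w -> thinned_pair r P p (reflect \o w).
Proof.
move=> [tw wP]; split; first by move=> x; exact/reflect_tame.
move=> A adA; pose B l := [set x | A l (- x)].
have mN (S : set R) : measurable S -> measurable [set x | S (- x)].
  have mo : measurable_fun setT (fun x : R => - x) by exact: oppr_measurable.
  by move=> mS; have := mo measurableT _ mS; rewrite setTI.
have adB : admissible setT B.
  move=> l; have [mA _ [M HM]] := adA l; split=> //; first exact: mN.
  by exists M => x /HM; rewrite normrN.
rewrite (_ : _ @^-1` _ = w @^-1` avoiding r B).
  have [mB ->] := wP _ adB; split=> //; congr (expR (- _))%:E.
  have mA l : measurable (A l) by case: (adA l).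
  have mS (S : set R) : measurable S ->
      lebesgue_measure [set x | S (- x)] = lebesgue_measure S.
    by move=> mS; exact: (lebesgue_measureN mS).
  rewrite /intensity -(mS ((A false `\` A true) `|` (A true `\` A false))).
    by rewrite -(mS (A false `&` A true))//; exact: measurableI.
  by apply: measurableU; exact: measurableD.
apply/seteqP; split=> x /= H l y Ay.
  by have := H l _ Ay; rewrite /reflect /= opprK.
by rewrite /reflect /=; apply: H; rewrite /B /= opprK.
Qed.

(** A walk that misses a point [X] leaves every bounded region, and far away a step
    from one side to the other would be longer than the step to [X]. *)
Lemma walk_transient pi W X : 0 < r -> tame r pi ->
  greedy_walk euclidean_dist pi (0, 0) W -> pi X -> (forall n, W n <> X) ->
  (exists N, forall n, (N <= n)%N -> r < (W n).1) \/
  (exists N, forall n, (N <= n)%N -> r < - (W n).1).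
Proof.
move=> r0 [piE lfpi] gW piX nX; pose M := `|X.1| + r.
have [N HN] := greedy_walk_unbounded lfpi gW M.
have X0 := normr_ge0 X.1.
have [[n0 [Nn0 Wn0]]|right] := pselect (exists n, (N <= n)%N /\ (W n).1 < 0).
  right; exists n0; elim=> [|n IH].
    rewrite leqn0 => /eqP n00; have := HN _ Nn0; rewrite (ltr0_norm Wn0) n00 /M; lra.
  rewrite leq_eqVlt => /orP[/eqP <-|]; first by have := HN _ Nn0; rewrite (ltr0_norm Wn0) /M; lra.
  rewrite ltnS => nn; have Wn := IH nn.
  have WM := HN n (leq_trans Nn0 nn); have WM' := HN n.+1 (leq_trans Nn0 (leqW nn)).
  have Wn' : (W n).1 < 0 by lra.
  rewrite (ltr0_norm Wn') in WM.
  have [w0|w0] := leP 0 (W n.+1).1; last by rewrite (ltr0_norm w0) /M in WM'; lra.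
  rewrite (ger0_norm w0) in WM'; exfalso.
  have [k hk] := walk_height piE (origin_height r) gW n; have [_ _ near] := walk_step gW n.
  apply: (step_far r0 piE hk piX _ (near X piX _)).
    have := ler_normB (W n).1 X.1; rewrite (ltr0_norm Wn') /M in WM' *; lra.
  by move=> i _; exact: nX.
left; exists N => n Nn; have := HN n Nn.
have [w0|w0] := leP 0 (W n).1; first by rewrite (ger0_norm w0) /M; lra.
by exfalso; apply: right; exists n.
Qed.

End reflection.

Section visits.
Context {d : measure_display} {Omega : measurableType d} {R : realType}.
Variables (P : probability Omega R) (r p : R).
Hypothesis r_gt0 : 0 < r.
Hypothesis p01 : 0 < p <= 1.
Hypothesis ae_generic : forall w, thinned_pair r P p w -> {ae P, forall x, generic r (w x)}.

Lemma ae_visits_all w : thinned_pair r P p w -> {ae P, forall x, forall W,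
  greedy_walk euclidean_dist (w x) (0, 0) W -> w x `<=` range W}.
Proof.
move=> wP; have wP' := reflect_thinned wP.
have := ae_no_right_escape r_gt0 p01 wP' (ae_generic wP').
have := ae_no_right_escape r_gt0 p01 wP (ae_generic wP).
apply: filterS2 => x nr nl W gW X wX; apply: contrapT => nX.
have {}nX n : W n <> X by move=> e; apply: nX; exists n.
have [esc|esc] := walk_transient r_gt0 (wP.1 x) gW wX nX; first exact: (nr W X gW wX nX esc).
apply: (nl _ (- X.1, X.2) (reflect_walk gW) _ _ esc).
  by rewrite /= /reflect /= opprK -surjective_pairing.
move=> n [/oppr_inj e1 e2]; apply: (nX n).
by rewrite [LHS]surjective_pairing [RHS]surjective_pairing e1 e2.
Qed.

End visits.

(** * The configuration is almost surely generic *)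

Lemma probability_small_null d (Omega : measurableType d) (R : realType)
  (P : probability Omega R) (A : set Omega) : measurable A ->
  (forall n : nat, (P A <= (n.+1%:R^-1)%:E)%E) -> P A = 0%E.
Proof.
move=> mA H; apply/eqP; rewrite eq_le measure_ge0 andbT leNgt; apply/negP => A0.
have Afin : P A \is a fin_num by rewrite fin_num_measure.
have fA : 0 < fine (P A) by rewrite fine_gt0// A0 ltey_eq Afin.
have := H (Num.truncn (fine (P A))^-1); rewrite -(fineK Afin) lee_fin leNgt => /negP; apply.
by rewrite invf_plt ?posrE// truncnS_gt.
Qed.

Section determined_points.
Context {d : measure_display} {Omega : measurableType d} {R : realType}.
Variables (P : probability Omega R) (r p : R) (w : Omega -> set (R * R)).
Hypothesis p01 : 0 < p <= 1.
Hypothesis wP : thinned_pair r P p w.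

Section one_function.
Variables (x0 q : R) (i j : code) (k : bool) (phi : R * R -> R).
Let D : set R := [set x | x < q].
Local Notation spot := (spot r D x0).
Local Notation sole := (sole r D).

Definition determined pi := [/\ sole i pi, sole j pi,
  {for (spot i pi, spot j pi), continuous phi}, q <= phi (spot i pi, spot j pi) &
  pi (phi (spot i pi, spot j pi), height r k)].

Definition rat_box (c : (rat * rat) * (rat * rat)) : set (R * R) :=
  [set z | ratr c.1.1 <= z.1 < ratr c.1.2 /\ ratr c.2.1 <= z.2 < ratr c.2.2].

(** An event that implies that the value of [phi] at the coded points is less than
    [t], and is equivalent to this if [phi] is continuous there. *)
Definition below t pi := sole i pi /\ (sole j pi /\ exists c,
  rat_box c `<=` [set z | phi z < t] /\
  (located r D x0 i [set x | ratr c.1.1 <= x < ratr c.1.2] pi /\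
   located r D x0 j [set x | ratr c.2.1 <= x < ratr c.2.2] pi)).

Lemma event_below t : event r D (below t).
Proof.
have mD : measurable D by exact: measurable_lt_set.
have mb (a b : R) : measurable [set x | a <= x < b] by exact: measurable_co.
apply: event_and; first exact: event_sole.
apply: event_and; first exact: event_sole.
apply: event_exists => c; apply: event_and; first exact: event_cst.
by apply: event_and; exact: event_located.
Qed.

Lemma below_le s t pi : s <= t -> below s pi -> below t pi.
Proof.
move=> st [si [sj [c [box loc]]]]; split=> //; split=> //; exists c; split=> // z /box /=.
by move/lt_le_trans; exact.
Qed.

Lemma below_lt t pi : below t pi -> phi (spot i pi, spot j pi) < t.
Proof.
move=> [si [sj [c [box [/(locatedP _ _ si) li /(locatedP _ _ sj) lj]]]]].
exact: (box (_, _)).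
Qed.

Lemma lt_below t pi : sole i pi -> sole j pi ->
  {for (spot i pi, spot j pi), continuous phi} ->
  phi (spot i pi, spot j pi) < t -> below t pi.
Proof.
move=> si sj cphi lt_; split=> //; split=> //.
have /nbhs_ballP[e /= e0 He] : nbhs (spot i pi, spot j pi) [set z | phi z < t].
  exact: (cvgr_lt _ cphi).
have e2 : 0 < e / 2 by rewrite divr_gt0.
have [a1 [b1 [ay yb Hy]]] := near_rat (spot i pi) e2.
have [a2 [b2 [az zb Hz]]] := near_rat (spot j pi) e2.
exists ((a1, b1), (a2, b2)); split; last first.
  by split; apply/(locatedP _ _) => //=; apply/andP.
move=> z [/Hy hy /Hz hz]; apply: He; split; rewrite /ball /= distrC.
  by apply: (le_lt_trans hy); lra.
by apply: (le_lt_trans hz); lra.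
Qed.

Lemma probability_occupied_le e n : 0 < e ->
  (P [set x | occupied r k (cell e q n) (w x)] <= e%:E)%E.
Proof.
move=> e0; pose A l' := if l' == k then cell e q n else set0.
have adA : admissible setT A.
  exact: (@cell_admissible R e setT q n (fun l' => l' == k)).
have [mA PA] := wP.2 _ adA.
rewrite (_ : [set x | _] = ~` (w @^-1` avoiding r A)); last first.
  apply/seteqP; split=> x /=.
    by move=> [y cy wy] H; apply: (H k y) wy; rewrite /A eqxx.
  move=> H; apply: contrapT => H'; apply: H => l' y; rewrite /A.
  by case: eqP => // -> cy wy; apply: H'; exists y.
rewrite probability_setC// PA -EFinB lee_fin /intensity.
have -> : (A false `&` A true = set0).
  by rewrite /A; case: (k) => /=; rewrite ?setI0 ?set0I.
have -> : ((A false `\` A true) `|` (A true `\` A false) = cell e q n).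
  by rewrite /A; case: (k) => /=; rewrite ?setD0 ?set0D ?setU0 ?set0U.
rewrite measure0 lebesgue_measure_cell//= addr0.
have := expR_ge1Dx (- ((1 - p / 2) * e)).
have : (1 - p / 2) * e <= 1 * e.
  by rewrite ler_pM2r// gerBl divr_ge0//; case/andP: p01 => /ltW.
by rewrite mul1r; lra.
Qed.

(** A position to the right of [q] that is computed from the configuration to the left
    of [q] is independent of the points to the right of [q]: it falls into an interval
    of length [e] which contains one of these with probability at most [e]. *)
Lemma ae_not_determined : {ae P, forall x, ~ determined (w x)}.
Proof.
pose e n : R := n.+1%:R^-1; have e0 n : 0 < e n by rewrite invr_gt0.
pose B n m pi := below (q + m.+1%:R * e n) pi /\ ~ below (q + m%:R * e n) pi.
have eB n m : event r D (B n m).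
  by apply: event_and; [|apply: event_not]; exact: event_below.
have eO n m : event r [set x | q <= x] (occupied r k (cell (e n) q m)).
  apply: event_occupied; [exact: measurable_co| |exact: co_bounded].
  by move=> x /andP[h1 _]; apply: le_trans h1; rewrite lerDl mulr_ge0// ltW.
have mB n m := event_measurable wP (eB n m); have mO n m := event_measurable wP (eO n m).
pose F n m := [set x | B n m (w x) /\ occupied r k (cell (e n) q m) (w x)].
have mF n m : measurable (F n m) by exact: (measurableI _ _ (mB n m) (mO n m)).
have mU n : measurable (\bigcup_m F n m) by exact: bigcup_measurable.
have PF n m : (P (F n m) <= (e n)%:E * P [set x | B n m (w x)])%E.
  rewrite /F (event_independent wP _ (eB n m) (eO n m)).
    by rewrite muleC lee_wpmul2r//; exact: probability_occupied_le.
  by apply/seteqP; split=> // x [h1 h2]; move: h1; rewrite /D /= ltNge h2.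
have PU n : (P (\bigcup_m F n m) <= (e n)%:E)%E.
  apply: (le_trans (measure_sigma_subadditive P (mF n) (mU n) (@subset_refl _ _))).
  apply: (@le_trans _ _ (\sum_(0 <= m <oo) ((e n)%:E * P [set x | B n m (w x)]))%E).
    by apply: lee_nneseries => m _ //; exact: PF.
  rewrite nneseriesZl// -[leRHS]mule1; apply: lee_wpmul2l; first by rewrite lee_fin ltW.
  apply: (probability_disjoint_le1 P (F := fun m => [set x | B n m (w x)])) => // m m' _ _.
  move=> [x [[Bm nBm] [Bm' nBm']]].
  have mono a a' : (a <= a')%N -> q + a%:R * e n <= q + a'%:R * e n.
    by move=> aa; rewrite lerD2l ler_pM2r// ler_nat.
  have [lt_|lt_|//] := ltngtP m m'; exfalso.
    exact/nBm'/(below_le (mono _ _ lt_) Bm).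
  exact/nBm/(below_le (mono _ _ lt_) Bm').
exists (\bigcap_n \bigcup_m F n m).
have mI : measurable (\bigcap_n \bigcup_m F n m) by exact: bigcap_measurable.
split=> //.
  apply: probability_small_null => // n; apply: le_trans (PU n).
  by apply: le_measure; rewrite ?inE// => x; apply.
move=> x /contrapT[si sj cphi qphi wphi] n _.
set V := phi _ in cphi qphi wphi.
have V0 : 0 <= (V - q) / e n by rewrite divr_ge0 ?subr_ge0// ltW.
have [V1 V2] := andP (truncn_itv V0).
rewrite ler_pdivlMr// in V1; rewrite ltr_pdivrMr// in V2.
exists (Num.truncn ((V - q) / e n)) => //; split.
  split; first by apply: lt_below => //; rewrite -/V; lra.
  by move=> /below_lt; rewrite -/V; lra.
by exists V => //; apply/andP; split; lra.
Qed.

End one_function.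
Definition kappa (o : option bool) : R :=
  if o is Some b then (if b then r ^+ 2 else - r ^+ 2) else 0.

(** Given the positions [z.1] and [z.2] of two of the points in a tie, the possible
    positions of the third one: at equal distances from them, or at the same distance
    from [z.1] as [z.2]. The correction [kappa] accounts for the points that are on
    different lines. *)
Definition tie_position (f : bool * bool * option bool) (z : R * R) : R :=
  if f.1.1 then (z.1 + z.2) / 2 - kappa f.2 / (2 * (z.1 - z.2))
  else z.1 + (-1) ^+ f.1.2 * Num.sqrt ((z.1 - z.2) ^+ 2 + kappa f.2).

Lemma tie_position_continuous (f : bool * bool * option bool) (z : R * R) : (f.1.1 -> z.1 != z.2) ->
  {for z, continuous (tie_position f)}.
Proof.
have c1 : {for z, continuous (fun z : R * R => z.1)} by exact: cvg_fst.
have c2 : {for z, continuous (fun z : R * R => z.2)} by exact: cvg_snd.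
case: f => [[[] e] o] /= H; rewrite /tie_position /=.
  apply: cvgB; first by apply: cvgM; [exact: cvgD|exact: cvg_cst].
  apply: cvgM; first exact: cvg_cst.
  apply: cvgV; first by rewrite mulf_neq0// subr_eq0 H.
  by apply: cvgM; [exact: cvg_cst|exact: cvgB].
apply: cvgD => //; apply: cvgM; first exact: cvg_cst.
apply: (continuous_comp (f := fun z : R * R => (z.1 - z.2) ^+ 2 + kappa o)); last exact: sqrt_continuous.
apply: cvgD; last exact: cvg_cst.
exact: (cvgM (cvgB c1 c2) (cvgB c1 c2)).
Qed.

Lemma determined_intro pi (x0 : rat) (y z : R) t (f : bool * bool * option bool) : tame r pi -> pi t ->
  (y = ratr x0 \/ (y < t.1 /\ exists2 u, pi u & u.1 = y)) ->
  (z = ratr x0 \/ (z < t.1 /\ exists2 u, pi u & u.1 = z)) ->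
  (f.1.1 -> y != z) -> t.1 = tie_position f (y, z) ->
  exists (q : rat) i j k, determined (ratr x0) (ratr q) i j k (tie_position f) pi.
Proof.
move=> tpi pit ysrc zsrc yz te.
pose left y' := if y' < t.1 then y' else t.1 - 1.
have leftt y' : left y' < t.1 by rewrite /left; case: ifPn => //; rewrite gtrBl.
have /rat_in_itvoo[q] : Num.max (left y) (left z) < t.1 by rewrite gt_max !leftt.
rewrite in_itv /= gt_max -andbA => /and3P[yq zq qt].
have rep y' : left y' < ratr q ->
    (y' = ratr x0 \/ (y' < t.1 /\ exists2 u, pi u & u.1 = y')) ->
    exists i, sole r [set x | x < ratr q] i pi /\ spot r [set x | x < ratr q] (ratr x0) i pi = y'.
  move=> yq' [->|[yt [u piu uy]]]; first by exists None.
  rewrite /left yt in yq'.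
  have [|i [si pti]] := @code_exists _ r [set x | x < ratr q] (ratr x0) true pi u tpi.
    by split=> //=; rewrite uy.
  by exists (Some i); split=> //; rewrite -uy -pti.
have [i [si yi]] := rep y yq ysrc; have [j [sj zj]] := rep z zq zsrc.
have [k tk] := height_surj tpi.1 pit.
exists q, i, j, k; split=> //; rewrite yi zj -?te.
- exact: tie_position_continuous.
- exact: ltW.
- by rewrite -tk.
Qed.

Lemma kappaB l m l' m' : exists o,
  (height r l - height r m) ^+ 2 - (height r l' - height r m') ^+ 2 = kappa o.
Proof.
have E l0 m0 : (height r l0 - height r m0) ^+ 2 = if l0 == m0 then 0 else r ^+ 2.
  by case: l0; case: m0 => /=; rewrite ?subrr ?expr0n ?subr0 ?sub0r ?sqrrN.
rewrite !E; case: eqP => _; case: eqP => _; rewrite ?subrr ?sub0r ?subr0.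
- by exists None.
- by exists (Some false).
- by exists (Some true).
- by exists None.
Qed.

(** In a tie the position of the rightmost point is a function of the positions of
    the other points, or of the other point and a rational number. *)
Lemma tie_determined pi s u v : 0 < r -> tame r pi -> pi s \/ grid_point r s ->
  pi u -> pi v -> u <> v -> sqdist s u = sqdist s v ->
  exists (x0 q : rat) i j k f, determined (ratr x0) (ratr q) i j k (tie_position f) pi.
Proof.
move=> r0 tpi; wlog vu : u v / v.1 < u.1.
  move=> WL ssrc piu piv uv e; have [lt_|lt_|e1] := ltgtP u.1 v.1.
  - by apply: (WL v u) => //; exact: nesym.
  - exact: (WL u v).
  exfalso; have [lu hu] := height_surj tpi.1 piu; have [lv hv] := height_surj tpi.1 piv.
  have [ls hs] : exists l, s.2 = height r l.
    by case: ssrc => [/tpi.1//|[t [l ->]]]; exists l.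
  move: e; rewrite /sqdist e1 => /addrI; rewrite hu hv /= hs.
  have E l0 m0 : (height r l0 - height r m0) ^+ 2 = if l0 == m0 then 0 else r ^+ 2.
    by case: l0; case: m0 => /=; rewrite ?subrr ?expr0n ?subr0 ?sub0r ?sqrrN.
  have r2 : r ^+ 2 != 0 by rewrite sqrf_eq0 gt_eqF.
  have luv : lu <> lv by move=> e; apply: uv; rewrite hu hv e1 e.
  rewrite !E; case: (ls) (lu) (lv) luv => -[] [] //= _ /eqP; rewrite ?(negbTE r2)// eq_sym ?(negbTE r2)//.
move=> ssrc piu piv uv e; have [lu hu] := height_surj tpi.1 piu; have [lv hv] := height_surj tpi.1 piv.
have [ls hs] : exists l, s.2 = height r l.
  by case: ssrc => [/tpi.1//|[t [l ->]]]; exists l.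
have root y x S : (x - y) ^+ 2 = S -> exists b : bool, x = y + (-1) ^+ b * Num.sqrt S.
  move=> <-; rewrite sqrtr_sqr; have [h|h] := leP 0 (x - y).
    by exists false; rewrite ger0_norm// mul1r subrKC.
  by exists true; rewrite ltr0_norm// mulN1r opprK subrKC.
have [c hc] := kappaB ls lv ls lu; have [c' hc'] := kappaB ls lu ls lv.
have e' : (s.1 - u.1) ^+ 2 + (height r ls - height r lu) ^+ 2 =
          (s.1 - v.1) ^+ 2 + (height r ls - height r lv) ^+ 2.
  by move: e; rewrite /sqdist hs hu hv.
have usrc (t : R * R) : t.1 < u.1 -> pi t -> t.1 < u.1 /\ exists2 u, pi u & u.1 = t.1.
  by move=> tu pit; split=> //; exists t.
have tie_at_u x0 : s.1 = ratr x0 \/ (s.1 < u.1 /\ exists2 u, pi u & u.1 = s.1) ->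
    exists (x0 q : rat) i j k f, determined (ratr x0) (ratr q) i j k (tie_position f) pi.
  move=> sx; have [b ub] : exists b : bool, u.1 = s.1 + (-1) ^+ b * Num.sqrt ((s.1 - v.1) ^+ 2 + kappa c).
    by apply: root; rewrite -sqrrN opprB -hc; lra.
  have [q [i [j [k H]]]] := @determined_intro pi x0 s.1 v.1 u (false, b, c) tpi piu sx
    (or_intror (usrc v vu piv)) (fun x => False_ind _ (notF x)) ub.
  by exists x0, q, i, j, k, (false, b, c).
case: ssrc => [pis|[x0 [l sE]]]; last by apply: (tie_at_u x0); left; rewrite sE.
have [su|us|su] := ltgtP s.1 u.1.
- by apply: (tie_at_u 0); right; split=> //; exists s.
- have vs : s.1 = tie_position (true, true, c) (u.1, v.1).
    rewrite /tie_position /= -hc.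
    have ne : u.1 - v.1 != 0 by rewrite subr_eq0 gt_eqF.
    have -> : (height r ls - height r lv) ^+ 2 - (height r ls - height r lu) ^+ 2 =
        (u.1 - v.1) * (u.1 + v.1 - 2 * s.1) by lra.
    by field.
  have [q [i [j [k H]]]] := @determined_intro pi 0 u.1 v.1 s (true, true, c) tpi pis
    (or_intror (conj us (ex_intro2 _ _ u piu erefl)))
    (or_intror (conj (lt_trans vu us) (ex_intro2 _ _ v piv erefl))) (fun=> negbT (gt_eqF vu)) vs.
  by exists 0, q, i, j, k, (true, true, c).
- have [b ub] : exists b : bool, u.1 = v.1 + (-1) ^+ b * Num.sqrt ((v.1 - v.1) ^+ 2 + kappa c').
    by apply: root; rewrite -hc'; rewrite su in e'; lra.
  have [q [i [j [k H]]]] := @determined_intro pi 0 v.1 v.1 u (false, b, c') tpi piu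
    (or_intror (usrc v vu piv)) (or_intror (usrc v vu piv)) (fun x => False_ind _ (notF x)) ub.
  by exists 0, q, i, j, k, (false, b, c').
Qed.

Lemma ae_no_ties : 0 < r -> {ae P, forall x, no_ties r (w x)}.
Proof.
move=> r0; pose I : countType := (rat * rat * code * code * bool * (bool * bool * option bool))%type.
have : {ae P, forall x, forall i : I, ~ determined (ratr i.1.1.1.1.1) (ratr i.1.1.1.1.2)
    i.1.1.1.2 i.1.1.2 i.1.2 (tie_position i.2) (w x)}.
  by apply: ae_forall_count => i; exact: ae_not_determined.
apply: filterS => x H s u v ssrc wu wv uv e.
have [x0 [q [i [j [k [f D]]]]]] := tie_determined r0 (wP.1 x) ssrc wu wv uv e.
exact: (H (x0, q, i, j, k, f)).
Qed.

Lemma ae_right_unbounded : {ae P, forall x, right_unbounded (w x)}.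
Proof.
pose A (n k : nat) (l : bool) : set R := cell k.+1%:R n%:R 0.
have k0 k : 0 < k.+1%:R :> R by [].
have adA n k : admissible setT (A n k).
  exact: (@cell_admissible R k.+1%:R setT n%:R 0 xpredT).
pose E n := \bigcap_k (w @^-1` avoiding r (A n k)).
have : {ae P, forall x, forall n : nat, ~ E n x}.
  apply: ae_forall_count => n; exists (E n).
  have mE : measurable (E n).
    by apply: bigcap_measurable => // k _; exact: (wP.2 _ (adA n k)).1.
  split=> //; last by move=> x /contrapT.
  apply: probability_small_null => // k.
  apply: (@le_trans _ _ (P (w @^-1` avoiding r (A n k)))).
    by apply: le_measure; rewrite ?inE//; [exact: (wP.2 _ (adA n k)).1|move=> x; apply].
  rewrite (wP.2 _ (adA n k)).2 lee_fin /intensity setDv setU0 measure0 mulr0 add0r setIid.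
  rewrite lebesgue_measure_cell//= expRN lef_pV2 ?posrE ?expR_gt0//.
  by have := expR_ge1Dx (k.+1%:R : R); lra.
apply: filterS => x H a; apply: contrapT => nu; apply: (H (Num.truncn `|a|).+1) => k _ l y.
rewrite /A /cell /= => /andP[ay _] wy; apply: nu; exists (y, height r l) => //=.
have := truncnS_gt `|a|; have := ler_norm a; move: ay; rewrite mul0r addr0; lra.
Qed.

Lemma ae_generic : 0 < r -> {ae P, forall x, generic r (w x)}.
Proof.
move=> r0; apply: filterS2 (ae_no_ties r0) ae_right_unbounded => x nt ru.
by have [piE lf] := wP.1 x; split.
Qed.

End determined_points.

(** * The law of the two thinned lines *)

Section poisson_sums.
Context {R : realType}.
Local Open Scope ereal_scope.

Definition poisson_weight (mu : R) k : R := mu ^+ k * k`!%:R^-1 * expR (- mu).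

Lemma poisson_prob_set1 (mu : R) k : (0 <= mu)%R ->
  poisson_prob mu 0 [set k] = (poisson_weight mu k)%:E.
Proof.
rewrite le_eqVlt /poisson_weight => /orP[/eqP <-|mu0].
  rewrite /poisson_prob ltxx diracE oppr0 expR0 mulr1.
  case: k => [|k]; first by rewrite mem_set// expr0 fact0 invr1 mulr1.
  by rewrite memNset//= expr0n mul0r.
by rewrite /poisson_prob mu0 esum_set1 /poisson_pmf ?mu0// lee_fin 2?mulr_ge0// exprn_ge0// ltW.
Qed.

Lemma poisson_weight_sum (mu : R) : (0 <= mu)%R ->
  \sum_(0 <= k <oo) (poisson_weight mu k)%:E = 1.
Proof.
move=> mu0; rewrite -(probability_setT (poisson_prob mu 0)).
rewrite (_ : [set: nat] = \bigcup_k [set k]); last by apply/seteqP; split=> // k _; exists k.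
rewrite measure_semi_bigcup//; last by move=> i j _ _ [x [/= -> ->]].
by apply: eq_eseriesr => k _; rewrite -poisson_prob_set1.
Qed.

(** Each point survives the thinning with probability [q]. *)
Lemma thinned_poisson_sum (q mu : R) : (0 <= q)%R -> (0 <= mu)%R ->
  \sum_(0 <= k <oo) (q ^+ k)%:E * (poisson_weight mu k)%:E =
  (expR (- ((1 - q) * mu)))%:E.
Proof.
move=> q0 mu0; rewrite (eq_eseriesr (g := fun k =>
    (expR (- ((1 - q) * mu)))%:E * (poisson_weight (q * mu) k)%:E)); last first.
  move=> k _; rewrite -!EFinM /poisson_weight exprMn; congr (_%:E).
  rewrite (_ : - mu = - ((1 - q) * mu) + - (q * mu))%R; last by ring.
  by rewrite expRD; ring.
rewrite nneseriesZl; last first.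
  by move=> k _; rewrite lee_fin !mulr_ge0// ?exprn_ge0 ?mulr_ge0// expR_ge0.
by rewrite poisson_weight_sum ?mule1// mulr_ge0.
Qed.

End poisson_sums.

Section attribution.
Context {d : measure_display} {Omega : measurableType d} {R : realType}.
Variables (P : probability Omega R) (r p : R) (Pihat : Omega -> set R).
Variables (X : nat -> {RV P >-> R}) (M : nat -> {RV P >-> (bool * bool)%type}).
Hypothesis p01 : 0 < p <= 1.
Hypothesis Poisson : homogeneous_poisson_process P 1 Pihat.
Hypothesis X_bij : {ae P, forall w, set_bij [set: nat] (Pihat w) (fun n => X n w)}.
Hypothesis M_law : forall n, [/\ P [set w | M n w = (true, true)] = (1 - p)%:E,
   P [set w | M n w = (true, false)] = (p / 2)%:E &
   P [set w | M n w = (false, true)] = (p / 2)%:E].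
Hypothesis XM_indep : mutually_independent P (fun o : option nat =>
  if o is Some n then sigma_fun (M n) else <<s \bigcup_n sigma_fun (X n) >>).
Local Open Scope ereal_scope.

Lemma probability_ae_eq (A B : set Omega) : measurable A -> measurable B ->
  {ae P, forall x, A x <-> B x} -> P A = P B.
Proof.
move=> mA mB AB; apply/eqP; rewrite eq_le; apply/andP.
by split; apply: probability_le_ae => //; apply: filterS AB => x [].
Qed.

Lemma measurable_bool_pair (b : bool * bool) : measurable [set b].
Proof.
rewrite (_ : [set b] = [set b.1] `*` [set b.2]); first exact: measurableX.
by apply/seteqP; split=> [_ ->//|[x y] [/= -> ->]]; rewrite -surjective_pairing.
Qed.

Lemma measurable_mark n (b : bool * bool) : measurable [set w | M n w = b].
Proof. exact: (measurable_funPTI (M n) (measurable_bool_pair b)). Qed.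

Lemma measurable_position n (S : set R) : measurable S -> measurable [set w | S (X n w)].
Proof. by move=> mS; exact: (measurable_funPTI (X n) mS). Qed.

Lemma ae_marked : {ae P, forall w, forall n, M n w <> (false, false)}.
Proof.
apply: ae_foralln => n; exists [set w | M n w = (false, false)]; split.
- exact: measurable_mark.
- have [tt tf ft] := M_law n; have mM := measurable_mark n.
  have : P (~` [set w | M n w = (false, false)]) = 1.
    rewrite (_ : ~` _ = [set w | M n w = (true, true)] `|`
      ([set w | M n w = (true, false)] `|` [set w | M n w = (false, true)])).
      rewrite !measureU//; last 2 first.
      - exact: measurableU.
      - by apply/seteqP; split=> // w /= [->] [].
      - transitivity ((1 - p)%:E + ((p / 2)%:E + (p / 2)%:E)).
          by congr (_ + (_ + _)); [exact: tt|exact: tf|exact: ft].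
        by rewrite -!EFinD; congr (_%:E); rewrite -splitr subrK.
      - by apply/seteqP; split=> // w /= [->].
    apply/seteqP; split=> w /=; first by case: (M n w) => -[] [] //=; auto.
    by move=> [->|[->|->]].
  move=> P1; have := probability_setC P (measurableC (mM (false, false))).
  by rewrite setCK P1 subee.
by move=> w /= /contrapT.
Qed.

Lemma measurable_count (A : set R) (c : \bar R) : measurable A ->
  measurable [set w | num_points Pihat A w = c].
Proof.
move=> mA; have [mN _ _] := Poisson.
by have := mN A mA measurableT _ (emeasurable_set1 c); rewrite setTI.
Qed.

Lemma count_law (A : set R) k : measurable A -> lebesgue_measure A < +oo ->
  P [set w | num_points Pihat A w = k%:R%:E] =
  (poisson_weight (fine (lebesgue_measure A)) k)%:E.
Proof.
move=> mA Afin; have [_ H _] := Poisson; rewrite H// mul1r poisson_prob_set1//.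
exact/fine_ge0.
Qed.

Lemma natE_inj (k k' : nat) : (k%:R%:E = k'%:R%:E :> \bar R) -> k = k'.
Proof. by move=> [] /eqP; rewrite eqr_nat => /eqP. Qed.

Lemma ae_count_finite (A : set R) : measurable A -> lebesgue_measure A < +oo ->
  {ae P, forall w, exists k : nat, num_points Pihat A w = k%:R%:E}.
Proof.
move=> mA Afin; pose E k := [set w | num_points Pihat A w = k%:R%:E].
have mE k : measurable (E k) by exact: measurable_count.
have mU : measurable (\bigcup_k E k) by exact: bigcup_measurable.
exists (~` \bigcup_k E k); split; first exact: measurableC.
  have P1 : P (\bigcup_k E k) = 1.
    rewrite measure_semi_bigcup//; last first.
      by move=> i j _ _ [w [/= Ei Ej]]; apply: natE_inj; rewrite -Ei -Ej.
    rewrite -(poisson_weight_sum (fine_ge0 (measure_ge0 lebesgue_measure A))).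
    by apply: eq_eseriesr => k _; exact: count_law.
  by rewrite probability_setC// P1 subee.
by move=> w /= nE [k _ Ek]; apply: nE; exists k.
Qed.

Lemma count_finite (A : set R) w (k : nat) : num_points Pihat A w = k%:R%:E ->
  (Pihat w `&` A #= `I_k)%card.
Proof.
rewrite /num_points /counting; case: asboolP => // fin [] /eqP; rewrite eqr_nat => /eqP <-.
by rewrite -{1}(fset_setK fin); exact/card_eq_fsetP.
Qed.

Lemma count_card (A : set R) w (k : nat) : (Pihat w `&` A #= `I_k)%card ->
  num_points Pihat A w = k%:R%:E.
Proof.
move=> Ak; rewrite /num_points /counting asboolT; last by apply/finite_setP; exists k.
by rewrite (card_fset_set Ak).
Qed.

Definition simple_marked w := [/\ set_bij [set: nat] (Pihat w) (fun n => X n w),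
  forall n, M n w <> (false, false) &
  forall k : nat, finite_set (Pihat w `&` [set x | `|x| <= k%:R]%R)].

Lemma ae_simple_marked : {ae P, forall w, simple_marked w}.
Proof.
have fin : {ae P, forall w, forall k : nat, finite_set (Pihat w `&` [set x | `|x| <= k%:R]%R)}.
  apply: ae_foralln => k; have kE : [set x | `|x| <= k%:R]%R = `[(- k%:R)%R, k%:R%R]%classic :> set R.
    by apply/seteqP; split=> x; rewrite /= in_itv /= ler_norml.
  have mI : measurable `[(- k%:R)%R, k%:R%R : R]%classic by exact: measurable_itv.
  apply: filterS (ae_count_finite mI _) => [w [n /count_finite cn]|].
    by apply/finite_setP; exists n; rewrite kE.
  by rewrite lebesgue_measure_itv /=; case: ifP => _; rewrite ?ltry// -EFinB ltry.
by apply: filterS3 X_bij ae_marked fin => w; split.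
Qed.

Definition on_line (l : bool) (b : bool * bool) := if l then b.2 else b.1.

Section avoidance.
Variable A : bool -> set R.
Hypothesis adA : admissible setT A.

Let mA l : measurable (A l). Proof. by case: (adA l). Qed.

Let only l := A l `\` A (~~ l).
Let single := only false `|` only true.
Let both := A false `&` A true.

Let m_only l : measurable (only l). Proof. exact: measurableD. Qed.
Let m_single : measurable single. Proof. exact: measurableU. Qed.
Let m_both : measurable both. Proof. exact: measurableI. Qed.

Definition avoided := [set w | forall n l, on_line l (M n w) -> ~ A l (X n w)].

Lemma measurable_avoided : measurable avoided.
Proof.
rewrite (_ : avoided = \bigcap_n (\bigcap_l (\bigcup_(b in [set b | on_line l b])
    [set w | M n w = b] `&` ~` [set w | A l (X n w)] `|` \bigcup_(b in [set b | ~~ on_line l b])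
    [set w | M n w = b]))); last first.
  apply/seteqP; split=> w /= H.
    move=> n _ l _; have [ol|nol] := boolP (on_line l (M n w)).
      by left; split; [exists (M n w)|exact: H].
    by right; exists (M n w).
  move=> n l ol; case: (H n I l I) => [[_ ]//|[b /= nol Mb]].
  by rewrite Mb in ol; rewrite ol in nol.
apply: bigcap_measurable => // n _; apply: fin_bigcap_measurable => // l _.
have mM b := measurable_mark n b.
apply: measurableU; last by apply: fin_bigcup_measurable.
apply: measurableI; first by apply: fin_bigcup_measurable.
by apply: measurableC; exact: measurable_position.
Qed.

(** The indices of the points in the two one-sided parts of [A], while the common
    part is empty. *)
Definition index_sets (I : {fset nat} * {fset nat}) := [set w | forall n,
  [/\ only false (X n w) <-> n \in I.1, only true (X n w) <-> n \in I.2 &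
      ~ both (X n w)]].

Let sX := <<s \bigcup_n sigma_fun (X n) >>.

Lemma index_sets_sigma I : sX (index_sets I).
Proof.
have [S0 SC SU] := smallest_sigma_algebra setT (\bigcup_n sigma_fun (X n)).
pose T n := (if n \in I.1 then only false else ~` only false) `&`
  ((if n \in I.2 then only true else ~` only true) `&` ~` both).
have mT n : measurable (T n).
  apply: measurableI; first by case: ifP => // _; exact: measurableC.
  apply: measurableI; last exact: measurableC.
  by case: ifP => // _; exact: measurableC.
have -> : index_sets I = setT `\` \bigcup_n (setT `\` (setT `&` X n @^-1` T n)).
  apply/seteqP; split=> w.
    move=> H; split=> // -[n _ [_]]; apply; split=> //; have [h1 h2 h3] := H n.
    split; first by case: ifP => [/h1|/negP nI /h1].
    by split=> //; case: ifP => [/h2|/negP nI /h2].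
  move=> [_ H] n; have [h1 [h2 h3]] : T n (X n w).
    by apply: contrapT => nT; apply: H; exists n => //; split=> // -[].
  split=> //.
    by move: h1; case: ifP => [h h'|h h']; split.
  by move: h2; case: ifP => [h h'|h h']; split.
apply: (SC); apply: SU => n; apply: SC; apply: sub_sigma_algebra.
by exists n => //; exists (T n).
Qed.

Lemma measurable_index_sets I : measurable (index_sets I).
Proof.
have : sX (index_sets I) by exact: index_sets_sigma.
apply: smallest_sub; first exact: sigma_algebra_measurable.
move=> B [n _ [S mS <-]]; rewrite setTI; exact: measurable_position.
Qed.

(** Given the index sets, avoiding [A] prescribes the marks of these indices, and the
    marks are independent of the positions. *)
Lemma avoided_index_sets I : P (avoided `&` index_sets I) =
  ((p / 2) ^+ #|` (I.1 `|` I.2)%fset|)%:E * P (index_sets I).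
Proof.
have [[n [n1 n2]]|dis] := pselect (exists n, n \in I.1 /\ n \in I.2).
  have -> : index_sets I = set0.
    apply/seteqP; split=> // w /(_ n)[/(iffRL)/(_ n1)[_ nA] /(iffRL)/(_ n2)[+ _] _].
    exact: nA.
  by rewrite setI0 measure0 mule0.
pose mk n := if n \in I.1 then (false, true) else (true, false).
pose E (o : option nat) := if o is Some n then [set w | M n w = mk n] else index_sets I.
pose J : {fset option nat} := (None |` [fset Some n | n in (I.1 `|` I.2)%fset])%fset.
transitivity (P (\bigcap_(o in [set` J]) E o)).
  have mE o : measurable (E o).
    by case: o => [n|] /=; [exact: measurable_mark|exact: measurable_index_sets].
  apply: probability_ae_eq.
  - by apply: measurableI; [exact: measurable_avoided|exact: measurable_index_sets].
  - by apply: fin_bigcap_measurable => // o _.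
  apply: filterS ae_marked => w mw; split.
    move=> [av ix] [n|] //= nJ.
    have {}nJ : n \in (I.1 `|` I.2)%fset.
      by move: nJ; rewrite !inE => /orP[//|/imfsetP[k + [->]]]; rewrite !inE.
    have [h1 h2 _] := ix n; rewrite /E /mk; case: ifP => n1.
      have /h1[An _] := n1; have := av n false; have := mw n.
      by case: (M n w) => -[] [] //= _ /(_ isT An).
    have n2 : n \in I.2 by move: nJ; rewrite inE n1.
    have /h2[An _] := n2; have := av n true; have := mw n.
    by case: (M n w) => -[] [] //= _ /(_ isT An).
  move=> H; have ix : index_sets I w.
    by apply: (H None); rewrite /= !inE.
  split=> // n l ol Al; have [h1 h2 nb] := ix n.
  have mkn : n \in (I.1 `|` I.2)%fset -> M n w = mk n.
    move=> nI; apply: (H (Some n)); rewrite /= !inE /=; apply/imfsetP.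
    by exists n => //; rewrite inE.
  case: l Al ol => Al.
    have /h2 n2 : only true (X n w) by split=> // Af; apply: nb.
    rewrite mkn ?inE ?n2 ?orbT// /mk; case: ifP => // n1.
    by exfalso; apply: dis; exists n.
  have /h1 n1 : only false (X n w) by split=> // Af; apply: nb.
  by rewrite mkn ?inE ?n1// /mk n1.
rewrite (XM_indep (J := J) (A := E)); last first.
  move=> [n|] _; last exact: index_sets_sigma.
  by exists [set mk n]; rewrite ?setTI//; exact: measurable_bool_pair.
rewrite big_fsetU1; last by apply/imfsetP => -[k].
rewrite big_imfset/=; last by move=> n n' _ _ [].
rewrite muleC; congr (_ * _).
rewrite (eq_bigr (fun=> (p / 2)%:E)); last first.
  by move=> n _; rewrite /E /mk; case: ifP => _; case: (M_law n).
by rewrite prodEFin big_const_seq count_predT iter_mulr_1.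
Qed.

Definition stratum_part k n : set Omega :=
  if (choice.pickle_inv n : option ({fset nat} * {fset nat})) is Some Is
  then [set w | index_sets Is w /\ #|` (Is.1 `|` Is.2)%fset| = k] else set0.

(** The index sets have [k] elements together: exactly [k] points lie in only one of
    the two sets, and none in both. *)
Definition stratum k := \bigcup_n stratum_part k n.

Let measurable_part k n : measurable (stratum_part k n).
Proof.
rewrite /stratum_part; case: choice.pickle_inv => // Is.
have [Ik|nIk] := pselect (#|` (Is.1 `|` Is.2)%fset| = k).
  rewrite (_ : [set w | _] = index_sets Is); first exact: measurable_index_sets.
  by apply/seteqP; split=> w // [].
by rewrite (_ : [set w | _] = set0)//; apply/seteqP; split=> w // [].
Qed.

Lemma measurable_stratum k : measurable (stratum k).
Proof. exact: bigcup_measurable. Qed.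

Let part_disjoint k : trivIset setT (stratum_part k).
Proof.
move=> i j _ _ [w []]; rewrite /stratum_part.
have := @choice.pickle_invK ({fset nat} * {fset nat})%type i.
have := @choice.pickle_invK ({fset nat} * {fset nat})%type j.
case: choice.pickle_inv => [Is'|//] /= <-; case: choice.pickle_inv => [Is|//] /= <- [wI _] [wI' _].
congr choice.pickle; rewrite (surjective_pairing Is) (surjective_pairing Is').
congr pair; apply/fsetP => n; have [h1 h2 _] := wI n; have [h1' h2' _] := wI' n.
  by apply/idP/idP => [/h1/h1'|/h1'/h1].
by apply/idP/idP => [/h2/h2'|/h2'/h2].
Qed.

Lemma avoided_stratum k : P (avoided `&` stratum k) = ((p / 2) ^+ k)%:E * P (stratum k).
Proof.
have mS := measurable_stratum k; have mV := measurable_avoided.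
have mVS n : measurable (avoided `&` stratum_part k n) by exact: measurableI.
have tVS : trivIset setT (fun n => avoided `&` stratum_part k n) by exact: trivIset_setIl.
have mU : measurable (\bigcup_n (avoided `&` stratum_part k n)) by exact: bigcup_measurable.
rewrite /stratum setI_bigcupr !measure_semi_bigcup//.
rewrite -nneseriesZl//; apply: eq_eseriesr => n _; rewrite /stratum_part.
case: choice.pickle_inv => [Is|]; last by rewrite setI0 measure0 mule0.
have [Ik|nIk] := pselect (#|` (Is.1 `|` Is.2)%fset| = k).
  rewrite (_ : [set w | _] = index_sets Is); last by apply/seteqP; split=> w // [].
  by rewrite -Ik; exact: avoided_index_sets.
rewrite (_ : [set w | _] = set0); last by apply/seteqP; split=> w // [].
by rewrite setI0 measure0 mule0.
Qed.

(** The index sets are finite because the number of points in [single] is; so the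
    strata can be described by the number of points alone. *)
Lemma stratumP k : {ae P, forall w, stratum k w <->
  num_points Pihat single w = k%:R%:E /\ num_points Pihat both w = 0%:R%:E}.
Proof.
apply: filterS ae_simple_marked => w [[Xim Xinj Xsurj] _ _].
pose idx S := [set n | S (X n w)].
have imE S : (fun n => X n w) @` idx S = Pihat w `&` S.
  apply/seteqP; split=> x; first by move=> [n Sn <-]; split=> //; exact: Xim.
  by move=> [/Xsurj[n _ <-] Sx]; exists n.
have idx_card S : (Pihat w `&` S #= idx S)%card.
  by rewrite -imE; apply: inj_card_eq => n n' _ _; apply: Xinj; rewrite ?inE.
have bothE : num_points Pihat both w = 0%:R%:E <-> forall n, ~ both (X n w).
  split=> [/count_finite|nb].
    rewrite II0 card_eq0 => /eqP e n bn.
    by have : (Pihat w `&` both) (X n w) by [split=> //; exact: Xim]; rewrite e.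
  apply: count_card; rewrite II0 card_eq0; apply/eqP; rewrite -imE.
  by apply/seteqP; split=> // x [n /nb].
rewrite bothE; split.
  move=> [i _]; rewrite /stratum_part; case: choice.pickle_inv => // Is [ix card_].
  split; last by move=> n; case: (ix n).
  apply: count_card; apply: (card_eq_trans (idx_card single)).
  rewrite (_ : idx single = [set` (Is.1 `|` Is.2)%fset]); first exact/card_eq_fsetP.
  apply/seteqP; split=> n; have [h1 h2 _] := ix n; rewrite /= inE.
    by move=> [/h1 ->//|/h2 ->]; rewrite orbT.
  by move=> /orP[/h1|/h2]; [left|right].
move=> [/count_finite cs nb].
have ck : (idx single #= `I_k)%card.
  by apply: (card_eq_trans _ cs); rewrite card_eq_sym.
have fin : finite_set (idx single) by apply/finite_setP; exists k.
have sE : idx single = idx (only false) `|` idx (only true) by [].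
have fin0 : finite_set (idx (only false)) by apply: sub_finite_set fin => n; left.
have fin1 : finite_set (idx (only true)) by apply: sub_finite_set fin => n; right.
pose Is := (fset_set (idx (only false)), fset_set (idx (only true))).
exists (choice.pickle Is) => //; rewrite /stratum_part choice.pickleK_inv; split.
  by move=> n; rewrite /= !in_fset_set// !inE; split=> //.
by rewrite /= -fset_setU// -sE; exact: card_fset_set.
Qed.

Let lebesgue_fin (S : set R) : (forall x, S x -> exists l, A l x) -> measurable S ->
  lebesgue_measure S < +oo.
Proof.
move=> SA mS; have [B HB] := admissible_bound adA.
by rewrite ltey_eq (@bounded_lebesgue_fin _ _ B)// => x /SA[l /HB].
Qed.

Let single_fin : lebesgue_measure single < +oo.
Proof. by apply: lebesgue_fin => // x [[Ax _]|[Ax _]]; [exists false|exists true]. Qed.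

Let both_fin : lebesgue_measure both < +oo.
Proof. by apply: lebesgue_fin => // x [Ax _]; exists false. Qed.

Lemma stratum_law k : P (stratum k) =
  (poisson_weight (fine (lebesgue_measure single)) k)%:E *
  (expR (- fine (lebesgue_measure both)))%:E.
Proof.
pose B (i : nat) : set R := if i == 0%N then single else if i == 1%N then both else set0.
have mB i : measurable (B i) by rewrite /B; case: ifP => // _; case: ifP.
have tB : trivIset setT B.
  apply/trivIsetP => i j _ _ ij; rewrite /B; apply/seteqP; split=> // x.
  case: i j ij => [|[|i]] [|[|j]] //= _ []; try by [move=> []|move=> _ []].
  - by move=> [[_ h]|[_ h]] [h1 h2]; apply: h.
  - by move=> [h1 h2] [[_ h]|[_ h]]; apply: h.
have [_ _ indep] := Poisson.
pose c i : \bar R := if i == 0%N then k%:R%:E else 0%:R%:E.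
pose E (i : nat) := [set w | num_points Pihat (B i) w = c i].
have mE i : measurable (E i) by exact: measurable_count.
transitivity (P (\bigcap_(i in [set` [fset 0%N; 1%N]%fset]) E i)).
  apply: probability_ae_eq; first exact: measurable_stratum.
    exact: fin_bigcap_measurable.
  apply: filterS (stratumP k) => w ->; split=> [[h1 h2] i|H].
    by rewrite /= !inE => /orP[] /eqP ->.
  by split; [apply: (H 0%N)|apply: (H 1%N)]; rewrite /= !inE.
rewrite (indep B mB tB); last first.
  by move=> i _; exists [set c i] => //; rewrite setTI.
rewrite big_fsetU1 ?inE// big_seq_fset1; congr (_ * _).
  exact: count_law.
rewrite /E /B /c /= (count_law 0)//.
by rewrite /poisson_weight expr0 fact0 invr1 mulr1 mul1r.
Qed.

(** A point that belongs to only one of the two sets lets the avoidance happen with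
    probability [p / 2], one that belongs to both prevents it. *)
Lemma avoided_law : P avoided = (expR (- intensity p A))%:E.
Proof.
have mV := measurable_avoided.
pose C k := [set w | num_points Pihat single w = k%:R%:E].
have mC k : measurable (C k) by exact: measurable_count.
have mVC k : measurable (avoided `&` C k) by exact: measurableI.
have mVS k : measurable (avoided `&` stratum k).
  by apply: measurableI => //; exact: measurable_stratum.
have mU : measurable (\bigcup_k (avoided `&` C k)) by exact: bigcup_measurable.
transitivity (P (\bigcup_k (avoided `&` C k))).
  apply: probability_ae_eq => //; apply: filterS (ae_count_finite m_single single_fin) => w [k Ck].
  by split=> [Vw|[j _ []//]]; exists k.
rewrite measure_semi_bigcup//; last first.
  by move=> i j _ _ [w [[_ Ci] [_ Cj]]]; apply: natE_inj; rewrite -Ci -Cj.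
pose mu := fine (lebesgue_measure single).
have mu0 : (0 <= mu)%R by exact: fine_ge0.
have q0 : (0 <= p / 2)%R by rewrite divr_ge0//; case/andP: p01 => /ltW.
rewrite (eq_eseriesr (g := fun k => (expR (- fine (lebesgue_measure both)))%:E *
   (((p / 2) ^+ k)%:E * (poisson_weight mu k)%:E))); last first.
  move=> k _; transitivity (P (avoided `&` stratum k)).
    apply: probability_ae_eq => //.
    apply: filterS2 (stratumP k) ae_simple_marked => w sk [Xb mw _].
    split=> -[Vw Ck]; split=> //; last by case/sk: Ck.
    apply/sk; split=> //; apply: count_card; rewrite II0 card_eq0; apply/eqP.
    apply/seteqP; split=> // x [wx [A0 A1]]; have [_ _ /(_ x wx)[n _ Xx]] := Xb.
    have := Vw n false; have := Vw n true; have := mw n; rewrite Xx.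
    by case: (M n w) => -[] [] //= _ V1 V0; [exact: V0|exact: V0|exact: V1].
  by rewrite avoided_stratum stratum_law -/mu muleA muleC.
rewrite nneseriesZl; last first.
  move=> k _; rewrite -EFinM lee_fin !mulr_ge0// ?exprn_ge0//; exact: expR_ge0.
by rewrite thinned_poisson_sum// -EFinM -expRD -opprD addrC.
Qed.

End avoidance.

End attribution.

Section lines.
Context {d : measure_display} {Omega : measurableType d} {R : realType}.
Variables (P : probability Omega R) (r p : R) (Pihat Pi0 Pir : Omega -> set R).
Hypothesis r_gt0 : 0 < r.
Hypothesis p01 : 0 < p <= 1.
Hypothesis Poisson : homogeneous_poisson_process P 1 Pihat.
Hypothesis attribution : independent_attribution P p Pihat Pi0 Pir.
Let Pi w := (Pi0 w `*` [set 0]) `|` (Pir w `*` [set r]).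

(** Emptying the configuration on a null set makes it tame everywhere. *)
Lemma thinned_pair_ae : exists2 w, thinned_pair r P p w & {ae P, forall x, w x = Pi x}.
Proof.
have [X [M [X_bij M_law XM_indep lines]]] := attribution.
have [N [mN N0 good]] : {ae P, forall w, simple_marked Pihat X M w /\
    (Pi0 w = [set X n w | n in [set n | (M n w).1]] /\
     Pir w = [set X n w | n in [set n | (M n w).2]])}.
  by apply: filterS2 (ae_simple_marked Poisson X_bij M_law) lines => w; split.
have {}good w : ~ N w -> simple_marked Pihat X M w /\
    forall l x, Pi w (x, height r l) <-> exists2 n, on_line l (M n w) & X n w = x.
  move=> nN; have [sm [e0 er]] : simple_marked Pihat X M w /\
    (Pi0 w = [set X n w | n in [set n | (M n w).1]] /\
     Pir w = [set X n w | n in [set n | (M n w).2]]).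
    by apply: contrapT => H; apply: nN; apply: good.
  split=> // l x; rewrite /Pi /= e0 er; split.
    case: l => -[] [] /= [n Mn Xn] h; try by exists n.
      by move: r_gt0; rewrite h ltxx.
    by move: r_gt0; rewrite -h ltxx.
  by case: l => -[n /= Mn Xn]; [right|left]; split=> //; exists n.
have twoPi w : two_lines r (Pi w).
  by move=> z [[_ ->]|[_ ->]]; [exists false|exists true].
pose w x := if x \in N then set0 else Pi x.
have wN x : N x -> w x = set0 by rewrite /w => Nx; rewrite mem_set.
have wPi x : ~ N x -> w x = Pi x by rewrite /w => Nx; rewrite memNset.
have aeN : {ae P, forall x, ~ N x} by exists N; split=> // x /= /contrapT.
exists w; last by apply: filterS aeN => x /wPi.
split=> [x|A adA].
  have [Nx|Nx] := pselect (N x).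
    rewrite wN//; split=> // a b; rewrite set0I; exact: finite_set0.
  rewrite wPi//; split=> // a b; have [[[Xim _ _] _ fin] lineE] := good x Nx.
  pose k := (Num.truncn (`|a| + `|b|)).+1; pose F := Pihat x `&` [set y | `|y| <= k%:R].
  have finL l : finite_set ((fun y => (y, height r l)) @` F) by exact/finite_image/fin.
  apply: (@sub_finite_set _ _ (((fun y => (y, height r false)) @` F) `|`
     ((fun y => (y, height r true)) @` F))); last by rewrite finite_setU.
  move=> z [Piz /= /andP[az zb]]; have [l zl] := height_surj (twoPi x) Piz.
  rewrite zl in Piz; have [n _ Xn] := (lineE l z.1).1 Piz.
  have Fz : F z.1.
    split; first by rewrite -Xn; exact: Xim.
    rewrite /= ler_norml; have := truncnS_gt (`|a| + `|b|); rewrite -/k.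
    have := ler_norm b; have := ler_norm (- a); rewrite normrN.
    have := normr_ge0 a; have := normr_ge0 b; move=> *; apply/andP; split; lra.
  by rewrite zl; case: (l); [right|left]; exists z.1.
have mV := measurable_avoided X M adA.
have E : w @^-1` avoiding r A = N `|` avoided X M A.
  apply/seteqP; split=> x; rewrite /preimage /=.
    have [Nx|Nx] := pselect (N x); first by left.
    rewrite wPi// => H; right=> n l Mn Al; apply: (H l _ Al).
    by apply/(good x Nx).2; exists n.
  have [Nx|Nx] := pselect (N x); first by rewrite wN// => _ l y _ [].
  rewrite wPi// => -[//|V] l y Aly /(good x Nx).2[n Mn Xn].
  by apply: (V n l Mn); rewrite Xn.
rewrite E; split; first exact: measurableU.
rewrite -(avoided_law p01 Poisson X_bij M_law XM_indep adA).
apply: probability_ae_eq => //; first exact: measurableU.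
by apply: filterS aeN => x Nx; split=> [[]|] //; right.
Qed.

End lines.

Theorem theorem3 (d : measure_display) (Omega : measurableType d)
    (R : realType) (P : probability Omega R) (r p : R)
    (Pihat Pi0 Pir : Omega -> set R)
    (Pi := fun w => (Pi0 w `*` [set 0]) `|` (Pir w `*` [set r])) :
  0 < r -> 0 < p <= 1 ->
  homogeneous_poisson_process P 1 Pihat ->
  independent_attribution P p Pihat Pi0 Pir ->
  {ae P, forall w,
    (exists S : nat -> R * R,
      greedy_walk euclidean_dist (Pi w) (0, 0) S) /\
    forall S : nat -> R * R,
      greedy_walk euclidean_dist (Pi w) (0, 0) S -> Pi w `<=` range S}.
Proof.
move=> r0 p01 Poisson attribution.
have [w wP wPi] := thinned_pair_ae r0 p01 Poisson attribution.
have gen w' (wP' : thinned_pair r P p w') := ae_generic p01 wP' r0.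
apply: filterS3 wPi (gen w wP) (ae_visits_all r0 p01 gen wP) => x.
rewrite -/(Pi x) => <- [_ lf _ ru] visits; split=> //.
by apply: greedy_walk_exists => // n q; exact: right_unbounded_unvisited.
Qed.
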